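(* Let $P_0=\begin{pmatrix} Q & S\\ S^T & R\end{pmatrix}\in\mathbb{S}^{2\nu}$ with $R\preceq0$ (blocks of size $\nu\times\nu$) and let $$\mathbf{V}=\left\{vI_k \;\middle|\; v\in\mathbb{C},\ \begin{pmatrix}I_\nu\\ vI_\nu\end{pmatrix}^{*}P_0\begin{pmatrix}I_\nu\\ vI_\nu\end{pmatrix}\succeq 0\right\}.$$ Then the uncertain interconnection $$\begin{pmatrix}\dot x(t)\\ z(t)\end{pmatrix}=\begin{pmatrix}A&B\\ C&D\end{pmatrix}\begin{pmatrix}x(t)\\ w(t)\end{pmatrix},\quad w(t)=\Delta(z)(t),\quad t\ge0,\quad \Delta\in\mathbf{\Delta}(\mathbf{V}),$$ is robustly stable if there exist $X\in\mathbb{S}^n$ and $M\in\mathbb{S}^{\nu k}$ satisfying $M\succ0$, $X\succ0$ and $$\begin{pmatrix} I&0\\ A&B\end{pmatrix}^T\begin{pmatrix}0&X\\ X&0\end{pmatrix}\begin{pmatrix} I&0\\ A&B\end{pmatrix}+\begin{pmatrix}C&D\\0&I\end{pmatrix}^TP(P_0,M)\begin{pmatrix}C&D\\0&I\end{pmatrix}\prec0,$$ where $$P(P_0,M):=\big(I_2\otimes\mathrm{vec}(I_\nu)\otimes I_k\big)^T(P_0\otimes M)\big(I_2\otimes\mathrm{vec}(I_\nu)\otimes I_k\big).$$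
   Context: $\mathbb{S}^n$ is the set of real symmetric $n\times n$ matrices; $\otimes$ is the Kronecker product; $\mathrm{vec}(S)$ is the vectorization of the matrix $S$ (a column vector); ${}^*$ is the conjugate transpose; $L_{2e}^n$ is the space of locally square integrable functions $[0,\infty)\to\mathbb{R}^n$; $\mathrm{RH}_\infty^{m\times n}$ is the space of real rational $m\times n$ matrices without poles in the extended closed right half-plane. $A\in\mathbb{R}^{n\times n}$, $B\in\mathbb{R}^{n\times l}$, $C\in\mathbb{R}^{k\times n}$, $D\in\mathbb{R}^{k\times l}$ are given real matrices (here $l=k$). Uncertainties: $\Delta$ is a stable LTI system with input-output map $\Delta:L_{2e}^k\to L_{2e}^l$, $$\Delta(z)(t)=\int_0^tC_\Delta e^{A_\Delta(t-s)}B_\Delta z(s)\,ds+D_\Delta z(t),$$ for some real matrices $A_\Delta,B_\Delta,C_\Delta,D_\Delta$. The same symbol denotes its transfer matrix $\Delta(s)=C_\Delta(sI-A_\Delta)^{-1}B_\Delta+D_\Delta$; stability means $\Delta\in\mathrm{RH}_\infty^{l\times k}$. For $\mathbf{V}\subset\mathbb{C}^{l\times k}$, $\mathbf{\Delta}(\mathbf{V})$ is the set of all such $\Delta$ with $\Delta(i\omega)\in\mathbf{V}$ for all $\omega\in\mathbb{R}\cup\{\infty\}$. Robust stability: the interconnection is robustly stable if it is well-posed, i.e., $\det(I-DV)\ne0$ for all $V\in\mathbf{V}$, and if there exists a constant $M_0>0$ such that the state-trajectories satisfy $\lim_{t\to\infty}x(t)=0$ and $\|x(t)\|\le M_0\|x(0)\|$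 for all $t\ge0$, for all initial conditions $x(0)\in\mathbb{R}^n$ and any $\Delta\in\mathbf{\Delta}(\mathbf{V})$. *)

(* Defs.v *)
From HB Require Import structures.
From mathcomp Require Import all_boot all_order all_algebra.
From mathcomp Require Import sesquilinear spectral.
From mathcomp Require Import complex mxtens.
From mathcomp Require Import all_classical all_reals all_analysis.

Set Implicit Arguments.
Unset Strict Implicit.
Unset Printing Implicit Defensive.

Import Order.TTheory GRing.Theory Num.Theory.
Import numFieldNormedType.Exports.

Local Open Scope classical_set_scope.
Local Open Scope ring_scope.

Definition mx_symmetric (R : realType) (n : nat) (M : 'M[R]_n) : Prop :=
  M^T = M.

Definition mx_posdef (R : realType) (n : nat) (M : 'M[R]_n) : Prop :=
  mx_symmetric M /\
  forall x : 'cV[R]_n, x != 0 -> 0 < (x^T *m M *m x) 0 0.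

Definition mx_negdef (R : realType) (n : nat) (M : 'M[R]_n) : Prop :=
  mx_symmetric M /\
  forall x : 'cV[R]_n, x != 0 -> (x^T *m M *m x) 0 0 < 0.

Definition mx_negsemidef (R : realType) (n : nat) (M : 'M[R]_n) : Prop :=
  mx_symmetric M /\
  forall x : 'cV[R]_n, (x^T *m M *m x) 0 0 <= 0.

Definition cmx (R : realType) (m n : nat) (M : 'M[R]_(m, n)) : 'M[R[i]]_(m, n) :=
  map_mx (real_complex R) M.

Definition ctr (R : realType) (m n : nat) (M : 'M[R[i]]_(m, n)) :
  'M[R[i]]_(n, m) := (M ^t*)%sesqui.

Definition cmx_possemidef (R : realType) (n : nat) (H : 'M[R[i]]_n) : Prop :=
  ctr H = H /\
  forall x : 'cV[R[i]]_n, 0 <= (ctr x *m H *m x) 0 0.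

(* [mxvec] enumerates entries row by row; transposing first gives the usual
   column-stacking vectorization. *)
Definition vec (R : realType) (m n : nat) (S : 'M[R]_(m, n)) : 'cV[R]_(n * m) :=
  (mxvec S^T)^T.

Lemma P_factor_rows (nu k : nat) :
  (2 * ((nu * nu) * k) = (nu + nu) * (nu * k))%N.
Proof. by rewrite mul2n -addnn !mulnDl !mulnA. Qed.

Lemma P_factor_cols (k : nat) : (2 * (1 * k) = k + k)%N.
Proof. by rewrite mul1n mul2n addnn. Qed.

(* The casts only identify equal dimensions: indices are lexicographic in
   [_ *t _], so they are unchanged by reassociation. *)
Definition P_factor (R : realType) (nu k : nat) :
    'M[R]_((nu + nu) * (nu * k), k + k) :=
  castmx (P_factor_rows nu k, P_factor_cols k)
    ((1%:M : 'M[R]_2) *t (vec (1%:M : 'M[R]_nu) *t (1%:M : 'M[R]_k))).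

Definition P_mult (R : realType) (nu k : nat)
    (P0 : 'M[R]_(nu + nu)) (M : 'M[R]_(nu * k)) : 'M[R]_(k + k) :=
  (P_factor R nu k)^T *m (P0 *t M) *m P_factor R nu k.

Definition V_set (R : realType) (nu k : nat) (P0 : 'M[R]_(nu + nu)) :
    set 'M[R[i]]_(k, k) :=
  [set V | exists v : R[i],
     V = v%:M /\
     let E := col_mx (1%:M : 'M[R[i]]_nu) v%:M in
     cmx_possemidef (ctr E *m cmx P0 *m E)].

Arguments V_set {R nu} k P0.

(* A point of the Riemann sphere is [Some s], or [None] for infinity.
   [rat_value f s v]: the real rational function [f] has no pole at [s] and
   takes the value [v] there. *)
Definition rat_value (R : realType) (f : {fraction {poly R}})
    (s : option R[i]) (v : R[i]) : Prop :=
  exists p q : {poly R}, [/\ q != 0, f = tofrac p / tofrac q &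
    match s with
    | Some s =>
        let ev (r : {poly R}) := (map_poly (real_complex R) r).[s] in
        ev q != 0 /\ v = ev p / ev q
    | None =>
        (size p <= size q)%N /\
        v = real_complex R (p`_(size q).-1 / lead_coef q)
    end].

Definition ext_closed_rhp (R : realType) : set (option R[i]) :=
  [set s | if s is Some s then 0 <= complex.Re s else True].

Definition ext_imag_axis (R : realType) : set (option R[i]) :=
  [set s | if s is Some s then complex.Re s = 0 else True].

Definition RHinf (R : realType) (m n : nat) :
    set 'M[{fraction {poly R}}]_(m, n) :=
  [set G : 'M[{fraction {poly R}}]_(m, n) | forall s, ext_closed_rhp s ->
           forall i j, exists v, rat_value (G i j) s v].

Record lti (R : realType) (l k : nat) := Lti {
  lti_order : nat;
  lti_A : 'M[R]_lti_order;
  lti_B : 'M[R]_(lti_order, k);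
  lti_C : 'M[R]_(l, lti_order);
  lti_D : 'M[R]_(l, k) }.

Definition transfer (R : realType) (l k : nat) (Delta : lti R l k) :
    'M[{fraction {poly R}}]_(l, k) :=
  let cst (m n : nat) (M : 'M[R]_(m, n)) :=
    map_mx (fun a : R => tofrac (a%:P)) M in
  cst _ _ (lti_C Delta)
    *m invmx ((tofrac 'X)%:M - cst _ _ (lti_A Delta))
    *m cst _ _ (lti_B Delta)
  + cst _ _ (lti_D Delta).

Definition expmx (R : realType) (n : nat) (A : 'M[R]_n) : 'M[R]_n :=
  limn (series (fun j : nat => (j`!%:R)^-1 *: A ^+ j)).

Definition io_map (R : realType) (l k : nat) (Delta : lti R l k)
    (z : R -> 'cV[R]_k) (t : R) : 'cV[R]_l :=
  \col_i (\int[lebesgue_measure]_(s in `[0, t])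
            (lti_C Delta *m expmx ((t - s) *: lti_A Delta)
               *m lti_B Delta *m z s) i 0)
  + lti_D Delta *m z t.

Definition Delta_set (R : realType) (l k : nat) (V : set 'M[R[i]]_(l, k)) :
    set (lti R l k) :=
  [set Delta | RHinf (transfer Delta) /\
     forall s, ext_imag_axis s ->
       exists2 W, V W & forall i j, rat_value (transfer Delta i j) s (W i j)].

Definition norm2 (R : realType) (n : nat) (x : 'cV[R]_n) : R :=
  Num.sqrt (\sum_i x i 0 ^+ 2).

(* Only the values on [0, +oo[ matter. *)
Definition L2e (R : realType) (n : nat) : set (R -> 'cV[R]_n) :=
  [set u : R -> 'cV[R]_n |
     (forall i, measurable_fun (`[0, +oo[ : set R) (fun t => u t i 0)) /\
     forall T : R, 0 <= T ->
       lebesgue_measure.-integrable `[0, T] (fun t => (norm2 (u t) ^+ 2)%:E)].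

Definition loc_abs_continuous (R : realType) (n : nat) (x : R -> 'cV[R]_n) :
    Prop :=
  forall T : R, 0 <= T -> forall e : R, 0 < e -> exists2 d : R, 0 < d &
    forall (N : nat) (a b : 'I_N -> R),
      (forall i, 0 <= a i /\ a i <= b i /\ b i <= T) ->
      (forall i j, i != j -> b i <= a j \/ b j <= a i) ->
      \sum_i (b i - a i) < d ->
      \sum_i norm2 (x (b i) - x (a i)) < e.

(* Elements of L2e are classes modulo a.e. equality, hence the a.e.
   quantifiers and the Caratheodory notion of solution for [x]. *)
Definition trajectory (R : realType) (n l k : nat)
    (A : 'M[R]_n) (B : 'M[R]_(n, l)) (C : 'M[R]_(k, n)) (D : 'M[R]_(k, l))
    (Delta : lti R l k)
    (x : R -> 'cV[R]_n) (z : R -> 'cV[R]_k) (w : R -> 'cV[R]_l) : Prop :=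
  [/\ loc_abs_continuous x, L2e z, L2e w &
   [/\ {ae lebesgue_measure, forall t : R, 0 < t ->
          is_derive t 1 x (A *m x t + B *m w t)},
       {ae lebesgue_measure, forall t : R, 0 <= t ->
          z t = C *m x t + D *m w t} &
       {ae lebesgue_measure, forall t : R, 0 <= t ->
          w t = io_map Delta z t}]].

Definition well_posed (R : realType) (l k : nat) (D : 'M[R]_(k, l))
    (V : set 'M[R[i]]_(l, k)) : Prop :=
  forall W, V W -> \det (1%:M - cmx D *m W) != 0.

Definition robustly_stable (R : realType) (n l k : nat)
    (A : 'M[R]_n) (B : 'M[R]_(n, l)) (C : 'M[R]_(k, n)) (D : 'M[R]_(k, l))
    (V : set 'M[R[i]]_(l, k)) : Prop :=
  well_posed D V /\
  exists2 M0 : R, 0 < M0 &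
    forall Delta : lti R l k, Delta_set V Delta ->
    forall x z w, trajectory A B C D Delta x z w ->
      x t @[t --> +oo] --> (0 : 'cV[R]_n) /\
      forall t : R, 0 <= t -> norm2 (x t) <= M0 * norm2 (x 0).

(* Main.v *)
Require Import Defs.
From mathcomp Require Import all_boot all_order all_algebra perm.
From mathcomp Require Import sesquilinear spectral.
From mathcomp Require Import complex mxtens.
From mathcomp Require Import all_classical all_reals all_analysis.
From mathcomp Require Import measurable_realfun.
From mathcomp Require Import ring lra zify.

(** The matrix inequality is a dissipation inequality: along the state
    equation, the derivative of [x^T X x] plus the form of [Pi = P_mult P0 M]
    at [(z, w)] is at most [- c (|x|^2 + |w|^2)] ([lmi_dissipation]). Robust
    stability follows once the uncertainty is given a nonnegative quadratic
    storage function for the supply rate [Pi], because the sum of the two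
    quadratic forms is then a Lyapunov function of the interconnection. The
    work goes into finding this storage function.

    The multiplier. If the scalar [v] satisfies the constraint defining
    [V_set], factoring [M] as [G] times its adjoint writes the form of [Pi] at
    [(u, v u)] as a sum of values of [P0] at vectors [(y, v y)], so that it is
    nonnegative ([P_mult_psd]). A singular [I - D V] would contradict this,
    since the matrix inequality at [x = 0] makes [Pi] negative at [(D w, w)]:
    the interconnection is well-posed. In the same way [Rb <= 0] makes [Pi]
    nonpositive at [(0, y)] ([P_mult_corner]).

    The uncertainty. As the values of its transfer matrix on the imaginary
    axis are multiples of the identity, the transfer matrix is a rational
    function [p / q] times the identity, [q] having no zero in the closed right
    half-plane ([scalar_transfer]). The realization that comes with the
    uncertainty need not be stable, but the input-output map depends only on
    its Markov parameters, so that the companion realization of [p / q],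
    tensored with the identity, may be used instead: its state matrix is
    Hurwitz ([hurwitz_realization], [io_map_response]).

    The storage function. On that realization the supply rate is nonnegative at
    every imaginary frequency, and the Kalman-Yakubovich-Popov inequality gives
    a symmetric [Y] ([kyp], [storage_exists]). It is proved by duality: without
    [Y] there would be a nonzero positive semidefinite [Z] in the dual
    alternative ([lmi_alternative]); a factor of [Z] can be rotated so that
    each column belongs to one imaginary frequency ([skew_gram_split]), and
    these columns contradict the frequency inequality. Since [Pi] is
    nonpositive at [(0, y)], [Y] satisfies a Lyapunov inequality for a Hurwitz
    matrix, whence [Y >= 0] ([lyapunov_nonneg]).

    The trajectories. The signals being only locally square integrable, the
    states are absolutely continuous and the equations hold almost everywhere.
    Let [xi] be the state of the uncertainty, which starts at [0]. For a small
    [eta > 0] the function [exp (eta t) (x^T X x + xi^T Y xi)] is absolutely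
    continuous with an almost everywhere nonpositive derivative
    ([energy_decrease]), hence nonincreasing ([ac_nonincreasing]). Its initial
    value is that of [x^T X x], which gives the uniform bound and the
    exponential decay of [x]. *)

Set Implicit Arguments.
Unset Strict Implicit.
Unset Printing Implicit Defensive.

Import Order.TTheory GRing.Theory Num.Theory.
Import numFieldNormedType.Exports.
Local Open Scope classical_set_scope.
Local Open Scope ring_scope.

(** * Quadratic forms and compactness *)

Section compact.
Variable R : realType.

Lemma continuous_sum (T : topologicalType) (I : finType) (F : I -> T -> R) :
  (forall i, continuous (F i)) -> continuous (fun x => \sum_i F i x).
Proof.
move=> cF x.
suff h (s : seq I) : \sum_(i <- s) F i y @[y --> x] --> \sum_(i <- s) F i x by exact: h.
elim: s => [|i s IH].
  by under eq_fun do rewrite big_nil; rewrite big_nil; exact: cvg_cst.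
under eq_fun do rewrite big_cons.
by rewrite big_cons; apply: cvgD; [exact: cF|exact: IH].
Qed.

Lemma continuous_mul (T : topologicalType) (f g : T -> R) :
  continuous f -> continuous g -> continuous (fun x => f x * g x).
Proof. by move=> cf cg x; apply: cvgM; [exact: cf|exact: cg]. Qed.

Lemma min_attained n (D : set 'rV[R]_n) (f : 'rV[R]_n -> R) :
  D !=set0 -> closed D -> (forall v, D v -> forall i, `|v 0 i| <= 1) ->
  continuous f -> exists2 c, D c & forall v, D v -> f c <= f v.
Proof.
move=> D0 cD bD cf.
have : compact D.
  apply: bounded_closed_compact => //; exists 1; split; first exact: num_real.
  move=> x x1 v /bD h /=; rewrite /Num.norm /= mx_normrE.
  apply: bigmax_le => [|[i j] _]; first by rewrite (le_trans ler01) // ltW.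
  by rewrite /= ord1 (le_trans (h j)) // ltW.
move=> /(EVT_min_rV D0) /(_ (continuous_subspaceT cf)) [c].
by rewrite inE => Dc cP; exists c => // v Dv; apply: cP; rewrite inE.
Qed.

Definition qf n (M : 'M[R]_n) (x : 'cV[R]_n) : R := (x^T *m M *m x) 0 0.

Lemma qf_tr n (M : 'M[R]_n) x : qf M x = \tr (M *m (x *m x^T)).
Proof. by rewrite mulmxA mxtrace_mulC /mxtrace big_ord1 mulmxA. Qed.

Lemma qfE n (M : 'M[R]_n) x : qf M x = \sum_i \sum_j M i j * x i 0 * x j 0.
Proof.
rewrite /qf mxE exchange_big /=; apply: eq_bigr => j _.
rewrite mxE mulr_suml; apply: eq_bigr => i _.
by rewrite !mxE [x i 0 * _]mulrC.
Qed.

Lemma continuous_tr n (C : 'M[R]_n) :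
  continuous (fun v : 'rV[R]_(n * n) => \tr (C *m vec_mx v)).
Proof.
rewrite (_ : (fun v : 'rV[R]_(n * n) => _) = fun v : 'rV[R]_(n * n) => \sum_i \sum_j C i j * v 0 (mxvec_index j i)).
  do 2 (apply: continuous_sum => ?); apply: continuous_mul; first exact: cst_continuous.
  exact: coord_continuous.
apply/funext => v; apply: eq_bigr => i _; rewrite mxE; apply: eq_bigr => j _.
by rewrite mxE.
Qed.

Definition normsq n (x : 'cV[R]_n) : R := \sum_i x i 0 ^+ 2.

Lemma normsq_ge0 n (x : 'cV[R]_n) : 0 <= normsq x.
Proof. by apply: sumr_ge0 => i _; exact: sqr_ge0. Qed.

Lemma normsq_gt0 n (x : 'cV[R]_n) : x != 0 -> 0 < normsq x.
Proof.
move=> x0; rewrite lt_neqAle normsq_ge0 andbT eq_sym.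
apply: contra x0; rewrite psumr_eq0 => [/allP h|i _]; last exact: sqr_ge0.
apply/eqP/matrixP => i j; rewrite ord1 mxE; apply/eqP.
by have := h i (mem_index_enum i); rewrite /= expf_eq0.
Qed.

Lemma normsq_tr n (x : 'cV[R]_n) : normsq x = \tr (x *m x^T).
Proof.
by apply: eq_bigr => i _; rewrite mxE big_ord1 mxE expr2.
Qed.

Lemma qfZ n (M : 'M[R]_n) c x : qf M (c *: x) = c ^+ 2 * qf M x.
Proof.
by rewrite /qf -scalemxAr mxE [(c *: x)^T]linearZ /= -!scalemxAl mxE mulrA expr2.
Qed.

Lemma normsqZ n c (x : 'cV[R]_n) : normsq (c *: x) = c ^+ 2 * normsq x.
Proof. by rewrite /normsq mulr_sumr; apply: eq_bigr => i _; rewrite mxE exprMn. Qed.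

(** Compactness of the unit sphere, and homogeneity. *)
Lemma qf_lower_bound n (M : 'M[R]_n) : (forall x, x != 0 -> 0 < qf M x) ->
  exists2 c, 0 < c & forall x, c * normsq x <= qf M x.
Proof.
move=> M0.
case: n M M0 => [|n] M M0.
  by exists 1 => // x; rewrite /normsq qfE !big_ord0 mulr0.
pose S := [set v : 'rV[R]_n.+1 | normsq v^T = 1].
have cf : continuous (fun v : 'rV[R]_n.+1 => qf M v^T).
  rewrite (_ : (fun v => _) = fun v : 'rV[R]_n.+1 => \sum_i \sum_j M i j * v 0 i * v 0 j).
    do 2 (apply: continuous_sum => ?); apply: continuous_mul; last exact: coord_continuous.
    by apply: continuous_mul; [exact: cst_continuous|exact: coord_continuous].
  by apply/funext => v; rewrite qfE; do 2 (apply: eq_bigr => ? _); rewrite !mxE.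
have S1 : S !=set0.
  exists (delta_mx 0 0); rewrite /S /= /normsq (bigD1 0) //= big1 => [|i i0].
    by rewrite !mxE /= expr1n addr0.
  by rewrite !mxE eqxx /= (negbTE i0) expr0n.
have cS : closed S.
  apply: (preimage_closed (f := fun v : 'rV[R]_n.+1 => normsq v^T) (D := [set x : R | x = 1])).
    move=> v _; move: v; rewrite (_ : (fun v => _) = fun v : 'rV[R]_n.+1 => \sum_i v 0 i * v 0 i).
      by apply: continuous_sum => i; apply: continuous_mul; exact: coord_continuous.
    by apply/funext => v; apply: eq_bigr => i _; rewrite mxE expr2.
  exact: closed_eq.
have bS v : S v -> forall i, `|v 0 i| <= 1.
  move=> vS i; rewrite -(@ler_pXn2r _ 2) ?nnegrE // expr1n real_normK ?num_real //.
  rewrite -vS /normsq (bigD1 i) //= mxE lerDl.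
  by apply: sumr_ge0 => j _; exact: sqr_ge0.
have [v vS vP] := min_attained S1 cS bS cf.
have v0 : v^T != 0.
  apply/eqP => v0; move: vS; rewrite /S /= v0 /normsq big1 => [/eqP|i _].
    by rewrite eq_sym oner_eq0.
  by rewrite mxE expr0n.
exists (qf M v^T); first exact: M0.
move=> x; have [->|x0] := eqVneq x 0.
  by rewrite -(scale0r 0) normsqZ qfZ expr0n /= !mul0r mulr0.
have s0 := normsq_gt0 x0.
pose r := (Num.sqrt (normsq x))^-1.
have r2 : r ^+ 2 = (normsq x)^-1 by rewrite exprVn sqr_sqrtr // ltW.
have := vP (r *: x)^T; rewrite /S /= trmxK normsqZ qfZ r2 mulVf ?gt_eqF //.
by move=> /(_ erefl); rewrite mulrC ler_pdivlMr // mulrC.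
Qed.

Lemma qf_upper_bound n (M : 'M[R]_n) :
  exists2 c, 0 < c & forall x, `|qf M x| <= c * normsq x.
Proof.
pose K := \sum_i \sum_j `|M i j|.
have K0 : 0 <= K by do 2 (apply: sumr_ge0 => ? _).
exists (K + 1); first by rewrite ltr_wpDl.
move=> x; apply: (@le_trans _ _ (K * normsq x)); last first.
  by rewrite ler_wpM2r ?normsq_ge0 // lerDl.
rewrite qfE (le_trans (ler_norm_sum _ _ _)) // /K mulr_suml ler_sum // => i _.
rewrite (le_trans (ler_norm_sum _ _ _)) // mulr_suml ler_sum // => j _.
rewrite -mulrA normrM ler_wpM2l // normrM.
have le l : `|x l 0| ^+ 2 <= normsq x.
  rewrite real_normK ?num_real // /normsq (bigD1 l) //= lerDl.
  by apply: sumr_ge0 => ? _; exact: sqr_ge0.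
by have := le i; have := le j; have := sqr_ge0 (`|x i 0| - `|x j 0|); nra.
Qed.
End compact.

(** * A theorem of the alternative for linear matrix inequalities *)

Section lmi.
Variable R : realType.

Lemma qfDl n (M N : 'M[R]_n) x : qf (M + N) x = qf M x + qf N x.
Proof. by rewrite /qf mulmxDr mulmxDl mxE. Qed.

Lemma qfZl n c (M : 'M[R]_n) x : qf (c *: M) x = c * qf M x.
Proof. by rewrite /qf -scalemxAr -scalemxAl mxE. Qed.

Lemma qf_suml n (I : finType) (y : I -> R) (L : I -> 'M[R]_n) x :
  qf (\sum_i y i *: L i) x = \sum_i y i * qf (L i) x.
Proof.
rewrite /qf mulmx_sumr mulmx_suml summxE; apply: eq_bigr => i _.
by rewrite -scalemxAr -scalemxAl mxE.
Qed.

(** First-order optimality: if a quadratic function of [t] is nonnegative just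
    to the right of its zero [t = 0], so is its slope there. *)
Lemma slope_ge0 (a K : R) :
  (forall t, 0 < t <= 1 -> 0 <= 2 * t * a + t ^+ 2 * K) -> 0 <= a.
Proof.
move=> h; rewrite leNgt; apply/negP => a0.
pose t := Num.min 1 (- a / (`|K| + 1)).
have K1 : 0 < `|K| + 1 by rewrite ltr_wpDl.
have t0 : 0 < t by rewrite lt_min ltr01 divr_gt0 // oppr_gt0.
have t1 : t <= 1 by rewrite ge_min lexx.
have tK : t * (`|K| + 1) <= - a by rewrite -ler_pdivlMr // ge_min lexx orbT.
have := h t (introT andP (conj t0 t1)).
have KK : K <= `|K| := ler_norm K.
have tK' : t * K <= t * `|K| by rewrite ler_wpM2l // ltW.
rewrite (_ : _ + _ = t * (2 * a + t * K)); last by ring.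
rewrite pmulr_rge0 //; nra.
Qed.

(** Separation of convex sets, through a minimisation over a compact set. On
    the matrices [Z] that are positive semidefinite of trace 1, the function
    [phi], a sum of squares, vanishes exactly at the [Z] of the second
    alternative. If its minimum is positive, first-order optimality at the
    minimiser, tested on the rank one matrices [x x^T / |x|^2], reads as a
    positive lower bound for a combination of the quadratic forms [L i] and
    [S0] at [x], and its coefficients give the first alternative. *)
Lemma lmi_alternative N (I : finType) (S0 : 'M[R]_N) (L : I -> 'M[R]_N) :
  (exists y : I -> R, forall x, x != 0 -> 0 < qf (S0 + \sum_i y i *: L i) x) \/
  (exists Z : 'M[R]_N, [/\ Z^T = Z, forall x, 0 <= qf Z x, Z != 0,
     forall i, \tr (L i *m Z) = 0 & \tr (S0 *m Z) <= 0]).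
Proof.
case: N S0 L => [|N] S0 L.
  by left; exists (fun=> 0) => x /eqP[]; apply/matrixP => -[].
pose D := [set v : 'rV[R]_(N.+1 * N.+1) | [/\ (vec_mx v)^T = vec_mx v :> 'M[R]_N.+1,
   forall x, 0 <= qf (vec_mx v) x & \tr (vec_mx v : 'M[R]_N.+1) = 1] ].
pose phi (v : 'rV[R]_(N.+1 * N.+1)) := \sum_i (\tr (L i *m vec_mx v)) ^+ 2 +
   (Num.max 0 (\tr (S0 *m vec_mx v))) ^+ 2.
have rank1 (x : 'cV[R]_N.+1) : x != 0 -> D (mxvec ((normsq x)^-1 *: (x *m x^T))).
  move=> x0; have s0 := normsq_gt0 x0; split; rewrite mxvecK.
  - by rewrite linearZ /= trmx_mul trmxK.
  - move=> y; rewrite qfZl mulr_ge0 ?invr_ge0 ?(ltW s0) //.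
    rewrite /qf mulmxA -mulmxA -[x^T *m y]trmxK trmx_mul trmxK.
    by rewrite mxE big_ord1 [(_^T) _ _]mxE -expr2 sqr_ge0.
  - by rewrite linearZ /= -normsq_tr mulVf // gt_eqF.
have D0 : D !=set0.
  pose e0 : 'cV[R]_N.+1 := delta_mx 0 0.
  exists (mxvec ((normsq e0)^-1 *: (e0 *m e0^T))).
  apply: rank1; apply/eqP => /matrixP /(_ 0 0) /eqP.
  by rewrite !mxE /= oner_eq0.
have diag (v : 'rV[R]_(N.+1 * N.+1)) i : D v -> 0 <= (vec_mx v : 'M[R]_N.+1) i i.
  move=> [_ /(_ (delta_mx i 0)) + _].
  by rewrite /qf trmx_delta -rowE -colE !mxE.
have bD v : D v -> forall l, `|v 0 l| <= 1.
  move=> Dv l; have [sym psd tr1] := Dv.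
  rewrite -[v]vec_mxK; move: (vec_mx v) sym psd tr1 (fun l => diag v l Dv) => Z sym psd tr1 dg.
  case/mxvec_indexP: l => i j; rewrite mxvecE.
  have d1 (l : 'I_N.+1) : Z l l <= 1.
    by rewrite -tr1 /mxtrace (bigD1 l) //= lerDl sumr_ge0.
  have sij : Z j i = Z i j by rewrite -[in RHS]sym mxE.
  have e (s : R) : qf Z (delta_mx i 0 + s *: delta_mx j 0) =
     Z i i + 2 * s * Z i j + s ^+ 2 * Z j j.
    rewrite /qf (_ : _^T = delta_mx 0 i + s *: delta_mx 0 j); last first.
      by rewrite [LHS]linearD /= linearZ /= !trmx_delta.
    rewrite !mulmxDl !mulmxDr -!scalemxAl -!scalemxAr.
    rewrite -!rowE -!colE !mxE sij; ring.
  have := psd (delta_mx i 0 + 1 *: delta_mx j 0); rewrite e expr1n.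
  have := psd (delta_mx i 0 + (-1) *: delta_mx j 0); rewrite e sqrrN expr1n.
  have := d1 i; have := d1 j; rewrite ler_norml => *; apply/andP; split; lra.
have cD : closed D.
  have -> : D = \bigcap_(ij in [set: 'I_N.+1 * 'I_N.+1]) [set v : 'rV[R]_(N.+1 * N.+1) |
       \tr ((delta_mx ij.1 ij.2 - delta_mx ij.2 ij.1) *m vec_mx v) = 0] `&`
     (\bigcap_(x in [set: 'cV[R]_N.+1]) [set v : 'rV[R]_(N.+1 * N.+1) | 0 <= \tr ((x *m x^T) *m vec_mx v)] `&`
     [set v : 'rV[R]_(N.+1 * N.+1) | \tr (1%:M *m vec_mx v) = 1]).
    have trd (i j : 'I_N.+1) (Z : 'M[R]_N.+1) : \tr (delta_mx i j *m Z) = Z j i.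
      rewrite -(mul_delta_mx (0 : 'I_1)) -mulmxA mxtrace_mulC /mxtrace big_ord1.
      by rewrite -rowE -colE !mxE.
    have qx (v : 'rV[R]_(N.+1 * N.+1)) x : qf (vec_mx v) x = \tr ((x *m x^T) *m vec_mx v).
      by rewrite qf_tr mxtrace_mulC.
    apply/seteqP; split => v /=.
      move=> [sym psd tr1]; split; [|split].
      - move=> [i j] _ /=; rewrite mulmxBl raddfB /= !trd; apply/eqP.
        by rewrite subr_eq0 -[in X in X == _]sym mxE.
      - by move=> x _ /=; rewrite -qx.
      - by rewrite mul1mx.
    move=> [sym [psd tr1]]; split.
    - apply/matrixP => i j; have := sym (i, j) Logic.I.
      by rewrite /= mulmxBl raddfB /= !trd => /eqP; rewrite subr_eq0 [(_^T) _ _]mxE => /eqP.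
    - by move=> x; rewrite qx; exact: psd.
    - by rewrite -[X in \tr X]mul1mx.
  apply: closedI; last apply: closedI.
  - apply: closed_bigI => ij _.
    apply: (preimage_closed (D := [set x : R | x = 0])) => [v _|]; last exact: closed_eq.
    exact: continuous_tr.
  - apply: closed_bigI => x _.
    apply: (preimage_closed (D := [set x : R | 0 <= x])) => [v _|]; last exact: closed_ge.
    exact: continuous_tr.
  - apply: (preimage_closed (D := [set x : R | x = 1])) => [v _|]; last exact: closed_eq.
    exact: continuous_tr.
have cphi : continuous phi.
  have cmax : continuous (fun v : 'rV[R]_(N.+1 * N.+1) => Num.max 0 (\tr (S0 *m vec_mx v))).
    move=> v; apply: (@continuous_max _ _ (fun=> 0) (fun v => \tr (S0 *m vec_mx v))).
      exact: cst_continuous.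
    exact: continuous_tr.
  have csum : continuous (fun v : 'rV[R]_(N.+1 * N.+1) => \sum_i (\tr (L i *m vec_mx v)) ^+ 2).
    apply: continuous_sum => i.
    apply: (continuous_mul (f := fun v => \tr (L i *m vec_mx v)) (g := fun v => \tr (L i *m vec_mx v))); exact: continuous_tr.
  have cmm := continuous_mul cmax cmax.
  by move=> v; exact: (cvgD (csum v) (cmm v)).
have [v Dv vmin] := min_attained D0 cD bD cphi.
(* [a] and [tau] are, up to a factor 2, the derivatives of [phi] with respect
   to the traces it is made of. *)
pose Z := vec_mx v : 'M[R]_N.+1.
pose a i := \tr (L i *m Z); pose s := \tr (S0 *m Z); pose tau := Num.max 0 s.
have tau0 : 0 <= tau by rewrite le_max lexx.
have taus : tau * s = tau ^+ 2.
  by rewrite /tau; case: (leP 0 s) => _; [rewrite expr2|rewrite mul0r expr0n].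
have phiE : phi v = \sum_i a i ^+ 2 + tau ^+ 2 by [].
have phi0 : 0 <= phi v.
  by rewrite phiE addr_ge0 ?sqr_ge0 // sumr_ge0 // => i _; exact: sqr_ge0.
have [sym psd tr1] := Dv.
have [pz|pnz] := eqVneq (phi v) 0.
  right; exists Z; move/eqP: pz; rewrite phiE paddr_eq0 ?sqr_ge0 //; last first.
    by rewrite sumr_ge0 // => i _; exact: sqr_ge0.
  rewrite expf_eq0 /= psumr_eq0 => [/andP[/allP az /eqP tz]|i _]; last exact: sqr_ge0.
  split => //.
  - apply/eqP => Z0; move: tr1; rewrite -/Z Z0 raddf0 => /eqP.
    by rewrite eq_sym oner_eq0.
  - by move=> i; have := az i (mem_index_enum i); rewrite /= expf_eq0 /= => /eqP.
  - by move: tz; rewrite /tau => tz; rewrite -[leRHS]tz le_max lexx orbT.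
left; have {}phi0 : 0 < phi v by rewrite lt_neqAle eq_sym pnz.
(* Optimality of [v] along the segment towards [w]. *)
have key w : D w -> phi v <= \sum_i a i * \tr (L i *m vec_mx w) + tau * \tr (S0 *m vec_mx w).
  move=> Dw; pose W := vec_mx w : 'M[R]_N.+1.
  pose b i := \tr (L i *m W) - a i; pose r := \tr (S0 *m W) - s.
  suff : 0 <= \sum_i a i * b i + tau * r.
    rewrite phiE /b /r (eq_bigr (fun i => a i * \tr (L i *m W) - a i ^+ 2)) => [|i _]; last first.
      by rewrite mulrBr expr2.
    by rewrite sumrB mulrBr taus -/W; lra.
  apply: (@slope_ge0 _ (\sum_i b i ^+ 2 + r ^+ 2)) => t /andP[t0 t1].
  have [symW psdW trW] := Dw.
  have Dt : D (v + t *: (w - v)).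
    rewrite /D /= linearD linearZ linearB /= -/Z -/W; split.
    - by rewrite linearD linearZ linearB /= -/Z -/W sym symW.
    - move=> x; rewrite qfDl qfZl qfDl -[- Z]scaleN1r qfZl.
      have := psd x; have := psdW x; rewrite -/W -/Z => h1 h2.
      have : 0 <= (1 - t) * qf Z x by rewrite mulr_ge0 // subr_ge0.
      have : 0 <= t * qf W x by rewrite mulr_ge0 // ltW.
      by lra.
    - by rewrite mxtraceD mxtraceZ raddfB /= tr1 trW subrr mulr0 addr0.
  have := vmin _ Dt; rewrite phiE /phi linearD linearZ linearB /= -/Z -/W.
  have tL M : \tr (M *m (Z + t *: (W - Z))) = \tr (M *m Z) + t * (\tr (M *m W) - \tr (M *m Z)).
    by rewrite mulmxDr -scalemxAr mulmxBr mxtraceD mxtraceZ raddfB.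
  rewrite tL -/s -/r; under [X in _ <= X + _]eq_bigr do rewrite tL -/(a _) -/(b _) sqrrD.
  have : Num.max 0 (s + t * r) ^+ 2 <= (tau + t * r) ^+ 2.
    rewrite /tau; case: (leP 0 s) => s0; case: (leP 0 (s + t * r)) => str //.
    - by rewrite expr0n /= sqr_ge0.
    - by rewrite add0r; nra.
    - by rewrite expr0n /= sqr_ge0.
  rewrite !big_split /= => h1 h2.
  have e1 : \sum_i a i * (t * b i) = t * \sum_i a i * b i.
    by rewrite mulr_sumr; apply: eq_bigr => i _; rewrite mulrCA.
  have e2 : \sum_i (t * b i) ^+ 2 = t ^+ 2 * \sum_i b i ^+ 2.
    by rewrite mulr_sumr; apply: eq_bigr => i _; rewrite exprMn.
  move: h2; rewrite e1 e2 => h2.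
  have e3 : (tau + t * r) ^+ 2 = tau ^+ 2 + 2 * t * (tau * r) + t ^+ 2 * r ^+ 2 by ring.
  move: h1 h2; rewrite e3.
  move: (\sum_i a i * b i) (\sum_i b i ^+ 2) (\sum_i a i ^+ 2) (Num.max 0 (s + t * r) ^+ 2).
  move=> p q u m h1 h2; clear -h1 h2; lra.
have keyx x : x != 0 -> phi v * normsq x <= \sum_i a i * qf (L i) x + tau * qf S0 x.
  move=> x0; have s0 := normsq_gt0 x0.
  have := key _ (rank1 x x0); rewrite mxvecK.
  have tq M : \tr (M *m ((normsq x)^-1 *: (x *m x^T))) = (normsq x)^-1 * qf M x.
    by rewrite -scalemxAr mxtraceZ -qf_tr.
  rewrite tq; under eq_bigr do rewrite tq mulrCA.
  by rewrite -mulr_sumr mulrCA -mulrDr mulrC ler_pdivlMr.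
(* If [tau = 0], the forms [L i] alone have a positive definite combination,
   and a large multiple of it dominates [S0]. *)
have [tz|tnz] := eqVneq tau 0.
  have [K K0 KP] := qf_upper_bound S0.
  exists (fun i => (K + 1) / phi v * a i) => x x0.
  have s0 := normsq_gt0 x0.
  rewrite qfDl (eq_bigr (fun i => ((K + 1) / phi v * a i) *: L i)) // qf_suml.
  rewrite (eq_bigr (fun i => (K + 1) / phi v * (a i * qf (L i) x))) => [|i _]; last first.
    by rewrite mulrA.
  rewrite -mulr_sumr; have := keyx x x0; rewrite tz mul0r addr0 => h.
  have : (K + 1) * normsq x <= (K + 1) / phi v * \sum_i a i * qf (L i) x.
    have -> : (K + 1) * normsq x = (K + 1) / phi v * (phi v * normsq x).
      by rewrite mulrA divfK.
    by rewrite ler_wpM2l // divr_ge0 // ltW // ltr_wpDl // ltW.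
  by have := KP x; rewrite ler_norml => /andP[? _]; lra.
have {tnz}tpos : 0 < tau by rewrite lt_neqAle eq_sym tnz.
exists (fun i => a i / tau) => x x0.
rewrite qfDl qf_suml -(pmulr_rgt0 _ tpos) mulrDr mulr_sumr.
under eq_bigr do rewrite mulrA mulrCA divff ?gt_eqF // mulr1.
rewrite addrC; apply: lt_le_trans (keyx x x0).
by rewrite mulr_gt0 // normsq_gt0.
Qed.
End lmi.


(** * Gram matrices and unitary factors *)

Section unitary.
Import Num.Def.
Local Open Scope sesquilinear_scope.
Variable C : numClosedFieldType.

Local Notation "B ^!" :=
  (orthomx conjC (mx_of_hermitian (hermitian1mx _)) B) : matrix_set_scope.

Lemma adjmx_mul m n p (A : 'M[C]_(m, n)) (B : 'M[C]_(n, p)) :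
  (A *m B)^t* = B^t* *m A^t*.
Proof. by rewrite trmx_mul map_mxM. Qed.

Lemma adjmxD m n (A B : 'M[C]_(m, n)) : (A + B)^t* = A^t* + B^t*.
Proof. by rewrite linearD map_mxD. Qed.

Lemma adjmxN m n (A : 'M[C]_(m, n)) : (- A)^t* = - A^t*.
Proof. by rewrite linearN map_mxN. Qed.

Lemma adjmxB m n (A B : 'M[C]_(m, n)) : (A - B)^t* = A^t* - B^t*.
Proof. by rewrite adjmxD adjmxN. Qed.

Lemma adjmx1 n : (1%:M : 'M[C]_n)^t* = 1%:M.
Proof. by rewrite trmx1 map_mx1. Qed.

Lemma gram_eq0 m n (A : 'M[C]_(m, n)) : A *m A^t* = 0 -> A = 0.
Proof.
move=> A0; apply/matrixP => i j.
have : (A *m A^t*) i i = 0 by rewrite A0 mxE.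
rewrite mxE; under eq_bigr do rewrite !mxE -normCK.
move/eqP; rewrite psumr_eq0 => [/allP /(_ j (mem_index_enum j))|k _]; last exact: exprn_ge0.
by rewrite /= expf_eq0 /= normr_eq0 mxE => /eqP.
Qed.

(** The missing rows are an orthonormal basis of the orthogonal complement of
    the rows of [Q]. *)
Lemma unitarymx_extend q r (Q : 'M[C]_(q, r)) : Q \is unitarymx ->
  exists2 U : 'M[C]_r, U \is unitarymx & Q = pid_mx q *m U.
Proof.
move=> uQ; have rQ := mxrank_unitary uQ.
have qr : (q <= r)%N by rewrite -rQ rank_leq_col.
move: (r - q)%N (subnKC qr) => s rs; case: _ / rs in Q uQ rQ qr *.
have rQo : \rank Q^!%MS = s by rewrite rank_ortho rQ addKn.
have : forall t, \rank Q^!%MS = t ->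
    exists2 W : 'M[C]_(t, q + s), W \is unitarymx & Q *m W^t* = 0.
  move=> t <-; exists (schmidt (row_base Q^!%MS)).
    by rewrite schmidt_unitarymx // rank_leq_col.
  apply/orthomx1P; rewrite orthomx_sym.
  by rewrite eqmx_schmidt_free ?eq_row_base ?row_base_free.
move=> /(_ s rQo) [W uW QW]; exists (col_mx Q W).
  apply/unitarymxP; rewrite tr_col_mx map_row_mx mul_col_row QW.
  have -> : W *m Q^t* = 0 by rewrite -[LHS]trmxCK adjmx_mul trmxCK QW trmx0 map_mx0.
  by rewrite (unitarymxP uQ) (unitarymxP uW) -scalar_mx_block.
by rewrite pid_mx_row mul_row_col mul0mx addr0 mul1mx.
Qed.

(** Write [N = T Q] with [T] of full column rank and orthonormal rows in [Q].
    A left inverse of [T] sends [M] to a matrix with orthonormal rows as well,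
    because [M] has the Gram matrix of [N], and [M] is recovered from it
    through the same [T]. Both matrices of orthonormal rows extend to unitary
    matrices, whose quotient is [U]. *)
Lemma gram_eq_unitary p r (M N : 'M[C]_(p, r)) : M *m M^t* = N *m N^t* ->
  exists2 U : 'M[C]_r, U \is unitarymx & M = N *m U.
Proof.
move=> MN.
have [q [Q [T [uQ NT rT]]]] : exists q (Q : 'M[C]_(q, r)) (T : 'M[C]_(p, q)),
    [/\ Q \is unitarymx, N = T *m Q & row_full T].
  pose Q := schmidt (row_base N).
  have uQ : Q \is unitarymx by rewrite schmidt_unitarymx // rank_leq_col.
  have /submxP[T NT] : (N <= Q)%MS.
    by rewrite eqmx_schmidt_free ?row_base_free // eq_row_base.
  exists (\rank N), Q, T; split => //.
  by rewrite /row_full eqn_leq rank_leq_col /= [X in (\rank X <= _)%N]NT mxrankM_maxl.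
pose T' := pinvmx T; have T'T : T' *m T = 1%:M by exact: mulVpmx.
pose Q' := T' *m M.
have uQ' : Q' \is unitarymx.
  apply/unitarymxP; rewrite /Q' adjmx_mul !mulmxA -[T' *m M *m _]mulmxA MN.
  have -> : T' *m (N *m N^t*) = T' *m (T *m Q *m (T *m Q)^t*) by rewrite -NT.
  rewrite (adjmx_mul T Q) !mulmxA T'T mul1mx (unitarymxP uQ).
  by rewrite mul1mx -adjmx_mul T'T adjmx1.
have MT : M = T *m Q'.
  apply/eqP; rewrite -subr_eq0; apply/eqP/gram_eq0.
  have -> : M - T *m Q' = (1%:M - T *m T') *m M by rewrite mulmxBl mul1mx mulmxA.
  set K := 1%:M - T *m T'.
  have -> : K *m M *m (K *m M)^t* = K *m (M *m M^t*) *m K^t*.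
    by rewrite adjmx_mul !mulmxA.
  rewrite MN mulmxA; have -> : K *m N = 0.
    rewrite /K NT mulmxBl mul1mx -[T *m T' *m _]mulmxA [T' *m (T *m Q)]mulmxA.
    by rewrite T'T mul1mx subrr.
  by rewrite !mul0mx.
have [U uU QU] := unitarymx_extend uQ; have [U' uU' QU'] := unitarymx_extend uQ'.
exists (U^t* *m U'); first by rewrite mul_unitarymx // trmxC_unitary.
by rewrite NT QU MT QU' !mulmxA -[_ *m U *m _]mulmxA (unitarymxP uU) mulmx1.
Qed.

Lemma unitary_diag r (U : 'M[C]_r) : U \is unitarymx ->
  exists2 V : 'M[C]_r, V \is unitarymx &
  exists d : 'rV[C]_r, U *m V = V *m diag_mx d /\ forall j, `|d 0 j| = 1.
Proof.
move=> uU.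
have : U \is normalmx.
  apply/normalmxP; rewrite (unitarymxP uU).
  by move: uU; rewrite -trmxC_unitary => /unitarymxP; rewrite trmxCK.
move=> /orthomx_spectralP; set P := spectralmx U; set d := spectral_diag U => UP.
have uP : P \is unitarymx by exact: spectral_unitarymx.
exists (P^t*); first by rewrite trmxC_unitary.
exists d; split.
  by rewrite UP invmx_unitary // -!mulmxA (unitarymxP uP) mulmx1.
move=> j.
have dD : diag_mx d = P *m U *m P^t*.
  rewrite UP invmx_unitary // !mulmxA (unitarymxP uP) mul1mx -mulmxA.
  by rewrite (unitarymxP uP) mulmx1.
have : diag_mx d \is unitarymx by rewrite dD !mul_unitarymx // trmxC_unitary.
move=> /unitarymxP /matrixP /(_ j j); rewrite tr_diag_mx map_diag_mx mulmx_diag.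
rewrite !mxE eqxx !mulr1n -normCK => /eqP.
by rewrite sqrp_eq1 ?normr_ge0 // => /eqP.
Qed.

(** The hypothesis says that [E + F] and [E - F] have the same Gram matrix, so
    that [E + F = (E - F) U] with [U] unitary. On an eigenvector [v] of [U],
    of eigenvalue [d], this becomes [(1 - d) E v = - (1 + d) F v], and the
    Cayley transform [(1 + d) / (1 - d)] of a number of modulus 1 is purely
    imaginary; it is infinite when [d = 1], and then [F v = 0]. *)
Lemma skew_gram_split p r (E F : 'M[C]_(p, r)) : E *m F^t* + F *m E^t* = 0 ->
  exists2 V : 'M[C]_r, V \is unitarymx & forall j,
    col j (F *m V) = 0 \/
    exists2 w, w \is Num.real & col j (E *m V) = ('i * w) *: col j (F *m V).
Proof.
move=> EF.
have /gram_eq_unitary[U uU EFU] : (E + F) *m (E + F)^t* = (E - F) *m (E - F)^t*.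
  rewrite adjmxD adjmxB !mulmxDl !mulmxDr !mulmxN !mulNmx opprK.
  have -> : F *m E^t* = - (E *m F^t*).
    by apply/eqP; rewrite -addr_eq0 addrC EF.
  by rewrite opprK !addrA addrK subrK.
have [V uV [d [UV d1]]] := unitary_diag uU.
exists V => // j.
have key : (1 - d 0 j) *: col j (E *m V) = - (1 + d 0 j) *: col j (F *m V).
  have : col j ((E + F) *m V) = d 0 j *: col j ((E - F) *m V).
    rewrite EFU -mulmxA UV mulmxA; apply/matrixP => a b.
    by rewrite mxE mul_mx_diag [LHS]mxE [RHS]mxE [col _ _ _ _]mxE mulrC.
  rewrite mulmxDl mulmxBl linearD linearB /=.
  move: (col j (E *m V)) (col j (F *m V)) => e f h.
  apply/matrixP => a b; have := congr1 (fun M : 'M[C]_(_, _) => M a b) h.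
  rewrite !mxE => /eqP; rewrite -subr_eq0 => /eqP {}h.
  apply/eqP; rewrite -subr_eq0 -{}h; apply/eqP; ring.
have [dj|dj] := eqVneq (d 0 j) 1.
  left; move: key; rewrite dj subrr scale0r => /esym/eqP.
  rewrite scaler_eq0 oppr_eq0 => /orP[|/eqP //].
  by rewrite -[1 + 1]/(2%:R) pnatr_eq0.
have d0 : d 0 j != 0 by rewrite -normr_eq0 d1 oner_eq0.
have dj' : 1 - d 0 j != 0 by rewrite subr_eq0 eq_sym.
right; exists ('i * ((1 + d 0 j) / (1 - d 0 j))).
  apply/CrealP; rewrite rmorphM /= conjCi fmorph_div /= rmorphD rmorphB /= rmorph1.
  have -> : (d 0 j)^* = (d 0 j)^-1.
    by rewrite -[RHS]mul1r -(expr1n _ 2) -(d1 j) normCK mulrAC divff // mul1r.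
  by field; rewrite d0 dj' subr_eq0 dj.
rewrite !mulrA -expr2 sqrCi mulN1r mulrC -scalerA -key scalerA.
by rewrite mulVf // scale1r.
Qed.

Lemma psd_factor n (H : 'M[C]_n) : H^t* = H ->
  (forall x : 'cV[C]_n, 0 <= (x^t* *m H *m x) 0 0) ->
  exists G : 'M[C]_n, H = G *m G^t*.
Proof.
move=> sym psd.
have : H \is normalmx by apply/normalmxP; rewrite sym.
move=> /orthomx_spectralP; set P := spectralmx H; set d := spectral_diag H => HP.
have uP : P \is unitarymx by exact: spectral_unitarymx.
have dD : diag_mx d = P *m H *m P^t*.
  rewrite HP invmx_unitary // !mulmxA (unitarymxP uP) mul1mx -mulmxA.
  by rewrite (unitarymxP uP) mulmx1.
have d0 j : 0 <= d 0 j.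
  have := psd ((row j P)^t*); rewrite trmxCK.
  suff -> : (row j P *m H *m (row j P)^t*) 0 0 = (P *m H *m P^t*) j j.
    by rewrite -dD !mxE eqxx mulr1n.
  rewrite -row_mul mxE [RHS]mxE; apply: eq_bigr => k _.
  by rewrite !mxE.
exists (P^t* *m diag_mx (\row_j sqrtC (d 0 j))).
rewrite adjmx_mul trmxCK HP invmx_unitary // !mulmxA; congr (_ *m _).
rewrite -!mulmxA; congr (_ *m _); rewrite tr_diag_mx map_diag_mx mulmx_diag.
congr diag_mx; apply/rowP => j; rewrite !mxE.
by rewrite -normCK ger0_norm ?sqrtC_ge0 // sqrtCK.
Qed.
End unitary.

(** * The Kalman-Yakubovich-Popov inequality *)

Section complexify.
Local Open Scope sesquilinear_scope.
Variable R : realType.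
Local Notation C := R[i].

Definition Remx m n (M : 'M[C]_(m, n)) : 'M[R]_(m, n) := map_mx (@complex.Re R) M.
Definition Immx m n (M : 'M[C]_(m, n)) : 'M[R]_(m, n) := map_mx (@complex.Im R) M.
Local Notation ii := (Complex 0 1 : C).

Lemma cmxM m n p (A : 'M[R]_(m, n)) (B : 'M[R]_(n, p)) : cmx (A *m B) = cmx A *m cmx B.
Proof. exact: map_mxM. Qed.

Lemma cmx_rect m n (M : 'M[C]_(m, n)) : M = cmx (Remx M) + ii *: cmx (Immx M).
Proof. by apply/matrixP => i j; rewrite !mxE [LHS]complexE. Qed.

Lemma ctrE m n (M : 'M[C]_(m, n)) :
  ctr M = cmx (Remx M)^T + (- ii) *: cmx (Immx M)^T.
Proof.
apply/matrixP => i j; rewrite !mxE; case: (M j i) => a b /=.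
by apply/eqP; rewrite eq_complex /=; apply/andP; split; apply/eqP; ring.
Qed.

Lemma ctr_cmx m n (M : 'M[R]_(m, n)) : ctr (cmx M) = cmx M^T.
Proof.
apply/matrixP => i j; rewrite !mxE /=.
by apply/eqP; rewrite eq_complex /= oppr0 !eqxx.
Qed.

Definition hf n (H : 'M[C]_n) (x : 'cV[C]_n) : C := (ctr x *m H *m x) 0 0.

(** A real symmetric form takes on a complex vector the sum of its values on
    the real and imaginary parts, the cross terms cancelling. *)
Lemma hf_cmx n (M : 'M[R]_n) (x : 'cV[C]_n) : M^T = M ->
  hf (cmx M) x = (qf M (Remx x) + qf M (Immx x))%:C%C.
Proof.
move=> sM; rewrite /hf ctrE [X in (_ *m X) 0 0]cmx_rect.
move: (Remx x) (Immx x) => a b.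
have ab : (a^T *m M *m b) 0 0 = (b^T *m M *m a) 0 0.
  rewrite (_ : a^T *m M *m b = (b^T *m M *m a)^T); first by rewrite [LHS]mxE.
  by rewrite !trmx_mul trmxK sM mulmxA.
rewrite mulmxDl mulmxDl !mulmxDr -!scalemxAl -!scalemxAr -!cmxM /qf.
move: (a^T *m M *m a) (b^T *m M *m b) (a^T *m M *m b) (b^T *m M *m a) ab => N1 N2 N3 N4 ab.
have mxDE (c d e : C) : (cmx N1 + c *: cmx N3 + (d *: cmx N4 + e *: cmx N2)) 0 0 =
    (N1 0 0)%:C%C + c * (N3 0 0)%:C%C + (d * (N4 0 0)%:C%C + e * (N2 0 0)%:C%C).
  by rewrite !mxE.
rewrite scalerA mxDE ab.
apply/eqP; rewrite eq_complex /=; apply/andP; split; apply/eqP; ring.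
Qed.

Lemma Remx_cmx m n (M : 'M[R]_(m, n)) : Remx (cmx M) = M.
Proof. by apply/matrixP => i j; rewrite !mxE. Qed.

Lemma cmx_inj m n : injective (@cmx R m n).
Proof. by move=> M N /(congr1 (@Remx _ _)); rewrite !Remx_cmx. Qed.

Lemma ReIm_eq0 n (x : 'cV[C]_n) : Remx x = 0 -> Immx x = 0 -> x = 0.
Proof.
by move=> r0 i0; rewrite [x]cmx_rect r0 i0 /cmx !map_mx0 scaler0 addr0.
Qed.

Lemma hf_cmx_ge0 n (M : 'M[R]_n) (x : 'cV[C]_n) : M^T = M ->
  (forall x, 0 <= qf M x) -> 0 <= hf (cmx M) x.
Proof. by move=> sM M0; rewrite hf_cmx // ler0c addr_ge0. Qed.

Lemma hf_cmx_gt0 n (M : 'M[R]_n) (x : 'cV[C]_n) : M^T = M ->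
  (forall x, x != 0 -> 0 < qf M x) -> x != 0 -> 0 < hf (cmx M) x.
Proof.
move=> sM M0 x0.
have M0' y : 0 <= qf M y.
  have [->|/M0/ltW //] := eqVneq y 0.
  by rewrite /qf mulmx0 mxE.
rewrite hf_cmx // ltcR.
have [r0|r0] := eqVneq (Remx x) 0; last by rewrite ltr_wpDr // M0.
have [i0|i0] := eqVneq (Immx x) 0; last by rewrite ltr_wpDl // M0.
by move: x0; rewrite (ReIm_eq0 r0 i0) eqxx.
Qed.

Lemma hf_suml n m (H : 'M[C]_n) (G : 'M[C]_(n, m)) :
  \tr (H *m (G *m ctr G)) = \sum_j hf H (col j G).
Proof.
rewrite mulmxA mxtrace_mulC mulmxA; apply: eq_bigr => j _.
rewrite /hf [LHS]mxE [RHS]mxE; apply: eq_bigr => k _; congr (_ * _); last by rewrite mxE.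
rewrite [LHS]mxE [RHS]mxE; apply: eq_bigr => l _; congr (_ * _).
by rewrite !mxE.
Qed.

(** If no [Y] exists, [lmi_alternative] provides a nonzero positive
    semidefinite [Z] orthogonal to all the terms linear in [Y] and with
    [tr (S0 Z) <= 0]. By [skew_gram_split], [Z] is a sum of matrices [g g^H]
    in which each [g = (xi, u)] either has [xi = 0] or solves the state
    equation at some imaginary frequency. The frequency condition then makes
    [tr (S0 Z)], the sum of the values of [S0] at the [g], positive. *)
Lemma kyp m k (A : 'M[R]_m) (B : 'M[R]_(m, k)) (S0 : 'M[R]_(m + k)) : S0^T = S0 ->
  (forall (xi : 'cV[C]_m) (u : 'cV[C]_k), col_mx xi u != 0 ->
     xi = 0 \/ (exists2 w : C, w \is Num.real & cmx A *m xi + cmx B *m u = ('i * w) *: xi) ->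
     0 < hf (cmx S0) (col_mx xi u)) ->
  exists2 Y : 'M[R]_m, Y^T = Y & forall x u, col_mx x u != 0 ->
    2 * (x^T *m Y *m (A *m x + B *m u)) 0 0 < qf S0 (col_mx x u).
Proof.
move=> sS0 freq.
pose T1 : 'M[R]_(m, m + k) := row_mx 1%:M 0; pose T2 := row_mx A B.
pose D (ij : 'I_m * 'I_m) : 'M[R]_m := delta_mx ij.1 ij.2 + delta_mx ij.2 ij.1.
pose L ij := - (T1^T *m D ij *m T2).
have DT ij : (D ij)^T = D ij by rewrite /D linearD /= !trmx_delta addrC.
have T1E (x : 'cV[R]_m) u : T1 *m col_mx x u = x by rewrite mul_row_col mul1mx mul0mx addr0.
have T2E (x : 'cV[R]_m) u : T2 *m col_mx x u = A *m x + B *m u by rewrite mul_row_col.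
have [[y yP]|[Z [sZ psdZ Z0 LZ SZ]]] := lmi_alternative S0 L.
  pose Y := \sum_ij y ij *: ((1 / 2 : R) *: D ij).
  exists Y.
    rewrite /Y linear_sum /=; apply: eq_bigr => ij _.
    by rewrite [LHS]linearZ /=; congr (_ *: _); rewrite linearZ /= DT.
  move=> x u xu0; have := yP _ xu0; rewrite qfDl qf_suml => h; rewrite -subr_gt0.
  suff -> : 2 * (x^T *m Y *m (A *m x + B *m u)) 0 0 = - \sum_i y i * qf (L i) (col_mx x u) by rewrite opprK.
  rewrite /Y mulmx_sumr mulmx_suml summxE mulr_sumr -sumrN; apply: eq_bigr => ij _.
  have -> : qf (L ij) (col_mx x u) = - ((x^T *m D ij *m (A *m x + B *m u)) 0 0).
    rewrite /qf /L mulmxN mulNmx mxE !mulmxA -trmx_mul T1E -mulmxA T2E //.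
  rewrite -!scalemxAr -!scalemxAl.
  move: (x^T *m D ij *m (A *m x + B *m u)) => N; rewrite !mxE; by field.
exfalso.
(* Orthogonality to every symmetric [Y] kills the symmetric part of
   [T2 Z T1^T]. *)
have W0 : T2 *m Z *m T1^T + T1 *m Z *m T2^T = 0.
  have trW : (T2 *m Z *m T1^T)^T = T1 *m Z *m T2^T.
    by rewrite !trmx_mul trmxK sZ mulmxA.
  rewrite -trW; set W := T2 *m Z *m T1^T.
  apply/matrixP => i j; have := LZ (i, j).
  rewrite /L mulNmx raddfN /= => /eqP; rewrite oppr_eq0 -mulmxA mxtrace_mulC.
  rewrite !mulmxA mxtrace_mulC !mulmxA -/W mxtrace_mulC /D /= mulmxDl raddfD /=.
  have trd (a b : 'I_m) : \tr (delta_mx a b *m W) = W b a.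
    rewrite -(mul_delta_mx (0 : 'I_1)) -mulmxA mxtrace_mulC /mxtrace big_ord1.
    by rewrite -rowE -colE !mxE.
  by rewrite !trd addrC !mxE => /eqP.
have [G ZG] : exists G : 'M[C]_(m + k), cmx Z = G *m ctr G.
  apply: psd_factor; first by rewrite -/(ctr _) ctr_cmx sZ.
  by move=> x; exact: hf_cmx_ge0.
pose F := cmx T1 *m G; pose E := cmx T2 *m G.
have EF : E *m ctr F + F *m ctr E = 0.
  have h (M N : 'M[R]_(m, m + k)) : (cmx M *m G) *m ctr (cmx N *m G) = cmx (M *m Z *m N^T).
    by rewrite /ctr adjmx_mul -/(ctr _) -/(ctr (cmx N)) ctr_cmx !cmxM ZG !mulmxA.
  by rewrite !h -map_mxD W0 /cmx map_mx0.
have [V uV VP] := skew_gram_split EF.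
pose g j := col j (G *m V).
have gE (T : 'M[R]_(m, m + k)) j : col j (cmx T *m G *m V) = cmx T *m g j.
  by rewrite /g !colE !mulmxA.
have gpos j : g j != 0 -> 0 < hf (cmx S0) (g j).
  rewrite -[g j]vsubmxK => g0; apply: freq => //.
  have T1g : cmx T1 *m g j = usubmx (g j).
    rewrite -{1}[g j]vsubmxK /cmx map_row_mx map_mx1 map_mx0 mul_row_col.
    by rewrite mul1mx mul0mx addr0.
  have T2g : cmx T2 *m g j = cmx A *m usubmx (g j) + cmx B *m dsubmx (g j).
    by rewrite -{1}[g j]vsubmxK /cmx map_row_mx mul_row_col.
  have := VP j; rewrite !gE T1g T2g => -[->|h]; [by left|by right].
have GV : (G *m V) *m ctr (G *m V) = cmx Z.
  by rewrite /ctr adjmx_mul !mulmxA -[G *m V *m _]mulmxA (unitarymxP uV) mulmx1 ZG.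
have tr0 : \sum_j hf (cmx S0) (g j) <= 0.
  by rewrite -hf_suml GV -cmxM /cmx trace_map_mx; move: SZ; rewrite -lecR.
have gge j : 0 <= hf (cmx S0) (g j).
  have [->|/gpos/ltW //] := eqVneq (g j) 0.
  by rewrite /hf mulmx0 mxE.
have g0 j : g j = 0.
  apply/eqP/contraT => gj.
  have : 0 < \sum_j hf (cmx S0) (g j).
    by rewrite (bigD1 j) //= ltr_wpDr ?gpos // sumr_ge0.
  by move=> /lt_le_trans /(_ tr0); rewrite ltxx.
move/eqP: Z0; apply; apply: cmx_inj; rewrite -GV.
have -> : G *m V = 0.
  by apply/matrixP => i j; have := congr1 (fun M : 'cV_(m + k) => M i 0) (g0 j); rewrite !mxE.
by rewrite mul0mx /cmx map_mx0.
Qed.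
End complexify.

(** * Lyapunov's theorem *)

Section lyapunov.
Local Open Scope sesquilinear_scope.
Variable R : realType.
Local Notation C := R[i].

Lemma ctr_mul m n p (A : 'M[C]_(m, n)) (B : 'M[C]_(n, p)) : ctr (A *m B) = ctr B *m ctr A.
Proof. exact: adjmx_mul. Qed.

Lemma ctrK m n (A : 'M[C]_(m, n)) : ctr (ctr A) = A.
Proof. exact: trmxCK. Qed.

Lemma ctr_col_mx m1 m2 n (A : 'M[C]_(m1, n)) (B : 'M[C]_(m2, n)) :
  ctr (col_mx A B) = row_mx (ctr A) (ctr B).
Proof. by rewrite /ctr tr_col_mx map_row_mx. Qed.

Lemma hf_lyap n (T H : 'M[C]_n) x : ctr H = H ->
  hf (ctr T *m H + H *m T) x =
  2%:R * (complex.Re ((ctr x *m H *m (T *m x)) 0 0))%:C%C.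
Proof.
move=> sH; rewrite -addcJ /hf mulmxDr mulmxDl mxE addrC; congr (_ + _).
  by rewrite !mulmxA.
have -> : ctr x *m (ctr T *m H) *m x = ctr (ctr x *m H *m (T *m x)).
  by rewrite !ctr_mul sH ctrK !mulmxA.
by rewrite /ctr !mxE.
Qed.

(** Induction on the dimension, through a Schur complement. Vectors [(0, y)]
    reduce the lower right block [H1] to the induction hypothesis. The vector
    [e = (1, - H1^-1 r)] is [H]-orthogonal to them, and the inequality at [e]
    is [2 Re t * s < 0], with [t] the first diagonal entry of [T] and [s] the
    value of [H] at [e]. Hence [s > 0], and [H] is positive on the orthogonal
    sum. *)
Lemma lyapunov_trig n (T H : 'M[C]_n) : is_trig_mx T -> ctr H = H ->
  (forall i, complex.Re (T i i) < 0) ->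
  (forall x, x != 0 -> hf (ctr T *m H + H *m T) x < 0) ->
  forall x, x != 0 -> 0 < hf H x.
Proof.
elim: n T H => [|n IH] T H trT sH hT lyap.
  by move=> x /eqP[]; apply/matrixP => -[].
move: T H trT sH hT lyap; rewrite -[n.+1]/(1 + n)%N => T H.
rewrite -[T]submxK -[H]submxK.
move: (ulsubmx T) (ursubmx T) (dlsubmx T) (drsubmx T) => t z c T1.
move: (ulsubmx H) (ursubmx H) (dlsubmx H) (drsubmx H) => h r' r H1.
rewrite is_trig_block_mx // => /and3P[/eqP -> _ trT1].
rewrite /ctr tr_block_mx map_block_mx -!/(ctr _) => sH hT lyap.
have [hh rr H1h] : [/\ ctr h = h, ctr r = r' & ctr H1 = H1].
  by have [] := eq_block_mx sH.
have hT1 i : complex.Re (T1 i i) < 0.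
  by have := hT (rshift 1 i); rewrite block_mxEdr.
have H1pos : forall x, x != 0 -> 0 < hf H1 x.
  apply: (IH T1) => // y y0.
  have y0' : col_mx (0 : 'M[C]_1) y != 0.
    by apply: contra y0 => /eqP /(congr1 dsubmx); rewrite col_mxKd linear0 => /eqP.
  have sH' : ctr (block_mx h r' r H1) = block_mx h r' r H1.
    by rewrite /ctr tr_block_mx map_block_mx -!/(ctr _) sH.
  have := lyap (col_mx 0 y) y0'; rewrite hf_lyap // hf_lyap //.
  have c0 : ctr (0 : 'M[C]_1) = 0 by rewrite /ctr trmx0 map_mx0.
  rewrite ctr_col_mx c0 mul_row_block mul_block_col mul_row_col.
  by rewrite !mul0mx !mulmx0 !add0r mulmx0 add0r.
have H1u : H1 \in unitmx.
  rewrite unitmxE unitfE; apply/det0P => -[y y0 yH].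
  have := H1pos (ctr y); rewrite /hf ctrK yH mul0mx mxE ltxx => /(_ _)/negP; apply => //.
  by apply: contra y0 => /eqP /(congr1 (@ctr R _ _)); rewrite ctrK /ctr trmx0 map_mx0 => ->.
pose v := - (invmx H1 *m r).
(* [H e] is supported on the first coordinate. *)
have Hv : block_mx h r' r H1 *m col_mx 1%:M v = col_mx (h + r' *m v) 0.
  have H1v : H1 *m v = - r by rewrite mulmxN mulKVmx.
  by rewrite mul_block_col !mulmx1 H1v subrr.
set BH := block_mx h r' r H1 in sH lyap Hv *; set s := h + r' *m v in Hv.
have sBH : ctr BH = BH by rewrite /ctr tr_block_mx map_block_mx -!/(ctr _) sH.
pose e : 'cV[C]_(1 + n) := col_mx 1%:M v.
have se : ctr e *m BH *m e = s.
  rewrite -mulmxA Hv ctr_col_mx mul_row_col mulmx0 addr0.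
  by rewrite /ctr trmx1 map_mx1 mul1mx.
have cs : ctr s = s by rewrite -se !ctr_mul ctrK sBH mulmxA.
have [a sa] : exists a : R, s 0 0 = a%:C%C.
  apply/complex_realP/CrealP; rewrite -{2}cs [RHS]mxE.
  by rewrite [X in _ = _ X]mxE.
have s_gt0 : 0 < s 0 0.
  have e0 : e != 0.
    apply/eqP => /(congr1 usubmx); rewrite col_mxKu linear0 => /matrixP /(_ 0 0) /eqP.
    by rewrite !mxE /= oner_eq0.
  have := lyap e e0; rewrite hf_lyap //.
  have -> : ctr e *m BH = ctr (BH *m e) by rewrite ctr_mul sBH.
  rewrite Hv ctr_col_mx cs mul_block_col mul_row_col mulmx1 mul0mx addr0.
  rewrite [ctr 0](_ : _ = 0) ?mul0mx ?addr0; last by rewrite /ctr trmx0 map_mx0.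
  rewrite mxE big_ord1 sa.
  have := hT (lshift n 0); rewrite block_mxEul.
  case: (t 0 0) => t1 t2 /= t10; rewrite mul0r subr0 pmulr_rlt0 ?ltr0n //.
  by rewrite -[0]/(0%:C%C) !ltcR nmulr_llt0.
move=> x x0.
have [al [w xE]] : exists (al : 'M[C]_1) w, x = e *m al + col_mx 0 w.
  exists (usubmx x), (dsubmx x - v *m usubmx x).
  by rewrite mul_col_mx mul1mx add_col_mx addr0 addrC subrK vsubmxK.
have w_orth : ctr (col_mx (0 : 'M[C]_1) w) *m (BH *m e) = 0.
  rewrite Hv ctr_col_mx mul_row_col mulmx0 addr0.
  by rewrite /ctr trmx0 map_mx0 mul0mx.
have hfx : hf BH x = `|al 0 0| ^+ 2 * s 0 0 + hf H1 w.
  have cx : ctr x = ctr (e *m al) + ctr (col_mx 0 w) by rewrite {1}xE; exact: adjmxD.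
  rewrite /hf cx [X in (_ *m X) 0 0]xE !mulmxDl !mulmxDr.
  have -> : ctr (e *m al) *m BH *m (e *m al) = ctr al *m s *m al.
    by rewrite ctr_mul -se !mulmxA.
  have w_orth' : ctr (col_mx 0 w) *m BH *m (e *m al) = 0.
    by rewrite -mulmxA [BH *m (_ *m _)]mulmxA mulmxA w_orth mul0mx.
  have -> : ctr (e *m al) *m BH *m col_mx 0 w = ctr (ctr (col_mx 0 w) *m BH *m (e *m al)).
    by rewrite [RHS]ctr_mul [ctr (_ *m BH)]ctr_mul ctrK sBH mulmxA.
  rewrite w_orth' (_ : ctr 0 = 0); last by rewrite /ctr trmx0 map_mx0.
  have -> : ctr (col_mx 0 w) *m BH *m col_mx 0 w = ctr w *m H1 *m w.
    have c0 : ctr (0 : 'M[C]_1) = 0 by rewrite /ctr trmx0 map_mx0.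
    by rewrite ctr_col_mx c0 mul_row_block mul_row_col !mul0mx !add0r mulmx0 add0r.
  rewrite addr0 add0r mxE; congr (_ + _) => //.
  by rewrite mxE big_ord1 mxE big_ord1 normCK /ctr !mxE; ring.
have hw : 0 <= hf H1 w.
  by have [->|/H1pos/ltW//] := eqVneq w 0; rewrite /hf mulmx0 mxE.
have [al0|al0] := eqVneq (al 0 0) 0; last first.
  by rewrite hfx ltr_wpDr // mulr_gt0 // exprn_gt0 // normr_gt0.
rewrite hfx al0 normr0 expr0n /= mul0r add0r H1pos //.
apply: contra x0 => /eqP w0; rewrite xE w0 col_mx0 addr0.
have -> : al = 0 by apply/matrixP => i j; rewrite !ord1 al0 mxE.
by rewrite mulmx0.
Qed.

Lemma lyap_congr n (P A H : 'M[C]_n) : ctr P *m P = 1%:M ->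
  ctr (P *m A *m ctr P) *m (P *m H *m ctr P) + P *m H *m ctr P *m (P *m A *m ctr P) =
  P *m (ctr A *m H + H *m A) *m ctr P.
Proof.
move=> PP; have PK M : ctr P *m (P *m M) = M :> 'M[C]_n by rewrite mulmxA PP mul1mx.
by rewrite !ctr_mul ctrK -!mulmxA !PK mulmxDl mulmxDr -!mulmxA.
Qed.

Definition hurwitz n (A : 'M[R]_n) : Prop :=
  forall l : C, eigenvalue (cmx A) l -> complex.Re l < 0.

(** Schur's unitary triangularisation of [A] reduces the claim to
    [lyapunov_trig]. *)
Lemma lyapunov_nonneg n (A Y : 'M[R]_n) : Y^T = Y -> hurwitz A ->
  (forall x : 'cV[R]_n, x != 0 -> (x^T *m Y *m (A *m x)) 0 0 < 0) ->
  forall x, 0 <= qf Y x.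
Proof.
case: n A Y => [|n] A Y sY hA lyap x.
  by rewrite qfE big_ord0.
have [P uP] := Schur (cmx A) (ltn0Sn n).
rewrite /similar_to /= conjymx // => trT; set T := P *m _ *m _ in trT.
have PP : ctr P *m P = 1%:M.
  by move: uP; rewrite -trmxC_unitary => /unitarymxP; rewrite trmxCK.
pose H := P *m cmx Y *m ctr P.
have sH : ctr H = H by rewrite /H !ctr_mul ctrK ctr_cmx sY mulmxA.
have hT i : complex.Re (T i i) < 0.
  apply: hA; have : eigenvalue T (T i i).
    rewrite eigenvalue_root_char char_poly_trig // /root horner_prod.
    by rewrite (bigD1 i) //= !hornerE subrr mul0r.
  move=> /eigenvalueP[u uT u0]; apply/eigenvalueP; exists (u *m P).
    rewrite scalemxAl -uT /T -!mulmxA -/(ctr P) PP mulmx1 //.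
  apply: contra u0 => /eqP /(congr1 (mulmx^~ (ctr P))).
  by rewrite -mulmxA (unitarymxP uP) mulmx1 mul0mx => ->.
have sM : (A^T *m Y + Y *m A)^T = A^T *m Y + Y *m A.
  by rewrite linearD /= !trmx_mul trmxK sY addrC.
have hM y : y != 0 -> 0 < qf (- (A^T *m Y + Y *m A)) y.
  move=> y0; rewrite /qf mulmxN mulNmx mxE oppr_gt0 mulmxDr mulmxDl mxE.
  have -> : y^T *m (A^T *m Y) *m y = (y^T *m Y *m (A *m y))^T.
    by rewrite !trmx_mul trmxK sY !mulmxA.
  have -> : y^T *m (Y *m A) *m y = y^T *m Y *m (A *m y) by rewrite !mulmxA.
  by rewrite [(_^T) 0 0]mxE -mulr2n mulrn_wlt0 // lyap.
have lyapT y : y != 0 -> hf (ctr T *m H + H *m T) y < 0.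
  move=> y0.
  have -> : hf (ctr T *m H + H *m T) y = - hf (cmx (- (A^T *m Y + Y *m A))) (ctr P *m y).
    rewrite (lyap_congr _ _ PP) ctr_cmx -!cmxM /cmx -map_mxD map_mxN.
    by rewrite /hf mulmxN mulNmx [in RHS]mxE opprK ctr_mul ctrK !mulmxA.
  rewrite oppr_lt0 hf_cmx_gt0 //; first by rewrite linearN /= sM.
  apply: contra y0 => /eqP /(congr1 (mulmx P)).
  by rewrite mulmxA (unitarymxP uP) mul1mx mulmx0 => ->.
have := lyapunov_trig trT sH hT lyapT => pos.
have [->|x0] := eqVneq x 0; first by rewrite /qf mulmx0 mxE.
have Px : P *m cmx x != 0.
  apply: contra x0 => /eqP /(congr1 (mulmx (ctr P))).
  rewrite mulmxA PP mul1mx mulmx0 => x0; apply/eqP; apply: cmx_inj.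
  by rewrite x0 /cmx map_mx0.
have := pos _ Px; have -> : hf H (P *m cmx x) = (qf Y x)%:C%C.
  rewrite /hf /H ctr_mul !mulmxA -[_ *m ctr P *m P]mulmxA PP mulmx1.
  rewrite -[_ *m ctr P *m P]mulmxA PP mulmx1 ctr_cmx -!cmxM.
  by rewrite /cmx mxE.
by rewrite -[0]/(0%:C%C) ltcR => /ltW.
Qed.
End lyapunov.

(** * Storage functions *)

Section storage.
Variable R : realType.
Local Notation C := R[i].

Lemma qf_congr m n (P : 'M[R]_m) (T : 'M[R]_(m, n)) x :
  qf (T^T *m P *m T) x = qf P (T *m x).
Proof. by rewrite /qf trmx_mul !mulmxA. Qed.

Lemma hf_congr m n (P : 'M[R]_m) (T : 'M[R]_(m, n)) (x : 'cV[C]_n) :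
  hf (cmx (T^T *m P *m T)) x = hf (cmx P) (cmx T *m x).
Proof. by rewrite /hf ctr_mul ctr_cmx !cmxM !mulmxA. Qed.

Lemma hfD n (P Q : 'M[C]_n) x : hf (P + Q) x = hf P x + hf Q x.
Proof. by rewrite /hf mulmxDr mulmxDl mxE. Qed.

Lemma hfN n (P : 'M[C]_n) x : hf (- P) x = - hf P x.
Proof. by rewrite /hf mulmxN mulNmx mxE. Qed.

Lemma qf1 n (x : 'cV[R]_n) : qf 1%:M x = normsq x.
Proof. by rewrite qf_tr mul1mx normsq_tr. Qed.

Lemma normsq_col_mx m n (x : 'cV[R]_m) (y : 'cV[R]_n) :
  normsq (col_mx x y) = normsq x + normsq y.
Proof.
rewrite /normsq big_split_ord /=; congr (_ + _); apply: eq_bigr => i _.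
  by rewrite col_mxEu.
by rewrite col_mxEd.
Qed.

Lemma tr_congr m n (P : 'M[R]_m) (T : 'M[R]_(m, n)) : P^T = P ->
  (T^T *m P *m T)^T = T^T *m P *m T.
Proof. by move=> sP; rewrite !trmx_mul trmxK sP mulmxA. Qed.

(** The term [e * normsq u] makes the frequency condition strict, so that
    [kyp] applies, and compactness turns its strict conclusion into the margin
    [c]. With input [0] the supply rate is nonpositive, so that [Y] satisfies
    a strict Lyapunov inequality for the Hurwitz matrix [A]; this fixes its
    sign. *)
Lemma storage_exists m k (A : 'M[R]_m) (B : 'M[R]_(m, k)) (C0 : 'M[R]_(k, m))
    (D : 'M[R]_k) (Pi : 'M[R]_(k + k)) (e : R) : Pi^T = Pi -> 0 < e ->
  hurwitz A ->
  (forall y : 'cV[R]_k, qf Pi (col_mx 0 y) <= 0) ->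
  (forall (xi : 'cV[C]_m) (u : 'cV[C]_k), col_mx xi u != 0 ->
     xi = 0 \/ (exists2 w : C, w \is Num.real &
                  cmx A *m xi + cmx B *m u = ('i * w) *: xi) ->
     u != 0 /\ 0 <= hf (cmx Pi) (col_mx u (cmx C0 *m xi + cmx D *m u))) ->
  exists (Y : 'M[R]_m) (c : R), [/\ Y^T = Y, forall x, 0 <= qf Y x, 0 < c &
    forall x u, 2 * (x^T *m Y *m (A *m x + B *m u)) 0 0 <=
      qf Pi (col_mx u (C0 *m x + D *m u)) + e * normsq u - c * normsq x].
Proof.
move=> sPi e0 hA Pi0 freq.
pose T : 'M[R]_(k + k, m + k) := col_mx (row_mx 0 1%:M) (row_mx C0 D).
pose J : 'M[R]_(k, m + k) := row_mx 0 1%:M.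
pose S0 := T^T *m Pi *m T + J^T *m (e%:M) *m J.
have sS0 : S0^T = S0 by rewrite /S0 linearD /= !tr_congr // tr_scalar_mx.
have TE x u : T *m col_mx x u = col_mx u (C0 *m x + D *m u).
  by rewrite mul_col_mx !mul_row_col mul0mx add0r mul1mx.
have JE x u : J *m col_mx x u = u by rewrite mul_row_col mul0mx add0r mul1mx.
have S0E x u : qf S0 (col_mx x u) = qf Pi (col_mx u (C0 *m x + D *m u)) + e * normsq u.
  by rewrite qfDl !qf_congr TE JE -(scale1r e%:M) scale_scalar_mx mul1r -[e]mulr1 -scale_scalar_mx qfZl qf1 mulr1.
have [|Y sY YP] := @kyp R m k A B S0 sS0.
  move=> xi u xu0 h; have [u0 Pu] := freq xi u xu0 h.
  rewrite /S0 /cmx map_mxD -!/(cmx _) hfD !hf_congr.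
  have -> : cmx T *m col_mx xi u = col_mx u (cmx C0 *m xi + cmx D *m u).
    rewrite /cmx map_col_mx !map_row_mx map_mx0 map_mx1 mul_col_mx !mul_row_col.
    by rewrite mul0mx add0r mul1mx.
  have -> : cmx J *m col_mx xi u = u.
    by rewrite /cmx map_row_mx map_mx0 map_mx1 mul_row_col mul0mx add0r mul1mx.
  rewrite ltr_wpDl // hf_cmx_gt0 ?tr_scalar_mx // => y y0.
  by rewrite -[e]mulr1 -scale_scalar_mx qfZl qf1 mulr_gt0 // normsq_gt0.
pose G := S0 - (row_mx 1%:M 0)^T *m (2 *: Y) *m row_mx A B.
have GE x u : qf G (col_mx x u) = qf S0 (col_mx x u) - 2 * (x^T *m Y *m (A *m x + B *m u)) 0 0.
  rewrite qfDl -[- (_ *m _ *m _)]scaleN1r qfZl mulN1r; congr (_ - _).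
  rewrite /qf !mulmxA -trmx_mul mul_row_col mul1mx mul0mx addr0.
  by rewrite -mulmxA mul_row_col -scalemxAr -scalemxAl mxE.
have [c c0 cP] : exists2 c, 0 < c & forall x, c * normsq x <= qf G x.
  apply: qf_lower_bound => x; rewrite -[x]vsubmxK => x0.
  by rewrite GE subr_gt0 YP.
exists Y, c; split => //.
  apply: (lyapunov_nonneg sY hA) => x x0.
  have xu0 : col_mx x (0 : 'cV[R]_k) != 0.
    by apply: contra x0 => /eqP /(congr1 usubmx); rewrite col_mxKu linear0 => ->.
  have := YP x 0 xu0; rewrite S0E !mulmx0 !addr0.
  have := Pi0 (C0 *m x).
  have -> : normsq (0 : 'cV[R]_k) = 0 by rewrite /normsq big1 // => i _; rewrite mxE expr0n.
  move: ((x^T *m Y *m (A *m x)) 0 0) (qf Pi (col_mx 0 (C0 *m x))) => a b; lra.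
move=> x u; have := cP (col_mx x u); rewrite GE S0E normsq_col_mx.
have cu : 0 <= c * normsq u by rewrite mulr_ge0 ?normsq_ge0 // ltW.
by rewrite mulrDr; move: cu; lra.
Qed.
End storage.

(** * The multiplier *)

Section multiplier.
Variable R : realType.
Local Notation C := R[i].

Lemma big_mxtens (V : nmodType) (m n : nat) (F : 'I_(m * n) -> V) :
  \sum_i F i = \sum_(i < m) \sum_(j < n) F (mxtens_index (i, j)).
Proof.
rewrite pair_big /= (reindex (@mxtens_index m n)) /=; last first.
  by exists (@mxtens_unindex m n) => i _; rewrite (mxtens_indexK, mxtens_unindexK).
by apply: eq_bigr => -[i j].
Qed.

Variables (nu k : nat).

(** Up to a reassociation of lexicographic indices, [P_factor] consists of two
    equal diagonal blocks, [vec 1 *t 1]. *)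
Lemma P_factor_block (i : 'I_nu) (q : 'I_(nu * k)) (l : 'I_k) :
  let F := P_factor R nu k in
  [/\ F (mxtens_index (lshift nu i, q)) (rshift k l) = 0,
      F (mxtens_index (rshift nu i, q)) (lshift k l) = 0 &
      F (mxtens_index (rshift nu i, q)) (rshift k l) =
      F (mxtens_index (lshift nu i, q)) (lshift k l)].
Proof.
rewrite /= /P_factor; set W := (vec _ *t _).
rewrite !castmxE.
have iq : (i * (nu * k) + q < nu * nu * k)%N.
  by have := mxtens_index_proof (i, q); rewrite [X in (_ < X)%N]mulnA.
have pos : (0 < nu * nu * k)%N by case: (nu * nu * k)%N iq.
have k0 : (0 < 1 * k)%N by rewrite mul1n; case: l => [[]]; case: k.
have lk : (l < 1 * k)%N by rewrite mul1n.
have riq : ((nu + i) * (nu * k) + q = 1 * (nu * nu * k) + (i * (nu * k) + q))%N.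
  by rewrite mulnDl mul1n mulnA addnA.
have rl : (k + l = 1 * (1 * k) + l)%N by rewrite !mul1n.
have entry (a b : 'I_2) (r : 'I_(nu * nu * k)) (c : 'I_(1 * k))
      (r' : 'I_(2 * (nu * nu * k))) (c' : 'I_(2 * (1 * k))) :
    r' = (a * (nu * nu * k) + r)%N :> nat -> c' = (b * (1 * k) + c)%N :> nat ->
    ((1%:M : 'M[R]_2) *t W) r' c' = (a == b)%:R * W r c.
  move=> rE cE; have -> : r' = mxtens_index (a, r) by apply: val_inj.
  have -> : c' = mxtens_index (b, c) by apply: val_inj.
  by rewrite tensmxE mxE.
split.
- by rewrite (entry ord0 ord_max (Ordinal iq) (Ordinal lk)) ?mul0r.
- by rewrite (entry ord_max ord0 (Ordinal iq) (Ordinal lk)) ?mul0r.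
- rewrite (entry ord_max ord_max (Ordinal iq) (Ordinal lk)) //.
  by rewrite (entry ord0 ord0 (Ordinal iq) (Ordinal lk)).
Qed.

Lemma P_mult_sym (P0 : 'M[R]_(nu + nu)) (M : 'M[R]_(nu * k)) :
  P0^T = P0 -> M^T = M -> (P_mult P0 M)^T = P_mult P0 M.
Proof.
move=> sP sM; rewrite /P_mult !trmx_mul trmxK mulmxA; congr (_ *m _ *m _).
by apply/matrixP => i j; rewrite !mxE -[in LHS]sP -[in LHS]sM !mxE.
Qed.

Lemma hfE n (K : 'M[C]_n) (y : 'cV[C]_n) :
  hf K y = \sum_i \sum_j (y i 0)^* * K i j * y j 0.
Proof.
rewrite /hf mxE exchange_big /=; apply: eq_bigr => j _.
rewrite mxE mulr_suml; apply: eq_bigr => i _.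
by rewrite /ctr !mxE.
Qed.

(** Factor [M] as [G] times its adjoint. Each column of [G] contracts the
    second tensor index and turns [(v0 u, v u)] into a vector
    [(v0 phi, v phi)] of the space of [P0]; the multiplier form is the sum of
    the values of [P0] at these vectors. The pair [(v0, v)] plays the role of
    homogeneous coordinates, so that [v0 = 0] is the point at infinity. *)
Lemma P_mult_psd (P0 : 'M[R]_(nu + nu)) (M : 'M[R]_(nu * k)) (v0 v : C) (u : 'cV[C]_k) :
  M^T = M -> (forall x, 0 <= qf M x) ->
  (forall y : 'cV[C]_nu, 0 <= hf (cmx P0) (col_mx (v0 *: y) (v *: y))) ->
  0 <= hf (cmx (P_mult P0 M)) (col_mx (v0 *: u) (v *: u)).
Proof.
move=> sM psdM VP.
have [G MG] : exists G : 'M[C]_(nu * k), cmx M = G *m ctr G.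
  apply: psd_factor; first by rewrite -/(ctr _) ctr_cmx sM.
  by move=> x; exact: hf_cmx_ge0.
pose y := cmx (P_factor R nu k) *m col_mx (v0 *: u) (v *: u).
pose psi r : 'cV[C]_(nu + nu) := \col_I \sum_q (G q r)^* * y (mxtens_index (I, q)) 0.
pose zeta i q := \sum_l (P_factor R nu k (mxtens_index (lshift nu i, q)) (lshift k l))%:C%C * u l 0.
have yl i q : y (mxtens_index (lshift nu i, q)) 0 = v0 * zeta i q.
  rewrite /y [LHS]mxE big_split_ord /= [X in _ + X]big1 => [|l _]; last first.
    by have [h _ _] := P_factor_block i q l; rewrite [cmx _ _ _]mxE h mul0r.
  rewrite addr0 /zeta mulr_sumr; apply: eq_bigr => l _.
  by rewrite [cmx _ _ _]mxE col_mxEu [(v0 *: u) _ _]mxE mulrCA.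
have yr i q : y (mxtens_index (rshift nu i, q)) 0 = v * zeta i q.
  rewrite /y [LHS]mxE big_split_ord /= [X in X + _]big1 => [|l _]; last first.
    by have [_ h _] := P_factor_block i q l; rewrite [cmx _ _ _]mxE h mul0r.
  rewrite add0r /zeta mulr_sumr; apply: eq_bigr => l _.
  have [_ _ h] := P_factor_block i q l.
  by rewrite [cmx _ _ _]mxE h col_mxEd [(v *: u) _ _]mxE mulrCA.
pose phi r : 'cV[C]_nu := \col_i \sum_q (G q r)^* * zeta i q.
have psiE r : psi r = col_mx (v0 *: phi r) (v *: phi r).
  rewrite -[psi r]vsubmxK; congr col_mx; apply/matrixP => i j; rewrite ord1 !mxE mulr_sumr.
    by apply: eq_bigr => q _; rewrite yl mulrCA.
  by apply: eq_bigr => q _; rewrite yr mulrCA.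
have -> : hf (cmx (P_mult P0 M)) (col_mx (v0 *: u) (v *: u)) = \sum_r hf (cmx P0) (psi r).
  have -> : hf (cmx (P_mult P0 M)) (col_mx (v0 *: u) (v *: u)) = hf (cmx (P0 *t M)) y.
    by rewrite /hf /y ctr_mul ctr_cmx /P_mult !cmxM !mulmxA.
  rewrite hfE [LHS]big_mxtens [RHS](eq_bigr _ (fun r _ => hfE (cmx P0) (psi r))).
  rewrite [RHS]exchange_big; apply: eq_bigr => I _ /=.
  under eq_bigr do rewrite big_mxtens.
  rewrite exchange_big [RHS]exchange_big; apply: eq_bigr => J _ /=.
  have psiT r : (psi r I 0)^* * cmx P0 I J * psi r J 0 =
      \sum_q \sum_q' (y (mxtens_index (I, q)) 0)^* * (cmx P0 I J * (G q r * (G q' r)^*)) *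
         y (mxtens_index (J, q')) 0.
    rewrite !mxE rmorph_sum /= -mulrA mulr_suml; apply: eq_bigr => q _.
    rewrite !mulr_sumr; apply: eq_bigr => q' _.
    by rewrite rmorphM /= conjCK; ring.
  rewrite [RHS](eq_bigr _ (fun r _ => psiT r)).
  rewrite [RHS]exchange_big; apply: eq_bigr => q _ /=.
  rewrite [RHS]exchange_big; apply: eq_bigr => q' _ /=.
  rewrite -mulr_suml -mulr_sumr -mulr_sumr; congr (_ * _ * _).
  rewrite [LHS]mxE tensmxE rmorphM /= [cmx P0 I J]mxE; congr (_ * _).
  transitivity (cmx M q q'); first by rewrite mxE.
  rewrite MG mxE; apply: eq_bigr => r _; congr (_ * _).
  by rewrite /ctr !mxE.
by apply: sumr_ge0 => r _; rewrite psiE; exact: VP.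
Qed.
End multiplier.

(** * Transfer functions and Markov parameters *)

Section resolvent.
Variable R : realType.

Lemma size_det_leq n (M : 'M[{poly R}]_n) : (forall i j, (size (M i j) <= 2)%N) ->
  (size (\det M) <= n.+1)%N.
Proof.
move=> hM; rewrite /determinant (leq_trans (size_sum _ _ _)) //.
apply/bigmax_leqP => s _.
rewrite size_Msign (leq_trans (size_prod_leq _ _)) // leq_subLR.
have : (\sum_(i < n) size (M i (s i)) <= \sum_(i < n) 2)%N by exact: leq_sum.
rewrite sum_nat_const !card_ord.
set S := (\sum_(i < n) size _)%N; lia.
Qed.

Lemma size_mul_lt (a b r : {poly R}) : b != 0 -> (size r < size a)%N ->
  (size (r * b)%R < size (a * b)%R)%N.
Proof.
move=> b0 ra; have a0 : a != 0 by rewrite -size_poly_gt0; lia.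
have [->|r0] := eqVneq r 0.
  by rewrite mul0r size_poly0 size_poly_gt0 mulf_neq0.
rewrite !size_mul //; rewrite -!size_poly_gt0 in b0 r0.
move: (size a) (size b) (size r) ra b0 r0 => sa sb sr; lia.
Qed.

Lemma size_char_poly_mx n (A : 'M[R]_n) i j : (size (char_poly_mx A i j) <= 2)%N.
Proof.
rewrite !mxE; case: (i == j); rewrite ?mulr1n ?mulr0n ?sub0r ?size_XsubC //.
by rewrite size_polyN (leq_trans (size_polyC_leq1 _)).
Qed.

Lemma size_adj n (A : 'M[R]_n) i j : (size (\adj (char_poly_mx A) i j) <= n)%N.
Proof.
case: n A i j => [|n] A i j; first by case: i.
rewrite mxE /cofactor size_Msign size_det_leq // => a b.
by rewrite 2![in X in (size X <= _)%N]mxE size_char_poly_mx.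
Qed.

(** The numerator of [C (X - A)^-1 B] over the denominator [char_poly A];
    polynomials avoid inverting matrices of fractions. *)
Definition resnum n l k (C : 'M[R]_(l, n)) (A : 'M[R]_n) (B : 'M[R]_(n, k)) :
    'M[{poly R}]_(l, k) :=
  map_mx polyC C *m \adj (char_poly_mx A) *m map_mx polyC B.

Lemma size_resnum n l k (C : 'M[R]_(l, n)) (A : 'M[R]_n) (B : 'M[R]_(n, k)) i j :
  (size (resnum C A B i j) < size (char_poly A))%N.
Proof.
rewrite size_char_poly ltnS mxE (leq_trans (size_sum _ _ _)) //.
apply/bigmax_leqP => b _; rewrite mxE [map_mx _ B _ _]mxE mulrC mul_polyC.
rewrite (leq_trans (size_scale_leq _ _)) // (leq_trans (size_sum _ _ _)) //.
apply/bigmax_leqP => a _; rewrite [map_mx _ _ _ _]mxE mul_polyC.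
by rewrite (leq_trans (size_scale_leq _ _)) // size_adj.
Qed.

(** Multiplying the resolvent by [X] splits off the constant [C B]: this is [A
    adj (X - A) = X adj (X - A) - char_poly A]. *)
Lemma resnum_step n l k (C : 'M[R]_(l, n)) (A : 'M[R]_n) (B : 'M[R]_(n, k)) :
  resnum (C *m A) A B =
  'X *: resnum C A B - char_poly A *: map_mx polyC (C *m B).
Proof.
have h : map_mx polyC A *m \adj (char_poly_mx A) =
    'X *: \adj (char_poly_mx A) - (char_poly A)%:M.
  have : char_poly_mx A *m \adj (char_poly_mx A) = (char_poly A)%:M by exact: mul_mx_adj.
  rewrite {1}/char_poly_mx mulmxBl mul_scalar_mx => <-.
  by rewrite opprB addrC subrK.
rewrite /resnum map_mxM -mulmxA [_ *m (_ *m map_mx _ B)]mulmxA.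
rewrite -!mulmxA [map_mx _ A *m (_ *m _)]mulmxA h mulmxBl mulmxBr.
rewrite -!scalemxAl -!scalemxAr mul_scalar_mx -scalemxAr map_mxM.
by rewrite !mulmxA.
Qed.

(** The hypothesis is the equality of two strictly proper transfer functions,
    cleared of denominators. Multiplying both by [X] splits off the constants
    [C B] and [C' B'] ([resnum_step]), which must agree because the remaining
    parts are again strictly proper; so [C A] and [C' A'] satisfy the same
    hypothesis. *)
Lemma resnum_markov n n' l k (C : 'M[R]_(l, n)) (A : 'M[R]_n) (B : 'M[R]_(n, k))
    (C' : 'M[R]_(l, n')) (A' : 'M[R]_n') (B' : 'M[R]_(n', k)) :
  char_poly A' *: resnum C A B = char_poly A *: resnum C' A' B' ->
  forall j, C *m A ^+ j *m B = C' *m A' ^+ j *m B'.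
Proof.
set x := char_poly A; set x' := char_poly A' => eqN.
have x0 : x != 0 by rewrite monic_neq0 // char_poly_monic.
have x'0 : x' != 0 by rewrite monic_neq0 // char_poly_monic.
have step (D : 'M[R]_(l, n)) (D' : 'M[R]_(l, n')) :
    x' *: resnum D A B = x *: resnum D' A' B' ->
    x' *: resnum (D *m A) A B = x *: resnum (D' *m A') A' B' /\ D *m B = D' *m B'.
  move=> e.
  have e1 : x' *: resnum (D *m A) A B - x *: resnum (D' *m A') A' B' =
      (x * x') *: map_mx polyC (D' *m B' - D *m B).
    rewrite !resnum_step -/x -/x'; move: e.
    move: (resnum D A B) (resnum D' A' B') (D *m B) (D' *m B') => N N' P P' e.
    apply/matrixP => i j; have := congr1 (fun M : 'M[{poly R}]_(l, k) => M i j) e.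
    rewrite !mxE polyCB => eij.
    have -> : x' * ('X * N i j - x * (P i j)%:P) - x * ('X * N' i j - x' * (P' i j)%:P) =
       x * x' * ((P' i j)%:P - (P i j)%:P) + 'X * (x' * N i j - x * N' i j) by ring.
    by rewrite eij subrr mulr0 addr0.
  have DB : D' *m B' = D *m B.
    apply/eqP; rewrite -subr_eq0; apply/eqP/matrixP => i j; apply/eqP.
    apply: contraT => nz.
    have := congr1 (fun M : 'M[{poly R}]_(l, k) => M i j) e1.
    have := size_resnum (D *m A) A B i j; have := size_resnum (D' *m A') A' B' i j.
    rewrite -/x -/x'.
    move: (resnum _ _ _) (resnum _ _ _) (D' *m B' - D *m B) nz => N' N d nz s' s.
    rewrite !mxE in nz *; rewrite mulrC => e'.
    have : (size (x * x' * (d i j)%:P)%R < size (x * x')%R)%N.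
      rewrite -e' (leq_ltn_trans (size_polyD _ _)) // size_polyN gtn_max.
      by rewrite size_mul_lt //= [x * N i j]mulrC [x * x']mulrC size_mul_lt.
    by rewrite mulrC mul_polyC size_scale // ltnn.
  split; last by rewrite DB.
  by apply/eqP; rewrite -subr_eq0 e1 DB subrr map_mx0 scaler0.
have all j : x' *: resnum (C *m A ^+ j) A B = x *: resnum (C' *m A' ^+ j) A' B'.
  elim: j => [|j IH]; first by rewrite !expr0 !mulmx1.
  by rewrite !exprSr !mulmxA; have [] := step _ _ IH.
by move=> j; have [] := step _ _ (all j).
Qed.
End resolvent.

Section transfer.
Variable R : realType.
Local Notation C := R[i].
Local Notation ev := (fun (s : C) (r : {poly R}) => (map_poly (real_complex R) r).[s]).

Lemma transfer_resnum l k (Delta : lti R l k) i j :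
  tofrac (char_poly (lti_A Delta)) * (transfer Delta i j - tofrac (lti_D Delta i j)%:P) =
  tofrac (resnum (lti_C Delta) (lti_A Delta) (lti_B Delta) i j).
Proof.
case: Delta => n A B C0 D0 /=; rewrite /transfer /= [in LHS]mxE [X in _ + X - _]mxE addrK.
have cst m1 m2 (M : 'M[R]_(m1, m2)) : map_mx (fun a : R => tofrac (a%:P)) M =
    map_mx (@tofrac {poly R}) (map_mx polyC M) by rewrite -map_mx_comp.
rewrite !cst.
have -> : (tofrac 'X)%:M - map_mx (@tofrac {poly R}) (map_mx polyC A) =
    map_mx (@tofrac {poly R}) (char_poly_mx A).
  by rewrite /char_poly_mx map_mxB map_scalar_mx.
have x0 : tofrac (char_poly A) != 0 by rewrite tofrac_eq0 monic_neq0 // char_poly_monic.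
have PQ : map_mx (@tofrac {poly R}) (char_poly_mx A) *m
    ((tofrac (char_poly A))^-1 *: map_mx (@tofrac {poly R}) (\adj (char_poly_mx A))) = 1%:M.
  rewrite -scalemxAr -map_mxM mul_mx_adj map_scalar_mx scale_scalar_mx.
  by rewrite mulVf.
have [uP _] := mulmx1_unit PQ.
have -> : invmx (map_mx (@tofrac {poly R}) (char_poly_mx A)) =
    (tofrac (char_poly A))^-1 *: map_mx (@tofrac {poly R}) (\adj (char_poly_mx A)).
  by rewrite -[LHS]mulmx1 -PQ mulKmx.
set y := tofrac (char_poly A) in x0 *; set a := y^-1.
have -> : resnum C0 A B = map_mx polyC C0 *m \adj (char_poly_mx A) *m map_mx polyC B by [].
move: (map_mx polyC C0) (\adj _) (map_mx polyC B) => M1 M2 M3.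
have -> : map_mx (@tofrac {poly R}) M1 *m (a *: map_mx (@tofrac {poly R}) M2) *m
    map_mx (@tofrac {poly R}) M3 = a *: map_mx (@tofrac {poly R}) (M1 *m M2 *m M3).
  by rewrite -scalemxAr -scalemxAl !map_mxM.
by rewrite mxE mulrA divff // mul1r mxE.
Qed.

Lemma rat_value_cross (p q : {poly R}) s v : q != 0 ->
  rat_value (tofrac p / tofrac q) (Some s) v -> ev s p = v * ev s q.
Proof.
move=> q0 [p' [q' [q'0 e [evq' ->]]]].
have e' : p * q' = p' * q.
  apply/eqP; rewrite -tofrac_eq !tofracM; move/eqP: e.
  by rewrite eqr_div ?tofrac_eq0.
have := congr1 (ev s) e'; rewrite /= !rmorphM /= !hornerM => {}e'.
by apply: (mulIf evq'); rewrite e' mulrAC divfK // mulrC.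
Qed.

(** A nonzero polynomial has finitely many roots on the imaginary axis. *)
Lemma poly_imag_axis0 (p : {poly R}) : (forall w : R, ev (Complex 0 w) p = 0) -> p = 0.
Proof.
move=> h; apply/eqP; apply: contraT => p0.
pose rs := [seq (Complex 0 n%:R : C) | n <- iota 0 (size p)].
have : (size rs < size (map_poly (real_complex R) p))%N.
  apply: max_poly_roots.
  - by rewrite map_poly_eq0.
  - by apply/allP => _ /mapP[n _ ->]; rewrite /root h.
  - rewrite map_inj_uniq ?iota_uniq // => a b [] /eqP.
    by rewrite eqr_nat => /eqP.
by rewrite size_map size_iota size_map_poly ltnn.
Qed.

Lemma rat_value_fraction (f : {fraction {poly R}}) s v : rat_value f s v ->
  exists2 pq : {poly R} * {poly R}, pq.2 != 0 & f = tofrac pq.1 / tofrac pq.2.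
Proof. by move=> [p [q [q0 e _]]]; exists (p, q). Qed.

Lemma rat_value_imag_inj (f g : {fraction {poly R}}) (v : R -> C) :
  (forall w, rat_value f (Some (Complex 0 w)) (v w)) ->
  (forall w, rat_value g (Some (Complex 0 w)) (v w)) -> f = g.
Proof.
move=> hf hg.
have [[p q] /= q0 fE] := rat_value_fraction (hf 0).
have [[p' q'] /= q'0 gE] := rat_value_fraction (hg 0).
suff e : p * q' = p' * q.
  by rewrite fE gE; apply/eqP; rewrite eqr_div ?tofrac_eq0 // -!tofracM e.
apply/eqP; rewrite -subr_eq0; apply/eqP/poly_imag_axis0 => w.
rewrite rmorphB !rmorphM /= !hornerE /=.
have := hf w; rewrite fE => /(rat_value_cross q0) /= ->.
have := hg w; rewrite gE => /(rat_value_cross q'0) /= ->.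
by ring.
Qed.

Lemma coprime_rep (f : {fraction {poly R}}) s v : rat_value f s v ->
  exists p q : {poly R}, [/\ q \is monic, coprimep p q & f = tofrac p / tofrac q].
Proof.
move=> /rat_value_fraction [[p0 q0] /= q00 fE].
pose g := gcdp p0 q0.
have g0 : g != 0 by rewrite gcdp_eq0 negb_and q00 orbT.
pose q1 := q0 %/ g; pose p1 := p0 %/ g.
have p0E : p0 = p1 * g by rewrite divpK // dvdp_gcdl.
have q0E : q0 = q1 * g by rewrite divpK // dvdp_gcdr.
have q10 : q1 != 0 by apply: contra q00 => /eqP h; rewrite q0E h mul0r.
have lc0 : lead_coef q1 != 0 by rewrite lead_coef_eq0.
exists ((lead_coef q1)^-1 *: p1), ((lead_coef q1)^-1 *: q1); split.
- by rewrite monicE lead_coefZ mulVf.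
- rewrite coprimepZl ?invr_eq0 // coprimepZr ?invr_eq0 //.
  by apply: coprimep_div_gcd; rewrite q00 orbT.
- rewrite fE p0E q0E; apply/eqP; rewrite eqr_div ?tofrac_eq0 //.
    by rewrite -!tofracM tofrac_eq -!mul_polyC; apply/eqP; ring.
  by rewrite mulf_neq0.
  by rewrite scaler_eq0 invr_eq0 (negbTE lc0).
Qed.

(** A coprime denominator divides every other denominator of the same
    fraction. *)
Lemma coprime_no_pole (p q : {poly R}) s v : q \is monic -> coprimep p q ->
  rat_value (tofrac p / tofrac q) (Some s) v -> ev s q != 0.
Proof.
move=> mq cpq [p' [q' [q'0 e [evq' _]]]].
have q0 := monic_neq0 mq.
have e' : p * q' = p' * q.
  apply/eqP; rewrite -tofrac_eq !tofracM; move/eqP: e.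
  by rewrite eqr_div ?tofrac_eq0.
have : q %| p * q' by rewrite e' dvdp_mull.
rewrite Gauss_dvdpr; last by rewrite coprimep_sym.
move=> /dvdpP[r rE]; apply: contra evq' => /eqP h.
by rewrite rE rmorphM hornerM h mulr0.
Qed.

Lemma proper_size (p q : {poly R}) v : q != 0 ->
  rat_value (tofrac p / tofrac q) None v ->
  (size p <= size q)%N.
Proof.
move=> q0 [p' [q' [q'0 e [sz _]]]].
have e' : p * q' = p' * q.
  apply/eqP; rewrite -tofrac_eq !tofracM; move/eqP: e.
  by rewrite eqr_div ?tofrac_eq0.
have [->|p0] := eqVneq p 0; first by rewrite size_poly0.
have p'0 : p' != 0.
  by apply: contraTneq q0 => h; move/eqP: e'; rewrite h mul0r mulf_eq0 (negbTE p0) (negbTE q'0).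
have := congr1 (size : {poly R} -> nat) e'; rewrite !size_mul //.
move: p0 q0 p'0 q'0 sz; rewrite -!size_poly_gt0.
by move: (size p) (size q) (size p') (size q') => a b c d; lia.
Qed.
End transfer.

(** * Scalar transfer matrices and their companion realization *)

Section realization.
Variable R : realType.
Local Notation C := R[i].
Local Notation ev := (fun (s : C) (r : {poly R}) => (map_poly (real_complex R) r).[s]).

(** The off-diagonal entries and the differences of diagonal entries vanish on
    the imaginary axis, hence identically. In lowest terms, the denominator of
    the common diagonal entry vanishes only at poles. *)
Lemma scalar_transfer k (Delta : lti R k k) :
  RHinf (transfer Delta) ->
  (forall s, ext_imag_axis s -> exists v : C,
     forall i j, rat_value (transfer Delta i j) s ((v%:M : 'M[C]_k) i j)) ->
  exists p q : {poly R}, [/\ q \is monic, forall s : C, 0 <= complex.Re s -> ev s q != 0,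
    (size p <= size q)%N &
    forall i j, transfer Delta i j = (i == j)%:R * (tofrac p / tofrac q)].
Proof.
case: k Delta => [|k] Delta stab imag.
  exists 0, 1; split => [||//|[]//]; first exact: monic1.
    by move=> s _; rewrite rmorph1 hornerC oner_neq0.
  by rewrite size_poly0.
have /choice[v vP] : forall w : R, exists v : C, forall i j,
    rat_value (transfer Delta i j) (Some (Complex 0 w)) ((v%:M : 'M[C]_k.+1) i j).
  by move=> w; apply: imag.
have scE (u : C) i j : (u%:M : 'M[C]_k.+1) i j = u *+ (i == j) by rewrite mxE.
have [vinf vinfP] := imag None Logic.I.
have [p [q [mq cpq fE]]] := coprime_rep (vinfP 0 0).
exists p, q; split => //.
- move=> s s0; have [w wP] := stab (Some s) s0 0 0.
  by move: wP; rewrite fE; exact: coprime_no_pole.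
- by have := vinfP 0 0; rewrite fE; apply: proper_size; exact: monic_neq0.
- move=> i j; have [->|ij] := eqVneq i j.
    rewrite mul1r -fE; apply: (rat_value_imag_inj (v := v)) => w.
      by have := vP w j j; rewrite scE eqxx mulr1n.
    by have := vP w 0 0; rewrite scE eqxx mulr1n.
  rewrite mul0r; apply: (rat_value_imag_inj (v := fun=> 0)) => w.
    by have := vP w i j; rewrite scE (negbTE ij) mulr0n.
  exists 0, 1; split; first exact: oner_neq0.
    by rewrite tofrac0 mul0r.
  by rewrite /= map_poly0 rmorph1 horner0 hornerC oner_neq0 mul0r.
Qed.

(** Over an abstract field, where [field] does not have to look inside
    fractions of polynomials. *)
Lemma clear_denominator (F : fieldType) (x b p q d : F) : q != 0 ->
  x * (b * p - q * d) = q * (x * (b * (p / q) - d)).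
Proof. by move=> q0; field. Qed.

(** A comparison of degrees: [p / q] and the feedthrough matrix differ by a
    strictly proper function, so that the feedthrough is the value [d] of
    [p / q] at infinity, and [(p - d q) / q] is the strictly proper part. *)
Lemma scalar_feedthrough k (Delta : lti R k k) (p q : {poly R})
    (d := p`_(size q).-1) :
  q \is monic -> (size p <= size q)%N ->
  (forall i j, transfer Delta i j = (i == j)%:R * (tofrac p / tofrac q)) ->
  lti_D Delta = d%:M /\
  q *: resnum (lti_C Delta) (lti_A Delta) (lti_B Delta) =
  char_poly (lti_A Delta) *: (p - d *: q)%:M.
Proof.
move=> mq pq trE; have q0 := monic_neq0 mq.
set x := char_poly _; have x0 : x != 0 by rewrite monic_neq0 // char_poly_monic.
set N := resnum _ _ _.
have key i j : x * ((i == j)%:R * p - q * (lti_D Delta i j)%:P) = q * N i j.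
  have := transfer_resnum Delta i j; rewrite -/x -/N trE => h.
  apply/eqP; rewrite -tofrac_eq !tofracM tofracB -h !tofracM; apply/eqP.
  have -> : tofrac (i == j)%:R = (i == j)%:R :> {fraction {poly R}} by rewrite rmorph_nat.
  by apply: clear_denominator; rewrite tofrac_eq0.
have szN i j : (size (N i j) < size x)%N by exact: size_resnum.
have D0 i j : i != j -> lti_D Delta i j = 0 /\ N i j = 0.
  move=> ij; have := key i j; rewrite (negbTE ij) mul0r sub0r => h.
  have NE : N i j = - (lti_D Delta i j)%:P * x.
    by apply: (mulfI q0); rewrite -h; ring.
  have D0 : lti_D Delta i j = 0.
    apply/eqP; apply: contraT => nz; have := szN i j.
    by rewrite NE mulNr size_polyN mul_polyC size_scale // ltnn.
  by rewrite NE D0 polyC0 oppr0 mul0r.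
have DE i : lti_D Delta i i = d.
  have h := key i i; rewrite eqxx mul1r in h.
  have : (size (p - q * (lti_D Delta i i)%:P)%R < size q)%N.
    rewrite ltnNge; apply/negP => sq.
    have m0 : p - q * (lti_D Delta i i)%:P != 0.
      by rewrite -size_poly_gt0 (leq_trans _ sq) // size_poly_gt0.
    have := size_mul_lt q0 (szN i i); rewrite [N i i * q]mulrC -h !size_mul //.
    move: sq m0 q0 x0; rewrite -!size_poly_gt0.
    move: (size (p - _)) (size q) (size x) => a b c; lia.
  move=> sz; have := nth_default 0 (_ : (size (p - q * (lti_D Delta i i)%:P)%R <= (size q).-1)%N).
  rewrite coefB coefMC -lead_coefE (monicP mq) mul1r => e; apply/eqP.
  rewrite eq_sym -subr_eq0; apply/eqP/e.
  by rewrite -ltnS prednK // size_poly_gt0.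
split.
  apply/matrixP => i j; rewrite !mxE; have [->|ij] := eqVneq i j.
    by rewrite DE.
  by have [-> _] := D0 _ _ ij.
apply/matrixP => i j; rewrite [LHS]mxE [RHS]mxE [X in _ = _ * X]mxE.
have [->|ij] := eqVneq i j.
  by rewrite -key eqxx DE mul1r mulr1n -mul_polyC; ring.
by have [_ ->] := D0 _ _ ij; rewrite !mulr0.
Qed.

Lemma noneigenvalue_unitmx n (A : 'M[C]_n) s :
  ~~ eigenvalue A s -> s%:M - A \in unitmx.
Proof.
move=> neig; rewrite unitmxE unitfE; apply: contra neig => /det0P[r r0 rA].
apply/eigenvalueP; exists r => //; apply/eqP; rewrite eq_sym -subr_eq0.
by rewrite -mul_mx_scalar -mulmxBr rA.
Qed.

Section companion.
Variables (k : nat) (n q : {poly R}).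
Hypothesis mq : q \is monic.
Hypothesis nq : (size n < size q)%N.
Let m := (size q).-1.

Definition comp_A : 'M[R]_(m * k) := companionmx q *t (1%:M : 'M[R]_k).
Definition comp_B : 'M[R]_(m * k, k) := \matrix_(i, j)
  ((((mxtens_unindex i).1 == m.-1 :> nat) && ((mxtens_unindex i).2 == j))%:R).
Definition comp_C : 'M[R]_(k, m * k) := \matrix_(i, l)
  (n`_((mxtens_unindex l).1) * (i == (mxtens_unindex l).2)%:R).
(** The matrix [q (X - comp_A)^-1 comp_B], which has the monomials [X^i] as
    entries: [comp_AV] is its defining equation. *)
Let comp_V : 'M[{poly R}]_(m * k, k) := \matrix_(i, j)
  ('X ^+ ((mxtens_unindex i).1) * ((mxtens_unindex i).2 == j)%:R).

Lemma comp_CV : map_mx polyC comp_C *m comp_V = n%:M.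
Proof.
apply/matrixP => i j; rewrite mxE big_mxtens.
transitivity (\sum_(l < m) n`_l *: 'X^l * (i == j)%:R : {poly R}).
  apply: eq_bigr => l _; rewrite (bigD1 j) //= big1 => [|a aj].
    rewrite !mxE !mxtens_indexK /= eqxx addr0 polyCM -mul_polyC mulr1.
    by rewrite mulrAC; case: eqP => _; rewrite ?polyC1 ?polyC0 ?mulr1 ?mulr0.
  by rewrite !mxE !mxtens_indexK /= (negbTE aj) !mulr0.
rewrite -mulr_suml [RHS]mxE -[RHS]mulr_natr; congr (_ * _).
rewrite -poly_def; apply/polyP => l; rewrite coef_poly.
case: ltnP => // ml; rewrite nth_default // (leq_trans _ ml) //.
by rewrite -ltnS prednK // size_poly_gt0 monic_neq0.
Qed.

Lemma comp_AV : char_poly_mx comp_A *m comp_V = q *: map_mx polyC comp_B.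
Proof.
apply/matrixP => i j; case: (mxtens_indexP i) => {}i a.
rewrite mxE big_mxtens.
transitivity (\sum_(l < m) ('X *+ (i == l) - (companionmx q i l)%:P) * 'X^l * (a == j)%:R : {poly R}).
  apply: eq_bigr => l _; rewrite (bigD1 j) //= big1 => [|b bj].
    rewrite [comp_V _ _]mxE mxtens_indexK /= eqxx mulr1 addr0.
    have -> : char_poly_mx comp_A (mxtens_index (i, a)) (mxtens_index (l, j)) =
      ('X *+ (i == l) - (companionmx q i l)%:P) * (a == j)%:R.
      rewrite /char_poly_mx [LHS]mxE [X in X + _]mxE [X in _ + X]mxE [X in _ - X]mxE tensmxE.
      rewrite (can_eq (@mxtens_indexK _ _)) xpair_eqE [(1%:M) a j]mxE.
      by case: (a == j); rewrite ?andbT ?andbF ?mulr1 ?mulr0 ?polyC0 ?subrr ?mulr0n.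
    by rewrite mulrAC.
  by rewrite [comp_V _ _]mxE !mxtens_indexK /= (negbTE bj) !mulr0.
rewrite -mulr_suml [RHS]mxE [X in _ = _ * X]mxE [X in _ = _ * X%:P]mxE mxtens_indexK /=.
have -> : ((i == m.-1 :> nat) && (a == j))%:R%:P = (i == m.-1 :> nat)%:R * (a == j)%:R :> {poly R}.
  by rewrite -mulnb natrM polyCM -!polyC_natr.
rewrite mulrA; congr (_ * _).
have m0 : (0 < m)%N by case: (m) i => [[]|].
have XiE : \sum_(l < m) 'X *+ (i == l) * 'X^l = 'X^(i.+1) :> {poly R}.
  rewrite (bigD1 i) //= eqxx mulr1n big1 ?addr0 -?exprS // => l li.
  by rewrite eq_sym (negbTE li) mulr0n mul0r.
under eq_bigr do rewrite mulrBl.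
rewrite sumrB XiE; have [im|im] := eqVneq (i : nat) m.-1.
  have qE : q = \sum_(l < m) (q`_l)%:P * 'X^l + 'X^m.
    rewrite -{1}[q]coefK poly_def -(big_mkord xpredT (fun l => q`_l *: 'X^l)).
    rewrite -[size q]prednK ?size_poly_gt0 ?monic_neq0 // -/m big_nat_recr //=.
    rewrite -lead_coefE (monicP mq) scale1r big_mkord; congr (_ + _).
    by apply: eq_bigr => l _; rewrite mul_polyC.
  rewrite mulr1 im prednK // [RHS]qE addrC -sumrN; congr (_ + _).
  apply: eq_bigr => l _; rewrite mxE im eqxx.
  by rewrite polyCN mulNr opprK.
rewrite mulr0; have im1 : (i.+1 < m)%N by have := ltn_ord i; move: im m0; lia.
rewrite (bigD1 (Ordinal im1)) //= big1 => [|l li].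
  by rewrite mxE (negbTE im) /= eqxx polyC1 mul1r addr0 subrr.
rewrite mxE (negbTE im) (_ : (i.+1 == l :> nat) = false) ?polyC0 ?mul0r //.
by apply/negbTE; apply: contra li => /eqP h; apply/eqP/val_inj.
Qed.

Lemma comp_resnum : q *: resnum comp_C comp_A comp_B = char_poly comp_A *: n%:M.
Proof.
rewrite -comp_CV [RHS]scalemxAr.
have <- : \adj (char_poly_mx comp_A) *m (q *: map_mx polyC comp_B) = char_poly comp_A *: comp_V.
  by rewrite -comp_AV mulmxA mul_adj_mx mul_scalar_mx.
by rewrite /resnum -scalemxAr -scalemxAr !mulmxA.
Qed.

(** A nonzero slice of an eigenvector of [companionmx q *t 1] is an
    eigenvector of [companionmx q], so that the eigenvalues are zeros of
    [q]. *)
Lemma comp_hurwitz : (forall s : C, 0 <= complex.Re s -> ev s q != 0) -> hurwitz comp_A.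
Proof.
move=> hq l /eigenvalueP[u uA u0]; rewrite ltNge; apply/negP => l0.
have /eqP[] := hq l l0.
have : exists a, (\row_(i < m) u 0 (mxtens_index (i, a))) != 0.
  apply/existsP; rewrite -negb_forall; apply: contra u0 => /forallP h.
  apply/eqP/rowP => b; case: (mxtens_indexP b) => i a; rewrite mxE.
  by have /eqP/rowP/(_ i) := h a; rewrite !mxE.
move=> [a ua].
have : eigenvalue (cmx (companionmx q)) l.
  apply/eigenvalueP; exists (\row_(i < m) u 0 (mxtens_index (i, a))) => //.
  apply/rowP => j; have := congr1 (fun M : 'rV_(m * k) => M 0 (mxtens_index (j, a))) uA.
  rewrite /= [in X in _ = X -> _]mxE => h; rewrite [RHS]mxE [X in _ = _ * X]mxE -h.
  rewrite [LHS]mxE [RHS]mxE big_mxtens; apply: eq_bigr => i _.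
  rewrite (bigD1 a) //= big1 => [|b ba]; rewrite [cmx comp_A _ _]mxE tensmxE [(1%:M) _ a]mxE.
    by rewrite eqxx mulr1 addr0 !mxE.
  by rewrite (negbTE ba) mulr0 mulr0.
rewrite eigenvalue_root_char /cmx -map_char_poly companionmxK //.
by move=> /rootP.
Qed.

(** [comp_AV] evaluated at [s] solves the state equation:
    [xi = q(s)^-1 V(s) u]; then [comp_CV] gives the output. *)
Lemma comp_freq (s : C) (xi : 'cV[C]_(m * k)) (u : 'cV[C]_k) :
  ~~ eigenvalue (cmx comp_A) s -> ev s q != 0 ->
  cmx comp_A *m xi + cmx comp_B *m u = s *: xi ->
  cmx comp_C *m xi = (ev s n / ev s q) *: u.
Proof.
move=> neig qs e.
pose evm : {rmorphism {poly R} -> C} := (horner_eval s \o map_poly (real_complex R)).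
have evC a : evm a%:P = a%:C%C by rewrite /evm /= map_polyC /horner_eval hornerC.
pose V := map_mx evm comp_V.
have evP p1 p2 (M : 'M[R]_(p1, p2)) : map_mx evm (map_mx polyC M) = cmx M.
  by apply/matrixP => i j; rewrite !mxE evC.
have CV : cmx comp_C *m V = (ev s n)%:M.
  by rewrite -evP -map_mxM comp_CV map_scalar_mx.
have AV : (s%:M - cmx comp_A) *m V = ev s q *: cmx comp_B.
  have := congr1 (map_mx evm) comp_AV; rewrite map_mxM map_mxZ evP.
  rewrite /char_poly_mx map_mxB map_scalar_mx evP.
  by rewrite /evm /= map_polyX /horner_eval hornerX.
have sA := noneigenvalue_unitmx neig.
have -> : xi = (ev s q)^-1 *: (V *m u).
  apply: (can_inj (mulKmx sA)).
  rewrite -scalemxAr mulmxA AV -scalemxAl scalerA mulVf // scale1r.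
  by rewrite mulmxBl mul_scalar_mx -e addrAC subrr add0r.
by rewrite -scalemxAr mulmxA CV mul_scalar_mx scalerA mulrC.
Qed.
End companion.
End realization.

Section uncertainty.
Variable R : realType.
Local Notation C := R[i].
Local Notation ev := (fun (s : C) (r : {poly R}) => (map_poly (real_complex R) r).[s]).

(** The scalars [v] whose multiples of the identity form [V_set]; the
    coefficient [1] completes [v] to the homogeneous coordinates [(1, v)] of
    [P_mult_psd]. *)
Definition admissible nu (P0 : 'M[R]_(nu + nu)) (v : C) : Prop :=
  forall y : 'cV[C]_nu, 0 <= hf (cmx P0) (col_mx (1 *: y) (v *: y)).

Lemma V_setP nu k (P0 : 'M[R]_(nu + nu)) W : V_set k P0 W ->
  exists2 v : C, W = v%:M & admissible P0 v.
Proof.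
move=> [v [WE [_ psd]]]; exists v => // y.
have := psd y; rewrite /hf !mulmxA -ctr_mul -mulmxA.
by rewrite mul_col_mx mul1mx mul_scalar_mx scale1r.
Qed.

(** The value at infinity does not depend on the fraction chosen to read it:
    compare the coefficients of highest possible degree in the
    cross-multiplied equation. *)
Lemma rat_value_infty (p q : {poly R}) v : q \is monic -> (size p <= size q)%N ->
  rat_value (tofrac p / tofrac q) None v -> v = (p`_(size q).-1)%:C%C.
Proof.
move=> mq pq [p' [q' [q'0 e [sz ->]]]]; congr (_%:C%C).
have q0 := monic_neq0 mq.
have e' : p * q' = p' * q.
  apply/eqP; rewrite -tofrac_eq !tofracM; move/eqP: e.
  by rewrite eqr_div ?tofrac_eq0.
have top (a b : {poly R}) m n : (size a <= m.+1)%N -> (size b <= n.+1)%N ->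
    (a * b)`_(m + n) = a`_m * b`_n.
  move=> sa sb; have im : (m < (m + n).+1)%N by rewrite ltnS leq_addr.
  rewrite coefM (bigD1 (Ordinal im)) //= addKn big1 ?addr0 // => i im'.
  have [lt|ge] := ltnP i m.
    rewrite [b`__]nth_default ?mulr0 // (leq_trans sb) //; lia.
  rewrite [a`__]nth_default ?mul0r // (leq_trans sa) // ltn_neqAle ge andbT.
  by apply: contra im' => /eqP h; apply/eqP/val_inj.
have q1 : size q = (size q).-1.+1 by rewrite prednK // size_poly_gt0.
have q'1 : size q' = (size q').-1.+1 by rewrite prednK // size_poly_gt0.
have := congr1 (fun r : {poly R} => r`_((size q).-1 + (size q').-1)) e'.
rewrite /= top -?q1 -?q'1 // [in RHS]addnC top -?q1 -?q'1 //.
rewrite -[q`__]lead_coefE (monicP mq) mulr1 -lead_coefE => <-.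
by rewrite mulfK // lead_coef_eq0.
Qed.

Lemma noneigenvalue_inj n (A : 'M[C]_n) s (xi : 'cV[C]_n) :
  ~~ eigenvalue A s -> A *m xi = s *: xi -> xi = 0.
Proof.
move=> /noneigenvalue_unitmx sA e.
by rewrite -[xi](mulKmx sA) mulmxBl mul_scalar_mx e subrr mulmx0.
Qed.

Lemma imag_Re (w : C) : w \is Num.real -> complex.Re ('i * w) = 0.
Proof.
move=> /CrealP wr.
have : ('i * w)^* = - ('i * w) by rewrite rmorphM /= wr conjCi mulNr.
move: ('i * w) => -[a b] /eqP; rewrite eq_complex /= => /andP[/eqP h _]; lra.
Qed.

(** The realization that comes with [Delta] may have unstable modes that are
    uncontrollable or unobservable. The transfer matrix, however, is a stable
    scalar function times the identity, and the companion realization of that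
    function has the same Markov parameters and a Hurwitz state matrix. The
    last clause is the frequency condition required by [storage_exists]: at an
    imaginary frequency, and at infinity when [xi = 0], the output is an
    admissible multiple of the input. *)
Lemma hurwitz_realization nu k (P0 : 'M[R]_(nu + nu)) (Delta : lti R k k) :
  Delta_set (V_set k P0) Delta ->
  exists m (A : 'M[R]_m) (B : 'M[R]_(m, k)) (C0 : 'M[R]_(k, m)),
  [/\ hurwitz A,
      forall j, lti_C Delta *m lti_A Delta ^+ j *m lti_B Delta = C0 *m A ^+ j *m B &
      forall (xi : 'cV[C]_m) (u : 'cV[C]_k), col_mx xi u != 0 ->
        xi = 0 \/ (exists2 w : C, w \is Num.real &
                     cmx A *m xi + cmx B *m u = ('i * w) *: xi) ->
        u != 0 /\ exists2 v, admissible P0 v & cmx C0 *m xi + cmx (lti_D Delta) *m u = v *: u].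
Proof.
move=> [stab imag].
have imag' s : ext_imag_axis s -> exists2 v : C, admissible P0 v &
    forall i j, rat_value (transfer Delta i j) s ((v%:M : 'M[C]_k) i j).
  by move=> /imag[W /V_setP[v -> vP] h]; exists v.
have [||p [q [mq hq pq trE]]] := scalar_transfer (Delta := Delta) => //.
  by move=> s /imag'[v _ h]; exists v.
have [DE resE] := scalar_feedthrough mq pq trE.
move: resE; set d := p`_(size q).-1 in DE *; set n := p - d *: q => resE.
have q0 := monic_neq0 mq.
have nq : (size n < size q)%N.
  have szn : (size n <= size q)%N.
    rewrite (leq_trans (size_polyD _ _)) // geq_max pq size_polyN.
    by rewrite (leq_trans (size_scale_leq _ _)).
  rewrite ltn_neqAle szn andbT; apply/eqP => e.
  have : lead_coef n = 0.
    rewrite lead_coefE e coefB coefZ -lead_coefE (monicP mq) mulr1 -/d.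
    by rewrite subrr.
  move=> /eqP; rewrite lead_coef_eq0 => /eqP n0.
  by move: q0; rewrite -size_poly_eq0 -e n0 size_poly0.
have hA := comp_hurwitz (k := k) mq hq.
exists _, (comp_A k q), (comp_B k q), (comp_C k n q); split => //.
  apply: resnum_markov; have cr := comp_resnum k mq nq.
  move: resE cr; move: (resnum _ _ _) (resnum _ _ _) => N N' e e'.
  apply/matrixP => i j; apply: (mulfI q0); rewrite [(_ *: N) _ _]mxE [(_ *: N') _ _]mxE.
  have := congr1 (fun M : 'M[{poly R}]_k => M i j) e.
  have := congr1 (fun M : 'M[{poly R}]_k => M i j) e'.
  by rewrite /= !mxE => h' h; rewrite mulrCA h [RHS]mulrCA h' mulrCA.
move=> xi u xu0 h.
have neig s : complex.Re s = 0 -> ~~ eigenvalue (cmx (comp_A k q)) s.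
  by move=> s0; apply/negP => /hA; rewrite s0 ltxx.
have u0 : u != 0.
  apply: contra xu0 => /eqP u0; case: h => [->|[w wr]].
    by rewrite u0 col_mx0.
  rewrite u0 mulmx0 addr0 => e.
  by rewrite (noneigenvalue_inj (neig _ (imag_Re wr)) e) col_mx0.
split => //.
have [i0 _] : exists i : 'I_k, u i 0 != 0.
  apply/existsP; rewrite -negb_forall; apply: contra u0 => /forallP h'.
  by apply/eqP/matrixP => i j; rewrite ord1 mxE; apply/eqP.
case: h => [->|[w wr e]].
  have [v vP vE] := imag' None Logic.I.
  exists v => //; rewrite mulmx0 add0r DE /cmx map_scalar_mx mul_scalar_mx.
  have := vE i0 i0; rewrite trE eqxx mul1r [(_%:M) _ _]mxE eqxx mulr1n.
  by move=> /(rat_value_infty mq pq) ->.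
set s := 'i * w in e; have s0 : complex.Re s = 0 by exact: imag_Re.
have [v vP vE] := imag' (Some s) s0.
exists v => //.
have qs : ev s q != 0 by apply: hq; rewrite s0.
rewrite (comp_freq mq nq (neig _ s0) qs e) DE /cmx map_scalar_mx mul_scalar_mx -scalerDl.
congr (_ *: _).
have := vE i0 i0; rewrite trE eqxx mul1r [(_%:M) _ _]mxE eqxx mulr1n.
move=> /(rat_value_cross q0) /= pE; apply: (mulIf qs); rewrite -pE mulrDl divfK //.
by rewrite /n rmorphB /= map_polyZ /= hornerD hornerN hornerZ; ring.
Qed.
End uncertainty.

(** * Absolutely continuous functions *)

Section ac_monotone.
Variable R : realType.
Implicit Types f g : R -> R.

Definition subdivision (T : R) (N : nat) (a b : 'I_N -> R) : Prop :=
  (forall i, 0 <= a i /\ a i <= b i /\ b i <= T) /\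
  (forall i j, i != j -> b i <= a j \/ b j <= a i).

Definition abs_continuous f : Prop :=
  forall T : R, 0 <= T -> forall e : R, 0 < e -> exists2 d : R, 0 < d &
    forall (N : nat) (a b : 'I_N -> R), subdivision T a b ->
      \sum_i (b i - a i) < d -> \sum_i `|f (b i) - f (a i)| < e.

(** The supremum [u] of the times up to which [g] stays below [g 0] satisfies
    [g u <= g 0], and the local hypothesis at [u] allows going beyond [u]
    unless [u = T]. *)
Lemma nonincreasing_local g (T : R) : 0 <= T ->
  (forall t, 0 <= t <= T -> exists2 d, 0 < d & forall s, 0 <= s <= T ->
     `|s - t| < d -> (t <= s -> g s <= g t) /\ (s <= t -> g t <= g s)) ->
  g T <= g 0.
Proof.
move=> T0 loc.
(* [S] is an interval starting at [0]. *)
pose S := [set t | 0 <= t <= T /\ forall s, 0 <= s <= t -> g s <= g 0].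
have S0 : S 0.
  split; first by rewrite lexx T0.
  by move=> s /andP[s0 s1]; have -> : s = 0 by apply/eqP; rewrite eq_le s0 s1.
have Sub : has_sup S by split; [exists 0|exists T => t [/andP[_ tT] _]].
pose u := sup S.
have u0 : 0 <= u by exact: sup_upper_bound.
have uT : u <= T by apply: ge_sup; [exists 0|move=> t [/andP[_ tT] _]].
have [d d0 dP] := loc u (introT andP (conj u0 uT)).
have [t St tu] := sup_adherent d0 Sub.
have tu' : t <= u by exact: sup_upper_bound.
have [/andP[t0 tT] Pt] := St.
have gu : g u <= g 0.
  have [_ h] := dP t (introT andP (conj t0 tT)) ltac:(rewrite ltr_norml; apply/andP; split; move: tu; rewrite -/u; lra).
  exact: le_trans (h tu') (Pt t (introT andP (conj t0 (lexx t)))).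
have Su : forall s, 0 <= s -> s <= T -> s < u + d -> g s <= g 0.
  move=> s s0 sT su; have [st|ts] := leP s t; first by apply: Pt; rewrite s0 st.
  have [us|su'] := leP u s.
    have [h _] := dP s (introT andP (conj s0 sT)) ltac:(rewrite ltr_norml; apply/andP; split; lra).
    exact: le_trans (h us) gu.
  have [t' St' t's] := @sup_adherent _ S (u - s) ltac:(lra) Sub.
  by apply: St'.2; rewrite s0 /=; move: t's; rewrite -/u; lra.
have [uT'|Tu] := ltP u T; last first.
  by apply: Su; [| |lra].
have [v [uv vT vd]] : exists v, [/\ u < v, v <= T & v < u + d].
  have [h|h] := leP T (u + d / 2); first by exists T; split => //; lra.
  by exists (u + d / 2); split; lra.
have vS : S v.
  split; first by apply/andP; split; lra.
  by move=> s /andP[s0 sv]; apply: Su => //; lra.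
by have := sup_upper_bound Sub vS; rewrite -/u; lra.
Qed.

Lemma itv_family_trivIset (T : R) N (a b : 'I_N -> R) : subdivision T a b ->
  trivIset setT (fun i => `]a i, b i[%classic : set R).
Proof.
move=> [ab disj] i j _ _ [x [/=]].
rewrite !in_itv /= => /andP[ax xb] /andP[ax' xb'].
apply/eqP/negPn/negP => ij.
by case: (disj i j ij); lra.
Qed.

Lemma itv_family_measure (T : R) N (a b : 'I_N -> R) : subdivision T a b ->
  lebesgue_measure (\big[setU/set0]_(i < N) (`]a i, b i[%classic : set R)) =
  (\sum_i (b i - a i))%:E.
Proof.
move=> sub.
have mI (i : 'I_N) : measurable (`]a i, b i[%classic : set R) by [].
transitivity (\sum_(i < N) lebesgue_measure (`]a i, b i[%classic : set R))%E.
  apply: (measure_semi_additive_ord lebesgue_measure mI).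
    exact: itv_family_trivIset sub.
  exact: bigsetU_measurable.
rewrite -sumEFin; apply: eq_bigr => i _.
rewrite lebesgue_measure_itv /= lte_fin.
have [_ [abi _]] := sub.1 i.
case: ltP => // h; congr (_%:E).
by move: abi h; lra.
Qed.

(** The supremum of this set is the total variation of [f] over the part of
    [O] inside [[0, t]]. *)
Definition var_on (O : set R) f (t : R) : set R :=
  [set v | exists N (a b : 'I_N -> R), [/\ subdivision t a b,
     forall i, `]a i, b i[%classic `<=` O & v = \sum_i `|f (b i) - f (a i)|]].

Lemma var_on0 O f t : 0 <= t -> var_on O f t 0.
Proof.
move=> t0; exists 0%N, (fun _ => 0), (fun _ => 0).
by split; [split => -[] //| case|rewrite big_ord0].
Qed.

Lemma var_onS O f s t : s <= t -> var_on O f s `<=` var_on O f t.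
Proof.
move=> st v [N [a [b [[ab dis] abO ->]]]]; exists N, a, b; split => //.
by split => // i; have [? [? ?]] := ab i; do !split => //; lra.
Qed.

Lemma var_on_cat O f s t v : 0 <= s -> s <= t -> `]s, t[%classic `<=` O ->
  var_on O f s v -> var_on O f t (v + `|f t - f s|).
Proof.
move=> s0 st stO [N [a [b [[ab dis] abO ->]]]].
pose ex (x : 'I_N -> R) y (i : 'I_N.+1) := if unlift ord_max i is Some j then x j else y.
have exl x y i : ex x y (lift ord_max i) = x i by rewrite /ex liftK.
have exm x y : ex x y ord_max = y by rewrite /ex unlift_none.
exists N.+1, (ex a s), (ex b t); split.
- split.
    move=> i; case: (unliftP ord_max i) => [j|] ->; rewrite ?exl ?exm //.
    by have [? [? ?]] := ab j; do !split => //; lra.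
  move=> i j; case: (unliftP ord_max i) => [i'|] ->;
    case: (unliftP ord_max j) => [j'|] ->; rewrite ?exl ?exm ?eqxx //.
  - by move=> h; apply: dis; apply: contra h => /eqP ->.
  - by move=> _; left; have [_ []] := ab i'.
  - by move=> _; right; have [_ []] := ab j'.
- move=> i; case: (unliftP ord_max i) => [j|] ->; rewrite ?exl ?exm //.
- rewrite big_ord_recr /= exm exm; congr (_ + _).
  apply: eq_bigr => i _.
  have -> : widen_ord (leqnSn N) i = lift ord_max i.
    by apply: val_inj; rewrite /= /bump leqNgt ltn_ord.
  by rewrite !exl.
Qed.

(** Off a null set [f] has a nonpositive derivative, so [f t - e1 * t] does
    not increase near such a [t]. The null set is covered by an open set [O]
    so small that, by absolute continuity, the variation [phi] of [f] over [O]
    is at most [e / 2], and [f - phi] does not increase near the points of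
    [O]. Hence [nonincreasing_local] applies to [f t - e1 * t - phi t], and
    the two corrections together cost at most [e]. *)
Lemma ac_nonincreasing f : abs_continuous f ->
  {ae lebesgue_measure, forall t : R, 0 < t ->
     exists2 l, is_derive t 1 f l & l <= 0} ->
  forall T, 0 <= T -> f T <= f 0.
Proof.
move=> acf [N0 [mN0 N00 sN0]] T T0.
have T1 : 0 < 1 + T by lra.
apply/ler_addgt0Pr => e e0.
pose e1 := e / 2 / (1 + T).
have e10 : 0 < e1 by rewrite !divr_gt0 //; lra.
have e20 : 0 < e / 2 by lra.
have [d d0 dP] := acf T T0 (e / 2) e20.
(* The derivative is controlled at positive times only, so that [0] joins the
   exceptional set. *)
pose N1 := N0 `|` [set 0].
have mN1 : measurable N1 by apply: measurableU.
have N10 : lebesgue_measure N1 = 0%E.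
  by apply: null_set_setU => //; exact: lebesgue_measure_set1.
have N1oo : (lebesgue_measure N1 < +oo)%E by rewrite N10 ltry.
have N1le : (lebesgue_measure N1 <= 0)%E by rewrite N10.
have [ O [oO sO OP]] := @lebesgue_regularity_outer R N1 d mN1 N1oo d0.
have mO : measurable O by exact: open_measurable.
have muO : (lebesgue_measure O < d%:E)%E.
  have -> : O = (O `\` N1) `|` N1 by rewrite setUC setDUK.
  apply: (le_lt_trans (measureU2 _ _ _)) => //; first exact: measurableD.
  apply: le_lt_trans OP; rewrite -[leRHS]adde0.
  by apply: leeD; [exact: lexx|exact: N1le].
have phi_ub t : 0 <= t <= T -> ubound (var_on O f t) (e / 2).
  move=> /andP[t0 tT] v /(var_onS tT) [N [a [b [ab abO ->]]]].
  apply/ltW/dP => //; rewrite -lte_fin.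
  rewrite -(itv_family_measure ab); apply: le_lt_trans muO.
  apply: le_measure => //; rewrite ?inE //; first exact: bigsetU_measurable.
  apply: (big_ind (fun A : set R => A `<=` O)) => // A B hA hB.
  by rewrite subUset.
pose phi t := sup (var_on O f t).
have hs t : 0 <= t <= T -> has_sup (var_on O f t).
  by move=> tT; split; [exists 0; apply: var_on0; case/andP: tT|exists (e / 2); exact: phi_ub].
have phi_mon s t : 0 <= s <= T -> 0 <= t <= T -> s <= t -> phi s <= phi t.
  move=> sT tT st; apply: le_sup; [|exact: (hs s sT).1|exact: hs].
  by move=> v /(var_onS st) vt; exists v; split => //.
have phi_cat s t : 0 <= s <= T -> 0 <= t <= T -> s <= t -> `]s, t[%classic `<=` O ->
    phi s + `|f t - f s| <= phi t.
  move=> sT tT st stO; rewrite -lerBrDr.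
  apply: ge_sup; first exact: (hs s sT).1.
  move=> v vs; rewrite lerBrDr; apply: (sup_upper_bound (hs t tT)).
  by apply: var_on_cat => //; case/andP: sT.
pose g t := f t - e1 * t - phi t.
have : g T <= g 0.
  apply: nonincreasing_local => // t tT; case/andP: (tT) => t0 tT'.
  (* On an interval inside [O], the increment of [phi] is at least that of
     [f]. *)
  have [tO|tO] := pselect (O t).
    have /(nbhs_ballP t)[r /= r0 rP] : nbhs t O by move: oO; rewrite openE; apply.
    exists r => // s sT st.
    have seg x y : ball t r x -> ball t r y -> `]x, y[%classic `<=` O.
      move=> bx bY z /=; rewrite in_itv /= => /andP[xz zy]; apply: rP.
      move: bx bY; rewrite /ball /= !ltr_norml => /andP[? ?] /andP[? ?].
      by apply/andP; split; lra.
    have bt : ball t r t by exact: ballxx.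
    have bs : ball t r s by rewrite /ball /= distrC.
    rewrite /g; split => h.
      have := phi_cat _ _ tT sT h (seg _ _ bt bs).
      have := ler_norm (f s - f t).
      have : e1 * t <= e1 * s by rewrite ler_pM2l.
      by lra.
    have := phi_cat _ _ sT tT h (seg _ _ bs bt).
    have := ler_norm (f t - f s).
    have : e1 * s <= e1 * t by rewrite ler_pM2l.
    by lra.
  have t00 : 0 < t.
    rewrite lt_neqAle t0 andbT eq_sym; apply/eqP => t00; apply: tO; apply: sO.
    by right; rewrite /= t00.
  have [l lf l0] : exists2 l, is_derive t 1 f l & l <= 0.
    have : ~ N1 t by move/sO.
    by rewrite not_orE => -[] nN _; apply: contrapT => h; apply: nN; apply: sN0 => /(_ t00).
  have [df lE] := (@ex_derive _ _ _ _ _ _ _ lf, @derive_val _ _ _ _ _ _ _ lf).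
  have /cvgrPdist_lt /(_ e1 e10) : h^-1 *: ((f \o shift t) (h *: 1) - f t) @[h --> 0^'] --> l.
    by rewrite -lE; exact: df.
  move=> /nbhs_ballP [r /= r0 rP].
  exists r => // s sT st.
  have key : s != t -> (f s - f t) / (s - t) < e1.
    move=> nst; have := rP (s - t); rewrite /ball /= sub0r normrN st subr_eq0 nst.
    move=> /(_ erefl erefl); rewrite /= /GRing.scale /= mulr1 subrK ltr_norml => /andP[+ _].
    rewrite mulrC; lra.
  have [->|nst] := eqVneq s t; first by split.
  have {}key := key nst.
  rewrite /g; split => h.
    have ts : 0 < s - t by rewrite subr_gt0 lt_neqAle eq_sym nst.
    move: key; rewrite ltr_pdivrMr // => key.
    by have := phi_mon _ _ tT sT h; lra.
  have ts : 0 < t - s by rewrite subr_gt0 lt_neqAle nst.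
  move: key; rewrite -[s - t]opprB -[f s - f t]opprB invrN mulrNN ltr_pdivrMr // => key.
  by have := phi_mon _ _ sT tT h; lra.
rewrite /g => gT.
have p0 : 0 <= phi 0.
  by apply: (sup_upper_bound (hs 0 _)); [rewrite lexx|exact: var_on0].
have pT : phi T <= e / 2 by apply: ge_sup; [apply: (hs T _).1|apply: phi_ub]; rewrite T0 lexx.
have eT : e1 * T <= e / 2.
  have -> : e / 2 = e1 * (1 + T) by rewrite /e1 divfK // gt_eqF.
  by rewrite ler_pM2l //; lra.
by lra.
Qed.
End ac_monotone.

Section ac_calculus.
Variable R : realType.
Implicit Types f g : R -> R.

(** The variation over a step shorter than [d] is less than [1], and finitely
    many steps cover [[0, T]]. *)
Lemma ac_bounded f (T : R) : abs_continuous f -> 0 <= T ->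
  exists2 K, 0 < K & forall t, 0 <= t <= T -> `|f t| <= K.
Proof.
move=> acf T0; have [d d0 dP] := acf T T0 1 ltr01.
have [q [q0 qd]] : exists q, 0 < q /\ q < d by exists (d / 2); split; lra.
have step (n : nat) t : 0 <= t <= T -> t <= n%:R * q -> `|f t| <= `|f 0| + n%:R.
  elim: n t => [|n IH] t /andP[t0 tT] tn.
    move: tn; rewrite mul0r => tn; have -> : t = 0 by lra.
    by rewrite addr0.
  have n0 : 0 <= n%:R * q by rewrite mulr_ge0 // ltW.
  move: tn; rewrite -natr1 mulrDl mul1r.
  have IHp := IH (n%:R * q).
  move: (n%:R * q) n0 IHp IH => p p0 IHp IH tn.
  have [tp|tp] := leP t p.
    by have := IH t (introT andP (conj t0 tT)) tp; lra.
  have pT : p <= T by lra.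
  have := IHp (introT andP (conj p0 pT)) (lexx _).
  have := dP 1%N (fun _ => p) (fun _ => t).
  rewrite !big_ord1 => h.
  have {h} : `|f t - f p| < 1.
    apply: h; last by lra.
    by split => [i|i j]; [do !split => //; lra|rewrite !ord1].
  by have := ler_normD (f t - f p) (f p); rewrite subrK; lra.
have Tq : 0 <= T / q by rewrite divr_ge0 // ltW.
exists (`|f 0| + (Num.bound (T / q))%:R + 1).
  by rewrite ltr_wpDl // addr_ge0.
move=> t tT; have := step (Num.bound (T / q)) t tT.
case/andP: tT => t0 tT /(_ _)/le_trans -> //; last by lra.
by rewrite (le_trans tT) // -ler_pdivrMr // ltW // archi_boundP.
Qed.

Lemma ac_add f g : abs_continuous f -> abs_continuous g ->
  abs_continuous (fun t => f t + g t).
Proof.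
move=> acf acg T T0 e e0.
have e20 : 0 < e / 2 by lra.
have [d d0 dP] := acf T T0 _ e20; have [d' d'0 d'P] := acg T T0 _ e20.
exists (Num.min d d'); first by rewrite lt_min d0.
move=> N a b ab; rewrite lt_min => /andP[sd sd'].
have := dP _ _ _ ab sd; have := d'P _ _ _ ab sd'.
suff : \sum_i `|f (b i) + g (b i) - (f (a i) + g (a i))| <=
   \sum_i `|f (b i) - f (a i)| + \sum_i `|g (b i) - g (a i)| by lra.
rewrite -big_split /=; apply: ler_sum => i _.
by rewrite opprD addrACA ler_normD.
Qed.

(** The increment of a product is controlled by those of the factors, weighted
    by their bounds on [[0, T]]. *)
Lemma ac_mul f g : abs_continuous f -> abs_continuous g ->
  abs_continuous (fun t => f t * g t).
Proof.
move=> acf acg T T0 e e0.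
have [K K0 KP] := ac_bounded acf T0; have [L L0 LP] := ac_bounded acg T0.
have e1 : 0 < e / 2 / K by rewrite divr_gt0 //; lra.
have e2 : 0 < e / 2 / L by rewrite divr_gt0 //; lra.
have [d d0 dP] := acf T T0 _ e2; have [d' d'0 d'P] := acg T T0 _ e1.
exists (Num.min d d'); first by rewrite lt_min d0.
move=> N a b ab; rewrite lt_min => /andP[sd sd'].
have := dP _ _ _ ab sd; rewrite ltr_pdivlMr // => h1.
have := d'P _ _ _ ab sd'; rewrite ltr_pdivlMr // => h2.
suff : \sum_i `|f (b i) * g (b i) - f (a i) * g (a i)| <=
   (\sum_i `|f (b i) - f (a i)|) * L + (\sum_i `|g (b i) - g (a i)|) * K by lra.
rewrite !mulr_suml -big_split /=; apply: ler_sum => i _.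
have [a0 [abi bT]] := ab.1 i.
have -> : f (b i) * g (b i) - f (a i) * g (a i) =
  (f (b i) - f (a i)) * g (b i) + (g (b i) - g (a i)) * f (a i) by ring.
apply: (le_trans (ler_normD _ _)); rewrite !normrM; apply: lerD.
  by rewrite ler_wpM2l // LP //; apply/andP; split => //; lra.
by rewrite ler_wpM2l // KP //; apply/andP; split => //; lra.
Qed.

Lemma ac_cst (c : R) : abs_continuous (fun=> c).
Proof.
move=> T T0 e e0; exists 1 => // N a b _ _.
by rewrite big1 // => i _; rewrite subrr normr0.
Qed.

Lemma ac_sum (I : finType) (F : I -> R -> R) :
  (forall i, abs_continuous (F i)) -> abs_continuous (fun t => \sum_i F i t).
Proof.
move=> acF; elim: (index_enum I) => [|i s IH].
  by under eq_fun do rewrite big_nil; exact: ac_cst.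
by under eq_fun do rewrite big_cons; exact: (ac_add (acF i) IH).
Qed.

Lemma ac_C1 f g : (forall t : R, is_derive t 1 f (g t)) -> continuous g ->
  abs_continuous f.
Proof.
move=> fg cg T T0 e e0.
have [K K0 KP] : exists2 K, 0 < K & forall t, t \in `[0, T] -> `|g t| <= K.
  have cng : {within `[0, T], continuous (fun t => `|g t|)}.
    apply: continuous_subspaceT => t; apply: continuous_comp; first exact: cg.
    exact: norm_continuous.
  have [c cT cP] := EVT_max T0 cng.
  exists (`|g c| + 1); first by rewrite ltr_wpDl.
  by move=> t tT; rewrite (le_trans (cP t tT)) // lerDl.
exists (e / K); first by rewrite divr_gt0.
move=> N a b [ab _]; rewrite ltr_pdivlMr // => h.
apply: le_lt_trans h; rewrite mulr_suml; apply: ler_sum => i _.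
have [a0 [abi bT]] := ab i.
have [|c cab ->] := MVT_segment abi (fun x _ => fg x).
  by apply: derivable_within_continuous => t _; apply: (@ex_derive _ _ _ _ _ _ _ (fg t)).
rewrite normrM mulrC (ger0_norm (x := b i - a i)) ?subr_ge0 // ler_wpM2l ?subr_ge0 //.
apply: KP; move: cab; rewrite !in_itv /= => /andP[? ?]; apply/andP; split; lra.
Qed.

Lemma ac_integral f : (forall T : R, lebesgue_measure.-integrable `[0, T] (EFin \o f)) ->
  abs_continuous (fun t => \int[lebesgue_measure]_(s in `[0, t]) f s)%R.
Proof.
move=> intf T T0 e e0.
pose fT := f \_ `[0, T].
have intfT : lebesgue_measure.-integrable setT (EFin \o fT).
  by rewrite -restrict_EFin; apply/integrable_restrict => //=; rewrite setTI.
have [d [d0 dP]] := integral_normr_continuous intfT e0.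
exists d => // N a b sub sd; have [ab disj] := sub.
pose A := \big[setU/set0]_(i < N) (`]a i, b i[%classic : set R).
have mI (i : 'I_N) : measurable (`]a i, b i[%classic : set R) by [].
have mA : measurable A by exact: bigsetU_measurable.
have Ad : (lebesgue_measure A < d%:E)%E by rewrite (itv_family_measure sub) lte_fin.
apply: le_lt_trans (dP A mA Ad).
have AT : A `<=` `[0, T].
  apply: (big_ind (fun B : set R => B `<=` `[0, T])) => // [B C hB hC|i _].
    by rewrite subUset.
  move=> x /=; rewrite !in_itv /= => /andP[? ?].
  by have [? [? ?]] := ab i; apply/andP; split; lra.
have intA : lebesgue_measure.-integrable A (EFin \o f) by exact: integrableS (intf T).
have IA : \int[lebesgue_measure]_(x in A) `|fT x| = \int[lebesgue_measure]_(x in A) `|f x|.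
  apply: eq_Rintegral => x; rewrite inE => xA.
  by rewrite /fT patchE mem_set //; exact: AT.
rewrite IA -lee_fin /Rintegral fineK; last first.
  by apply: integrable_fin_num => //; exact: integrable_abse intA.
rewrite ge0_integral_bigsetU; [|exact: mI|exact: index_enum_uniq
  |exact: sub_trivIset (itv_family_trivIset sub)
  |exact: (measurable_int lebesgue_measure (integrable_abse intA))
  |by move=> x _; rewrite lee_fin].
rewrite -sumEFin; apply: lee_sum => i _.
have [a0 [abi bT]] := ab i.
have intabi : lebesgue_measure.-integrable `]a i, b i[%classic (EFin \o f).
  apply: integrableS (intf T) => // x /=; rewrite !in_itv /= => /andP[? ?].
  by apply/andP; split; lra.
rewrite -/(Rintegral _ _ _) Rintegral_itvB ?bnd_simp //.
rewrite -Rintegral_itv_bndo_bndc //.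
apply: (@le_trans _ _ `|\int[lebesgue_measure]_(x in `]a i, b i[) (f x)%:E|%E); last first.
  apply: le_abse_integral => //.
  exact: (measurable_int lebesgue_measure intabi).
rewrite /Rintegral -abse_EFin fineK //; exact: integrable_fin_num.
Qed.
End ac_calculus.

Lemma mx_cvg (R : realType) (T : Type) (F : set_system T) (FF : Filter F)
  (m n : nat) (f : T -> 'M[R]_(m, n)) (M : 'M[R]_(m, n)) :
  (forall i j, f x i j @[x --> F] --> M i j) -> f x @[x --> F] --> M.
Proof.
move=> fM; apply/cvgrPdist_le => e e0.
have : \forall x \near F, forall ij : 'I_m * 'I_n,
    `|M ij.1 ij.2 - f x ij.1 ij.2| <= e.
  by apply: filter_forall => -[i j] /=; have /cvgrPdist_le := fM i j; apply.
apply: filterS => x H.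
rewrite /Num.norm /= mx_normrE; apply: bigmax_le => [|ij _]; first exact: ltW.
by rewrite !mxE; exact: H.
Qed.

(** * The matrix exponential *)

Section expmx.
Variables (R : realType) (n : nat) (A : 'M[R]_n).

(** Coefficients of the power series of an entry of [B *m expmx (t *: A)]; the
    factor [B] makes the family closed under differentiation, which replaces
    [B] by [B *m A]. *)
Definition expc (B : 'M[R]_n) i j (m : nat) : R := (B *m A ^+ m) i j * (m`!%:R)^-1.

Let K := \sum_i \sum_j `|A i j|.

Lemma pow_bound m i j : `|(A ^+ m) i j| <= K ^+ m.
Proof.
have K0 : 0 <= K by rewrite sumr_ge0 // => ? _; rewrite sumr_ge0.
elim: m i j => [|m IH] i j.
  by rewrite !expr0 mxE; case: eqP => _; rewrite ?normr1 ?normr0 ?ler01.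
rewrite exprS mxE exprS; apply: (le_trans (ler_norm_sum _ _ _)).
apply: (@le_trans _ _ (\sum_k `|A i k| * K ^+ m)).
  by apply: ler_sum => k _; rewrite normrM ler_wpM2l.
rewrite -mulr_suml ler_wpM2r ?exprn_ge0 // /K [leRHS](bigD1 i) //= lerDl.
by rewrite sumr_ge0 // => ? _; rewrite sumr_ge0.
Qed.

Lemma expc_cvg B i j t : cvgn (pseries (expc B i j) t).
Proof.
apply: normed_cvg; pose b := \sum_k `|B i k|.
have b0 : 0 <= b by rewrite sumr_ge0.
have K0 : 0 <= K by rewrite sumr_ge0 // => ? _; rewrite sumr_ge0.
apply: (@series_le_cvg _ _ (b *: exp_coeff (K * `|t|))) => [m|m|m|].
- exact: normr_ge0.
- by rewrite mulr_ge0 // exp_coeff_ge0 // mulr_ge0.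
- rewrite /= /expc !normrM normfV normrX (ger0_norm (ler0n _ _)).
  rewrite /exp_coeff /= /GRing.scale /= exprMn.
  rewrite [leLHS]mulrAC [leRHS]mulrA ler_wpM2r ?invr_ge0 ?ler0n // mulrA.
  rewrite ler_wpM2r ?exprn_ge0 // mxE.
  apply: (le_trans (ler_norm_sum _ _ _)); rewrite /b mulr_suml.
  by apply: ler_sum => k _; rewrite normrM ler_wpM2l // pow_bound.
- exact/is_cvg_seriesZ/is_cvg_series_exp_coeff.
Qed.

Lemma expc_diffs B i j : pseries_diffs (expc B i j) = expc (B *m A) i j.
Proof.
apply/funext => m; rewrite /pseries_diffs /expc exprS mulmxA.
by rewrite factS natrM invfM mulrCA mulVKf // pnatr_eq0.
Qed.

Definition expt B (t : R) : 'M[R]_n := \matrix_(i, j) limn (pseries (expc B i j) t).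

Lemma exprZmx (t : R) m : (t *: A) ^+ m = t ^+ m *: A ^+ m.
Proof.
elim: m => [|m IH]; first by rewrite !expr0 scale1r.
by rewrite !exprS IH -[LHS]/(_ *m _) -scalemxAl -scalemxAr scalerA.
Qed.

Lemma expmxE t : expmx (t *: A) = expt 1%:M t.
Proof.
apply/cvg_lim; first exact: norm_hausdorff.
apply: mx_cvg => i j; rewrite mxE.
have := @expc_cvg 1%:M i j t; rewrite /pseries => h.
rewrite (_ : (fun x => _) = [series expc 1%:M i j m * t ^+ m]_m) //.
apply/funext => m; rewrite /series /= summxE; apply: eq_bigr => l _.
by rewrite /expc mul1mx exprZmx !mxE; ring.
Qed.

Lemma expt_comb (I : finType) (c : I -> R) (p q : I -> 'I_n) t :
  limn [series (\sum_k c k * expc 1%:M (p k) (q k) m) * t ^+ m]_m =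
  \sum_k c k * expt 1%:M t (p k) (q k).
Proof.
transitivity (limn (series (\sum_k (fun m => c k * (expc 1%:M (p k) (q k) m * t ^+ m))))).
  congr (limn (series _)); apply/funext => m.
  rewrite fct_sumE /= mulr_suml; apply: eq_bigr => k _.
  by rewrite mulrA.
have h : forall s : seq I, series (\sum_(k <- s) (fun m => c k * (expc 1%:M (p k) (q k) m * t ^+ m)))
   @ \oo --> \sum_(k <- s) c k * (expt 1%:M t) (p k) (q k).
  elim => [|k s IH].
    rewrite !big_nil (_ : series 0 = cst 0); first exact: cvg_cst.
    by apply/funext => m; rewrite /series /= big1.
  rewrite !big_cons seriesD; apply: cvgD; last exact: IH.
  have -> : (fun m => c k * (expc 1%:M (p k) (q k) m * t ^+ m)) =
     c k *: (fun m => (expc 1%:M (p k) (q k) m * t ^+ m)) by [].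
  rewrite seriesZ; apply: cvgZr; rewrite mxE.
  exact: (@expc_cvg 1%:M (p k) (q k) t).
by apply/cvg_lim => //; exact: h.
Qed.

Lemma exptM B t : expt B t = B *m expt 1%:M t.
Proof.
apply/matrixP => i j; rewrite !mxE -(expt_comb (B i) id (fun=> j)).
congr (limn (series _)); apply/funext => m /=; congr (_ * _).
rewrite /expc mxE mulr_suml; apply: eq_bigr => k _.
by rewrite mul1mx mulrA.
Qed.

Lemma expt_comm t : expt 1%:M t *m A = A *m expt 1%:M t.
Proof.
rewrite -exptM; apply/matrixP => i j; rewrite !mxE.
under eq_bigr do rewrite mulrC.
rewrite -(expt_comb (A^~ j) (fun=> i) id).
congr (limn (series _)); apply/funext => m /=; congr (_ * _).
rewrite /expc (_ : A *m A ^+ m = A ^+ m *m A); last first.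
  by rewrite -[LHS]/(A * _) -exprS exprSr.
rewrite mxE mulr_suml; apply: eq_bigr => k _.
by rewrite mul1mx mulrAC mulrC.
Qed.

Lemma expt_derive B i j (t : R) : is_derive t 1 (fun t => expt B t i j) (expt (B *m A) t i j).
Proof.
rewrite (_ : (fun t => _) = (fun t => limn (pseries (expc B i j) t))); last first.
  by apply/funext => ?; rewrite mxE.
rewrite mxE -expc_diffs; apply: (@pseries_snd_diffs _ _ (`|t| + 1)).
- exact: expc_cvg.
- by rewrite expc_diffs; exact: expc_cvg.
- by rewrite !expc_diffs; exact: expc_cvg.
- by rewrite [X in _ < X]ger0_norm ?addr_ge0 // ltrDl.
Qed.

Lemma expt0 : expt 1%:M 0 = 1%:M.
Proof.
apply/matrixP => i j; rewrite mxE.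
apply/cvg_lim => //; rewrite /pseries.
rewrite -(cvg_shiftS _) /=.
rewrite (_ : (fun n0 => _) = cst (1%:M i j)); first exact: cvg_cst.
apply/funext => m; rewrite /series /= big_nat_recl //= big1 => [|l _].
  by rewrite /expc !expr0 mulmx1 fact0 invr1 !mulr1 addr0.
by rewrite expr0n /= mulr0.
Qed.

Lemma is_derive_prod (f g : R -> R) (t a b : R) :
  is_derive t 1 f a -> is_derive t 1 g b ->
  is_derive t 1 (fun s => f s * g s) (a * g t + f t * b).
Proof.
move=> df dg; apply: (is_derive_eq (is_deriveM df dg)).
by rewrite /GRing.scale /= addrC; congr (_ + _); rewrite mulrC.
Qed.

(** This series shows that an impulse response depends on a realization only
    through its Markov parameters [C A^m B]. *)
Lemma expmx_markov (l k : nat) (C : 'M[R]_(l, n)) (B : 'M[R]_(n, k)) t i j :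
  (C *m expmx (t *: A) *m B) i j =
  limn [series (C *m A ^+ m *m B) i j * (m`!%:R)^-1 * t ^+ m]_m.
Proof.
rewrite expmxE.
transitivity (\sum_(ab : 'I_n * 'I_n) (C i ab.1 * B ab.2 j) * expt 1%:M t ab.1 ab.2).
  rewrite -(pair_bigA _ (fun a b => C i a * B b j * expt 1%:M t a b)) /= exchange_big /=.
  rewrite mxE; apply: eq_bigr => b _; rewrite mxE mulr_suml; apply: eq_bigr => a _.
  by rewrite mulrAC.
rewrite -expt_comb; congr (limn (series _)); apply/funext => m /=; congr (_ * _).
rewrite -(pair_bigA _ (fun a b => C i a * B b j * expc 1%:M a b m)) /= exchange_big /=.
rewrite mxE mulr_suml; apply: eq_bigr => b _; rewrite mxE !mulr_suml; apply: eq_bigr => a _.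
by rewrite /expc mul1mx; ring.
Qed.

Definition mx_derive (m p : nat) (F : R -> 'M[R]_(m, p)) (F' : R -> 'M[R]_(m, p)) :=
  forall t i k, is_derive t (1 : R) (fun t => F t i k) (F' t i k).

Lemma mx_derive_mul (m p q : nat) (F : R -> 'M[R]_(m, p)) (G : R -> 'M[R]_(p, q)) F' G' :
  mx_derive F F' -> mx_derive G G' ->
  mx_derive (fun t => F t *m G t) (fun t => F' t *m G t + F t *m G' t).
Proof.
move=> dF dG t i j.
rewrite (_ : (fun t => _) = \sum_k (fun t => F t i k * G t k j)); last first.
  by apply/funext => s; rewrite fct_sumE mxE.
rewrite mxE [X in X + _]mxE [X in _ + X]mxE -big_split /=.
by apply: is_derive_sum => k; apply: is_derive_prod.
Qed.

Lemma mx_derive_cst (m p : nat) (F : R -> 'M[R]_(m, p)) :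
  mx_derive F (fun=> 0) -> forall s t, F s = F t.
Proof.
move=> dF s t; apply/matrixP => i j; apply: (@is_derive_0_is_cst R (fun t => F t i j)) => x.
by have := dF x i j; rewrite mxE.
Qed.

Lemma mx_derive_exp (e : R -> R) (c : R) : (forall t : R, is_derive t 1 e c) ->
  mx_derive (fun t => expt 1%:M (e t)) (fun t => c *: (A *m expt 1%:M (e t))).
Proof.
move=> de t i j; have := expt_derive 1%:M i j (e t).
rewrite mul1mx exptM => h.
apply: is_derive_eq; first exact: (is_derive1_comp h (de t)).
by rewrite [RHS]mxE mulrC.
Qed.

(** The function [exp (- x A) exp ((x - u) A)] of [x] has derivative zero,
    hence equals its value at [x = 0]; [u = 0] first identifies [exp (- x A)]
    as an inverse. *)
Lemma expmxB s t : expmx ((t - s) *: A) = expmx (t *: A) *m expmx ((- s) *: A).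
Proof.
rewrite !expmxE.
have dm : mx_derive (fun t => expt 1%:M (- t)) (fun t => -1 *: (A *m expt 1%:M (- t))).
  by apply: mx_derive_exp => x; apply: is_deriveNid.
have key u x : expt 1%:M (- x) *m expt 1%:M (x - u) = expt 1%:M (- u).
  have de : mx_derive (fun t => expt 1%:M (t - u)) (fun t => 1 *: (A *m expt 1%:M (t - u))).
    apply: mx_derive_exp => y; apply: (is_derive_eq (is_deriveB (is_derive_id _ _) (is_derive_cst _ _ _))).
    by rewrite subr0.
  rewrite (_ : expt 1%:M (- u) = expt 1%:M (- 0) *m expt 1%:M (0 - u)); last first.
    by rewrite oppr0 expt0 mul1mx add0r.
  apply: (mx_derive_cst (F := fun x => expt 1%:M (- x) *m expt 1%:M (x - u))).
  move=> y i j; have := mx_derive_mul dm de y i j.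
  by rewrite scale1r scaleN1r mulNmx -expt_comm mulmxA addNr.
have inv x : expt 1%:M x *m expt 1%:M (- x) = 1%:M.
  by apply: mulmx1C; have := key 0 x; rewrite subr0 oppr0 expt0.
by rewrite -(key s t) mulmxA inv mul1mx.
Qed.

Lemma expmx_derive : mx_derive (fun t => expmx (t *: A)) (fun t => A *m expmx (t *: A)).
Proof.
move=> t i j; have := @mx_derive_exp id 1 (fun t => is_derive_id _ _) t i j.
rewrite scale1r -expmxE; congr (is_derive _ _ _ _).
by apply/funext => s; rewrite expmxE.
Qed.

Lemma expmxV s : expmx (s *: A) *m expmx ((- s) *: A) = 1%:M.
Proof. by rewrite -expmxB subrr expmxE expt0. Qed.

End expmx.

(** * Response to a locally square integrable input *)

Section loc_int.
Variable R : realType.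
Implicit Types f g : R -> R.

Definition loc_int f := forall T : R, lebesgue_measure.-integrable `[0, T] (EFin \o f).

Lemma loc_intZ f c : loc_int f -> loc_int (fun t => c * f t).
Proof. by move=> lf T; exact: (integrableZl _ c (lf T)). Qed.

Lemma loc_int_sum (I : finType) (f : I -> R -> R) :
  (forall k, loc_int (f k)) -> loc_int (fun t => \sum_k f k t).
Proof.
move=> lf T; rewrite (_ : _ \o _ = fun t => (\sum_(k in I) (f k t)%:E)%E); last first.
  by apply/funext => t /=; rewrite -sumEFin.
by apply: integrable_sum => // k _; exact: lf.
Qed.

Lemma loc_int_mul f g : continuous g -> loc_int f -> loc_int (fun t => g t * f t).
Proof.
move=> cg lf T; have [T0|T0] := ltP T 0.
  by rewrite set_itv_ge ?bnd_simp -?ltNge //; exact: integrable_set0.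
apply: (integrableMr _ _ _ (lf T)) => //.
  by apply: measurable_funTS; exact: continuous_measurable_fun.
have cng : {within `[0, T], continuous (fun t => `|g t|)}.
  apply: continuous_subspaceT => t; apply: continuous_comp; first exact: cg.
  exact: norm_continuous.
have [c cT cP] := EVT_max T0 cng.
exists `|g c|; split; first exact: num_real.
by move=> x cx t /cP tT; exact: le_trans tT (ltW cx).
Qed.

Lemma Rintegral_comb (I : finType) (c : I -> R) (f : I -> R -> R) (t : R) :
  (forall k, loc_int (f k)) ->
  \int[lebesgue_measure]_(s in `[0, t]) (\sum_k c k * f k s) =
  \sum_k c k * \int[lebesgue_measure]_(s in `[0, t]) f k s.
Proof.
move=> lf; elim: (index_enum I) => [|k s IH].
  under eq_Rintegral do rewrite big_nil.
  by rewrite big_nil Rintegral_cst // mul0r.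
under eq_Rintegral do rewrite big_cons.
rewrite big_cons RintegralD //=; last 2 first.
- exact: loc_intZ.
- rewrite (_ : _ \o _ = fun t => (\sum_(k <- s) (c k * f k t)%:E)%E); last first.
    by apply/funext => x /=; rewrite -sumEFin.
  by apply: integrable_sum => // j _; exact: loc_intZ.
congr (_ + _); last exact: IH.
by rewrite RintegralZl //; exact: lf.
Qed.

Lemma L2e_loc_int n (z : R -> 'cV[R]_n) j : L2e z -> loc_int (fun t => z t j 0).
Proof.
move=> [mz z2] T; have [T0|T0] := ltP T 0.
  by rewrite set_itv_ge ?bnd_simp -?ltNge //; exact: integrable_set0.
have mT : measurable_fun (`[0, T] : set R) (fun t => z t j 0).
  apply: measurable_funS (mz j) => //.
  by move=> x /=; rewrite !in_itv /= => /andP[->].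
apply: (@le_integrable _ _ _ lebesgue_measure `[0, T] _ _
  (fun t => (1 + norm2 (z t) ^+ 2)%:E)) => //.
- exact/measurable_EFinP.
- move=> t _ /=; rewrite lee_fin.
  have n0 : 0 <= \sum_i z t i 0 ^+ 2 by apply: sumr_ge0 => ? _; exact: sqr_ge0.
  rewrite (ger0_norm (x := 1 + _)) ?addr_ge0 ?sqr_ge0 // /norm2 sqr_sqrtr //.
  have : `|z t j 0| ^+ 2 <= \sum_i z t i 0 ^+ 2.
    rewrite real_normK ?num_real // (bigD1 j) //= lerDl.
    by apply: sumr_ge0 => ? _; exact: sqr_ge0.
  by have := normr_ge0 (z t j 0); nra.
- rewrite (_ : (fun t => _) = (cst 1%E \+ (fun t => (norm2 (z t) ^+ 2)%:E))%E) //.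
  apply: integrableD => //; last exact: z2.
  apply/integrableP; split; first by apply: measurable_cst.
  rewrite integral_cst //= normr1 mul1e lebesgue_measure_itv /=.
  by case: ifP => _; rewrite ?ltry // -EFinB ltry.
Qed.

(** [f] is extended by [0] to negative times, where nothing is assumed about
    it, so that it becomes locally integrable on the line. *)
Lemma ftc_loc_int f : loc_int f ->
  {ae lebesgue_measure, forall t : R, 0 < t ->
    is_derive t 1 (fun t => \int[lebesgue_measure]_(s in `[0, t]) f s) (f t)}.
Proof.
move=> lf; pose f0 := f \_ `[0, +oo[.
have I0 (t : R) : \int[lebesgue_measure]_(s in `[0, t]) f s = \int[lebesgue_measure]_(s in `[0, t]) f0 s.
  apply: eq_Rintegral => s; rewrite inE /= in_itv /= => /andP[s0 _].
  by rewrite /f0 patchE mem_set //= in_itv /= s0.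
have mf0 : measurable_fun [set: R] f0.
  apply/(measurable_restrictT _ _).1 => //.
  have -> : `[0, +oo[%classic = \bigcup_(n : nat) `[0, n%:R : R]%classic.
    apply/seteqP; split => x /=; rewrite in_itv /= andbT.
      move=> x0; exists (Num.bound x) => //=; rewrite in_itv /= x0 /=.
      exact/ltW/archi_boundP.
    by case=> n _ /=; rewrite in_itv /= => /andP[].
  apply/measurable_fun_bigcup => // n.
  by have h := measurable_int _ (lf n%:R); apply/measurable_EFinP; apply: h.
have lf0 (T : R) : lebesgue_measure.-integrable `[0, T] (EFin \o f0).
  apply: eq_integrable (lf T) => // s; rewrite inE /= in_itv /= => /andP[s0 _].
  by rewrite /f0 patchE mem_set //= in_itv /= s0.
have loc : locally_integrable [set: R] f0.
  split => //; first exact: openT.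
  move=> K _ cK; have mK := compact_measurable cK.
  have [M [Mr MP]] := compact_bounded cK.
  have KM x : K x -> x <= M + 1.
    by move=> /(MP (M + 1) ltac:(by rewrite ltrDl)) /=; apply: le_trans; exact: ler_norm.
  have : lebesgue_measure.-integrable setT (EFin \o f0 \_ `[0, M + 1]).
    by rewrite -restrict_EFin; apply/integrable_restrict => //=; rewrite setTI; exact: lf0.
  move=> h'; have {h'}h : lebesgue_measure.-integrable K (EFin \o f0 \_ `[0, M + 1]).
    by apply: integrableS h'.
  have /integrableP[_ ] : lebesgue_measure.-integrable K (EFin \o f0).
    apply: eq_integrable h => // x; rewrite inE => Kx.
    rewrite /= patchE; case: ifPn => //; rewrite notin_setE /= in_itv /= => xn.
    rewrite /f0 patchE memNset //= in_itv /= andbT => x0; apply: xn.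
    by rewrite x0 KM.
  by [].
have := FTC1 (a := BLeft 0) lf0 loc.
apply: filterS; first exact: (ae_filter_ringOfSetsType lebesgue_measure).
move=> t h t0; have [|df dE] := h.
  by rewrite /= lte_fin.
under eq_fun do rewrite I0.
by apply: DeriveDef => //; rewrite -derive1E dE /f0 patchE mem_set //= in_itv /= ltW.
Qed.
End loc_int.

Section response.
Variables (R : realType) (m k : nat).
Variables (A : 'M[R]_m) (B : 'M[R]_(m, k)) (z : R -> 'cV[R]_k).
Hypothesis z2 : L2e z.

Definition response (t : R) : 'cV[R]_m :=
  \col_i \int[lebesgue_measure]_(s in `[0, t]) ((expmx ((t - s) *: A) *m B *m z s) i 0).

Let g i s := (expmx ((- s) *: A) *m B *m z s) i 0.
Let eta t : 'cV[R]_m := \col_i \int[lebesgue_measure]_(s in `[0, t]) g i s.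

Lemma expmx_entry_continuous i j : continuous (fun s : R => expmx (s *: A) i j).
Proof.
move=> s; apply/differentiable_continuous/derivable1_diffP.
exact: (@ex_derive _ _ _ _ _ _ _ (@expmx_derive _ _ A s i j)).
Qed.

Let g_int i : loc_int (g i).
Proof.
rewrite (_ : g i = fun s => \sum_j (expmx ((- s) *: A) *m B) i j * z s j 0); last first.
  by apply/funext => s; rewrite /g mxE.
apply: loc_int_sum => j; apply: loc_int_mul; last exact: L2e_loc_int.
rewrite (_ : (fun s => _) = fun s => \sum_l B l j * expmx ((- s) *: A) i l); last first.
  by apply/funext => s; rewrite mxE; apply: eq_bigr => l _; rewrite mulrC.
apply: continuous_sum => l; apply: continuous_mul; first exact: cst_continuous.
move=> s.
have := @continuous_comp _ _ _ (-%R : R -> R) (fun s : R => expmx (s *: A) i l) s.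
by apply; [exact: opp_continuous|exact: expmx_entry_continuous].
Qed.

Let int_split l (c : R -> 'M[R]_(l, m)) t i :
  \int[lebesgue_measure]_(s in `[0, t]) ((c t *m expmx ((t - s) *: A) *m B *m z s) i 0) =
  (c t *m expmx (t *: A) *m eta t) i 0.
Proof.
transitivity (\int[lebesgue_measure]_(s in `[0, t])
    (\sum_j (c t *m expmx (t *: A)) i j * g j s)).
  by apply: eq_Rintegral => s _; rewrite expmxB -!mulmxA mulmxA mxE !mulmxA.
rewrite Rintegral_comb // mxE; apply: eq_bigr => j _.
by congr (_ * _); rewrite [RHS]mxE.
Qed.

(** Once [exp (t A)] is factored out of the convolution, [t] remains only as
    the upper bound of an integral, which can be differentiated almost
    everywhere. *)
Lemma response_eta t : response t = expmx (t *: A) *m eta t.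
Proof.
apply/matrixP => i j; rewrite ord1 mxE.
have := int_split (fun=> 1%:M) t i; rewrite mul1mx => <-.
by under [in RHS]eq_Rintegral do rewrite mul1mx.
Qed.

Lemma response_output l (C : 'M[R]_(l, m)) t i :
  \int[lebesgue_measure]_(s in `[0, t]) ((C *m expmx ((t - s) *: A) *m B *m z s) i 0) =
  (C *m response t) i 0.
Proof. by rewrite (int_split (fun=> C)) response_eta mulmxA. Qed.

Lemma response0 : response 0 = 0.
Proof.
by apply/matrixP => i j; rewrite !mxE set_itv1 Rintegral_set1.
Qed.

Lemma response_ac i : abs_continuous (fun t => response t i 0).
Proof.
rewrite (_ : (fun t => _) = fun t => \sum_j expmx (t *: A) i j * eta t j 0); last first.
  by apply/funext => t; rewrite response_eta mxE.
apply: ac_sum => j; apply: ac_mul.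
  apply: (ac_C1 (fun t => expmx_derive A t i j)).
  rewrite (_ : (fun s => _) = fun s => \sum_l A i l * expmx (s *: A) l j); last first.
    by apply/funext => s; rewrite mxE.
  apply: continuous_sum => l; apply: continuous_mul; first exact: cst_continuous.
  exact: expmx_entry_continuous.
rewrite (_ : (fun t => _) = fun t => \int[lebesgue_measure]_(s in `[0, t]) g j s); last first.
  by apply/funext => t; rewrite mxE.
by apply: ac_integral; exact: g_int.
Qed.

Lemma response_derive : {ae lebesgue_measure, forall t : R, 0 < t -> forall i,
  is_derive t 1 (fun t => response t i 0) ((A *m response t + B *m z t) i 0)}.
Proof.
have : {ae lebesgue_measure, forall t : R, forall i : 'I_m, 0 < t ->
    is_derive t 1 (fun t => eta t i 0) (g i t)}.
  have h i : {ae lebesgue_measure, forall t : R, 0 < t ->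
    is_derive t 1 (fun t => eta t i 0) (g i t)}.
    rewrite (_ : (fun t => eta t i 0) = fun t => \int[lebesgue_measure]_(s in `[0, t]) g i s); last first.
      by apply/funext => t; rewrite mxE.
    exact: ftc_loc_int.
  apply: filter_forall => //; exact: (ae_filter_ringOfSetsType lebesgue_measure).
apply: filterS; first exact: (ae_filter_ringOfSetsType lebesgue_measure).
move=> t h t0 i.
rewrite (_ : (fun t => _) = fun t => \sum_j (fun t => expmx (t *: A) i j * eta t j 0) t); last first.
  by apply/funext => s; rewrite response_eta mxE.
rewrite (_ : (fun t => _) = \sum_j (fun t => expmx (t *: A) i j * eta t j 0)); last first.
  by apply/funext => s; rewrite fct_sumE.
apply: (is_derive_eq (is_derive_sum (fun j => is_derive_prod (expmx_derive A t i j) (h j t0)))).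
rewrite big_split /= response_eta mulmxA mxE; congr (_ + _); first by rewrite [RHS]mxE.
have -> : B *m z t = expmx (t *: A) *m (\col_j g j t).
  rewrite (_ : (\col_j g j t) = expmx ((- t) *: A) *m (B *m z t)).
    by rewrite mulmxA expmxV mul1mx.
  by apply/matrixP => a b; rewrite ord1 !mulmxA mxE.
by rewrite mxE; apply: eq_bigr => j _; congr (_ * _); rewrite mxE.
Qed.
End response.

(** * Energy along trajectories *)

Section energy_derivative.
Variable R : realType.

Lemma qf_derive n (X : 'M[R]_n) (x : R -> 'cV[R]_n) (x' : 'cV[R]_n) (t : R) : X^T = X ->
  (forall i, is_derive t 1 (fun t => x t i 0) (x' i 0)) ->
  is_derive t 1 (fun t => qf X (x t)) (2 * ((x t)^T *m X *m x') 0 0).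
Proof.
move=> sX dx.
have -> : (fun t => qf X (x t)) = \sum_i \sum_j (fun t => X i j * (x t i 0 * x t j 0)).
  apply/funext => s; rewrite qfE fct_sumE; apply: eq_bigr => i _.
  by rewrite fct_sumE; apply: eq_bigr => j _; rewrite mulrA.
apply: (is_derive_eq (is_derive_sum (fun i => is_derive_sum (fun j =>
  is_derive_prod (is_derive_cst (X i j) t 1) (is_derive_prod (dx i) (dx j)))))).
have E1 : ((x t)^T *m X *m x') 0 0 = \sum_i \sum_j X i j * (x t i 0 * x' j 0).
  rewrite mxE exchange_big /=; apply: eq_bigr => j _.
  rewrite mxE mulr_suml; apply: eq_bigr => i _; rewrite !mxE; ring.
have E2 : ((x t)^T *m X *m x') 0 0 = \sum_i \sum_j X i j * (x' i 0 * x t j 0).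
  rewrite E1 exchange_big /=; apply: eq_bigr => j _; apply: eq_bigr => i _.
  by rewrite -[in LHS]sX mxE; ring.
have -> : 2 * ((x t)^T *m X *m x') 0 0 =
   ((x t)^T *m X *m x') 0 0 + ((x t)^T *m X *m x') 0 0 by ring.
rewrite {1}E2 E1 -big_split /=; apply: eq_bigr => i _.
rewrite -big_split /=; apply: eq_bigr => j _.
by rewrite mul0r add0r mulrDr.
Qed.

Lemma ac_qf n (X : 'M[R]_n) (x : R -> 'cV[R]_n) :
  (forall i, abs_continuous (fun t => x t i 0)) -> abs_continuous (fun t => qf X (x t)).
Proof.
move=> acx.
have -> : (fun t => qf X (x t)) = fun t => \sum_i \sum_j X i j * (x t i 0 * x t j 0).
  apply/funext => s; rewrite qfE; apply: eq_bigr => i _.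
  by apply: eq_bigr => j _; rewrite mulrA.
apply: ac_sum => i; apply: ac_sum => j; apply: ac_mul; first exact: ac_cst.
exact: ac_mul.
Qed.

Lemma loc_abs_continuous_entry n (x : R -> 'cV[R]_n) i :
  loc_abs_continuous x -> abs_continuous (fun t => x t i 0).
Proof.
move=> acx T T0 e e0; have [d d0 dP] := acx T T0 e e0.
exists d => // N a b [ab dis] sd; apply: le_lt_trans (dP N a b ab dis sd).
apply: ler_sum => j _; rewrite /norm2 -(ler_pXn2r (n := 2)) ?nnegrE ?sqrtr_ge0 //.
rewrite sqr_sqrtr; last by apply: sumr_ge0 => ? _; exact: sqr_ge0.
rewrite real_normK ?num_real // (bigD1 i) //= !mxE lerDl.
by apply: sumr_ge0 => ? _; exact: sqr_ge0.
Qed.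

Lemma is_derive_entry n (x : R -> 'cV[R]_n) (x' : 'cV[R]_n) (t : R) i :
  is_derive t 1 x x' -> is_derive t 1 (fun t => x t i 0) (x' i 0).
Proof.
move=> [dx xE]; have /derivable_mxP /(_ i 0) dxi := dx.
by apply: DeriveDef => //; rewrite -xE derive_mx // mxE.
Qed.
End energy_derivative.

Section stability.
Variable R : realType.
Local Notation C := R[i].

Lemma hf_real n (M : 'M[R]_n) (y : 'cV[R]_n) : M^T = M ->
  hf (cmx M) (cmx y) = (qf M y)%:C%C.
Proof.
move=> sM; rewrite hf_cmx // Remx_cmx (_ : Immx (cmx y) = 0).
  by rewrite [qf M 0](_ : _ = 0) ?addr0 // /qf mulmx0 mxE.
by apply/matrixP => i j; rewrite !mxE.
Qed.

Lemma qfN n (M : 'M[R]_n) x : qf (- M) x = - qf M x.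
Proof. by rewrite -scaleN1r qfZl mulN1r. Qed.

Lemma P_multN nu k (P0 : 'M[R]_(nu + nu)) (M : 'M[R]_(nu * k)) :
  P_mult (- P0) M = - P_mult P0 M.
Proof.
rewrite /P_mult -mulNmx -mulmxN; congr (_ *m _ *m _).
by apply/matrixP => i j; rewrite !mxE mulNr.
Qed.

(** [P_mult_psd] for [- P0] at the point at infinity [(0, 1)]. *)
Lemma P_mult_corner nu k (P0 : 'M[R]_(nu + nu)) (M : 'M[R]_(nu * k)) :
  P0^T = P0 -> M^T = M -> (forall x, 0 <= qf M x) ->
  (forall y : 'cV[R]_nu, qf P0 (col_mx 0 y) <= 0) ->
  forall y : 'cV[R]_k, qf (P_mult P0 M) (col_mx 0 y) <= 0.
Proof.
move=> sP sM psdM P00 y.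
have sN : (- P0)^T = - P0 by rewrite linearN /= sP.
have h0 (a : 'cV[C]_nu) : 0 <= hf (cmx (- P0)) (col_mx (0 *: a) (1 *: a)).
  rewrite hf_cmx // scale0r scale1r ler0c /Remx /Immx !map_col_mx !map_mx0.
  by rewrite !qfN addr_ge0 // oppr_ge0.
have := P_mult_psd (cmx y) sM psdM h0.
rewrite scale0r scale1r P_multN (_ : col_mx 0 _ = cmx (col_mx 0 y)); last first.
  by rewrite /cmx map_col_mx map_mx0.
rewrite hf_real; last by rewrite linearN /= P_mult_sym.
by rewrite ler0c qfN oppr_ge0.
Qed.

(** A nonzero [z] with [z = D V z] gives [w = v z] at which the complexified
    negative form takes the value of [P_mult P0 M] at [(z, v z)], which is
    nonnegative by [P_mult_psd]. *)
Lemma well_posed_of_lmi nu k (P0 : 'M[R]_(nu + nu)) (M : 'M[R]_(nu * k)) (D : 'M[R]_k) :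
  P0^T = P0 -> M^T = M -> (forall x, 0 <= qf M x) ->
  (forall w : 'cV[R]_k, w != 0 -> qf (P_mult P0 M) (col_mx (D *m w) w) < 0) ->
  well_posed D (V_set k P0).
Proof.
move=> sP sM psdM neg W /V_setP[v -> vP].
rewrite -det_tr; apply/negP => /det0P[r r0].
rewrite linearB /= trmx1 mulmxBr mulmx1 trmx_mul tr_scalar_mx => /eqP.
rewrite subr_eq0 => /eqP rE.
pose z := r^T; pose w := v *: z.
have zE : z = cmx D *m w.
  by rewrite /z {1}rE !trmx_mul trmxK tr_scalar_mx -mulmxA mul_scalar_mx.
have w0 : w != 0.
  apply: contra r0 => /eqP w0; apply/eqP.
  by rewrite -[r]trmxK -/z zE w0 mulmx0 trmx0.
pose T : 'M[R]_(k + k, k) := col_mx D 1%:M.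
pose H := T^T *m (- P_mult P0 M) *m T.
have sH : H^T = H by rewrite tr_congr // linearN /= P_mult_sym.
have H0 x : x != 0 -> 0 < qf H x.
  move=> x0; rewrite qf_congr mul_col_mx mul1mx qfN oppr_gt0.
  exact: neg.
have := hf_cmx_gt0 sH H0 w0.
rewrite /H hf_congr /cmx map_mxN map_col_mx map_mx1 hfN mul_col_mx mul1mx.
rewrite -!/(cmx _) -zE oppr_gt0 /w -{1}[z]scale1r => /lt_le_trans.
by move=> /(_ _ (P_mult_psd z sM psdM vP)); rewrite ltxx.
Qed.

(** The matrix inequality, read along the state equation; compactness gives
    the margin [c]. *)
Lemma lmi_dissipation n k (A : 'M[R]_n) (B : 'M[R]_(n, k)) (C : 'M[R]_(k, n))
    (D : 'M[R]_k) (X : 'M[R]_n) (Pi : 'M[R]_(k + k)) : X^T = X ->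
  (let L1 := block_mx 1%:M 0 A B in let L2 := block_mx C D 0 1%:M in
   mx_negdef (L1^T *m block_mx 0 X X 0 *m L1 + L2^T *m Pi *m L2)) ->
  exists2 c, 0 < c & forall x w,
    2 * (x^T *m X *m (A *m x + B *m w)) 0 0 + qf Pi (col_mx (C *m x + D *m w) w) <=
    - (c * (normsq x + normsq w)).
Proof.
move=> sX /= [_]; set N := _ + _ => neg.
have NE x w : qf N (col_mx x w) =
    2 * (x^T *m X *m (A *m x + B *m w)) 0 0 + qf Pi (col_mx (C *m x + D *m w) w).
  rewrite qfDl !qf_congr !mul_block_col mul0mx !mul1mx mul0mx addr0 add0r.
  congr (_ + _); set y := _ + _.
  rewrite /qf tr_col_mx mul_row_block !mulmx0 add0r addr0 mul_row_col mxE.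
  rewrite (_ : y^T *m X *m x = (x^T *m X *m y)^T); last first.
    by rewrite !trmx_mul trmxK sX mulmxA.
  rewrite [_^T _ _]mxE; ring.
have [|c c0 cP] := @qf_lower_bound R _ (- N).
  by move=> x x0; rewrite qfN oppr_gt0; exact: neg.
exists c => // x w; rewrite -NE lerNr -normsq_col_mx.
by have := cP (col_mx x w); rewrite qfN.
Qed.

Lemma output_bound n k (C : 'M[R]_(k, n)) (D : 'M[R]_k) :
  exists2 c, 0 < c & forall x w,
    normsq (C *m x + D *m w) <= c * (normsq x + normsq w).
Proof.
pose K := row_mx C D.
have [c c0 cP] := qf_upper_bound (K^T *m 1%:M *m K).
exists c => // x w; rewrite -normsq_col_mx; apply: le_trans (cP _).
by rewrite qf_congr qf1 mul_row_col ler_norm.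
Qed.

Lemma io_map_response m k (Delta : lti R k k) (A : 'M[R]_m) (B : 'M[R]_(m, k))
    (C0 : 'M[R]_(k, m)) (z : R -> 'cV[R]_k) (t : R) : L2e z ->
  (forall j, lti_C Delta *m lti_A Delta ^+ j *m lti_B Delta = C0 *m A ^+ j *m B) ->
  io_map Delta z t = C0 *m response A B z t + lti_D Delta *m z t.
Proof.
move=> z2 markov; rewrite /io_map; congr (_ + _).
have ker s : lti_C Delta *m expmx (s *: lti_A Delta) *m lti_B Delta =
    C0 *m expmx (s *: A) *m B.
  by apply/matrixP => i j; rewrite !expmx_markov; under eq_fun do rewrite markov.
apply/matrixP => i j; rewrite ord1 mxE -(response_output A B z2 C0 t i).
by apply: eq_Rintegral => s _; rewrite ker.
Qed.

Lemma is_derive_expRM (eta t : R) :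
  is_derive t 1 (fun s => expR (eta * s)) (eta * expR (eta * t)).
Proof.
have h : is_derive t 1 (fun s : R => eta * s) eta.
  by apply: (is_derive_eq (is_derive_prod (is_derive_cst eta t 1) (is_derive_id t 1))); rewrite mul0r add0r mulr1.
have := @is_derive1_comp R expR (fun s => eta * s) t (expR (eta * t)) eta (is_derive_expR _) h.
by rewrite mulrC.
Qed.

Lemma ac_expRM (eta : R) : abs_continuous (fun t => expR (eta * t)).
Proof.
apply: (ac_C1 (is_derive_expRM eta)) => t.
apply/differentiable_continuous/derivable1_diffP.
exact: (@ex_derive _ _ _ _ _ _ _ (is_derive_prod (is_derive_cst eta t 1) (is_derive_expRM eta t))).
Qed.
End stability.

Section energy.
Variable R : realType.
Local Notation C := R[i].

Lemma norm2_sqr n (x : 'cV[R]_n) : norm2 x ^+ 2 = normsq x.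
Proof. by rewrite sqr_sqrtr // normsq_ge0. Qed.

Lemma exp_decay_cvg0 n (x : R -> 'cV[R]_n) (K eta : R) : 0 < eta ->
  (forall t, 0 <= t -> expR (eta * t) * normsq (x t) <= K) ->
  x t @[t --> +oo] --> (0 : 'cV[R]_n).
Proof.
move=> eta0 bd; apply: mx_cvg => i j; rewrite ord1 mxE.
apply/cvgrPdist_le => e e0; rewrite /=.
near=> t.
have t0 : 0 <= t by near: t; exact/nbhs_pinfty_ge/num_real.
have tK : K / (eta * e ^+ 2) <= t by near: t; exact/nbhs_pinfty_ge/num_real.
rewrite sub0r normrN -(@ler_pXn2r _ 2) ?nnegrE //; last exact: ltW.
rewrite real_normK ?num_real //.
apply: (@le_trans _ _ (normsq (x t))).
  by rewrite /normsq (bigD1 i) //= lerDl; apply: sumr_ge0 => ? _; exact: sqr_ge0.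
have ee : 0 < eta * e ^+ 2 by rewrite mulr_gt0 ?exprn_gt0.
move: tK; rewrite ler_pdivrMr // => tK.
have h := le_trans (bd t t0) tK.
have et0 : 0 <= eta * t by rewrite mulr_ge0 // ltW.
have h1 := expR_ge1Dx (eta * t).
have ex : eta * t < expR (eta * t) by apply: lt_le_trans h1; rewrite ltrDr.
have ex0 := expR_gt0 (eta * t).
rewrite -(ler_pM2l ex0); apply: (le_trans h).
rewrite (_ : t * _ = eta * t * e ^+ 2); last by ring.
by rewrite ler_wpM2r ?exprn_ge0 // ltW.
Unshelve. all: by end_near.
Qed.

(** The margin [c] of the first dissipation inequality is spent half on the
    term in [normsq z], by the bound [kappa] on the output, and half, together
    with the margin [c'] of the second one, on [eta] times the energy. The
    supply rates cancel. *)
Lemma energy_decrease n k m (A : 'M[R]_n) (B : 'M[R]_(n, k)) (C : 'M[R]_(k, n))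
    (D : 'M[R]_k) (A' : 'M[R]_m) (B' : 'M[R]_(m, k)) (C' : 'M[R]_(k, m)) (D' : 'M[R]_k)
    (X : 'M[R]_n) (Y : 'M[R]_m) (Pi : 'M[R]_(k + k)) (c c' kappa : R) :
  0 < c -> 0 < c' -> 0 < kappa -> 
  (forall x w, 2 * (x^T *m X *m (A *m x + B *m w)) 0 0 +
     qf Pi (col_mx (C *m x + D *m w) w) <= - (c * (normsq x + normsq w))) ->
  (forall xi z, 2 * (xi^T *m Y *m (A' *m xi + B' *m z)) 0 0 <=
     qf Pi (col_mx z (C' *m xi + D' *m z)) + c / (2 * kappa) * normsq z - c' * normsq xi) ->
  (forall x w, normsq (C *m x + D *m w) <= kappa * (normsq x + normsq w)) ->
  exists2 eta, 0 < eta & forall x xi z w, z = C *m x + D *m w -> w = C' *m xi + D' *m z ->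
    eta * (qf X x + qf Y xi) + (2 * (x^T *m X *m (A *m x + B *m w)) 0 0 +
      2 * (xi^T *m Y *m (A' *m xi + B' *m z)) 0 0) <= 0.
Proof.
move=> c0 c'0 k0 dX dY dz.
have [a a0 aP] := qf_upper_bound X; have [b b0 bP] := qf_upper_bound Y.
pose eta := Num.min (c / (2 * a)) (c' / b).
have eta0 : 0 < eta by rewrite lt_min !divr_gt0 // mulr_gt0.
have ea : eta * a <= c / 2.
  have : eta <= c / (2 * a) by rewrite ge_min lexx.
  by rewrite invfM mulrA ler_pdivlMr.
have eb : eta * b <= c' by rewrite -ler_pdivlMr // ge_min lexx orbT.
exists eta => // x xi z w zE wE.
have := dX x w; have := dY xi z; have := dz x w; rewrite -wE -zE.
have hX : eta * qf X x <= c / 2 * normsq x.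
  apply: (@le_trans _ _ (eta * (a * normsq x))).
    by rewrite ler_pM2l // (le_trans (ler_norm _)).
  by rewrite mulrA ler_wpM2r ?normsq_ge0.
have hY : eta * qf Y xi <= c' * normsq xi.
  apply: (@le_trans _ _ (eta * (b * normsq xi))).
    by rewrite ler_pM2l // (le_trans (ler_norm _)).
  by rewrite mulrA ler_wpM2r ?normsq_ge0.
have := normsq_ge0 x; have := normsq_ge0 w; have := normsq_ge0 z.
rewrite [eta * _]mulrDr; move: hX hY.
move: (eta * qf X x) (eta * qf Y xi) (normsq x) (normsq w) (normsq z) (normsq xi) (qf Pi _)
  (_ 0 0) (_ 0 0) => q1 q2 nx nw nz nxi pi s1 s2 h1 h2 z0 w0 x0 zle.
have : c / (2 * kappa) * nz <= c / 2 * (nx + nw).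
  rewrite (_ : c / 2 * _ = c / (2 * kappa) * (kappa * (nx + nw))); last first.
    by field; rewrite gt_eqF.
  by apply: ler_wpM2l zle; rewrite divr_ge0 ?mulr_ge0 ?ltW.
have cw : 0 <= c * nw by rewrite mulr_ge0 // ltW.
lra.
Qed.
End energy.

Theorem theorem9 (R : realType) (n k nu : nat)
    (A : 'M[R]_n) (B : 'M[R]_(n, k)) (C : 'M[R]_(k, n)) (D : 'M[R]_(k, k))
    (Qb Sb Rb : 'M[R]_nu) :
  let P0 := block_mx Qb Sb Sb^T Rb in
  mx_symmetric P0 ->
  mx_negsemidef Rb ->
  (exists (X : 'M[R]_n) (M : 'M[R]_(nu * k)),
     mx_posdef M /\ mx_posdef X /\
     let L1 := block_mx 1%:M 0 A B in
     let L2 := block_mx C D 0 1%:M in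
     mx_negdef (L1^T *m block_mx 0 X X 0 *m L1
                + L2^T *m P_mult P0 M *m L2)) ->
  robustly_stable A B C D (V_set k P0).
Proof.
move=> P0 sP [_ Rb0] [X [M [[sM posM] [[sX posX] lmi]]]].
have psdM x : 0 <= qf M x.
  have [->|/posM/ltW //] := eqVneq x 0.
  by rewrite /qf mulmx0 mxE.
pose Pi := P_mult P0 M.
have sPi : Pi^T = Pi by exact: P_mult_sym.
have [c c0 diss] := lmi_dissipation sX lmi.
have corner y : qf Pi (col_mx 0 y) <= 0.
  apply: P_mult_corner => // y'.
  rewrite /qf /P0 tr_col_mx mul_row_block trmx0 !mul0mx !add0r mul_row_col mulmx0 add0r.
  exact: Rb0.
split.
  apply: (well_posed_of_lmi sP sM psdM) => w w0.
  have n0 : normsq (0 : 'cV[R]_n) = 0 by rewrite /normsq big1 // => i _; rewrite mxE expr0n.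
  have := diss 0 w; rewrite trmx0 !mul0mx mulmx0 [_ 0 0]mxE mulr0 !add0r n0 add0r.
  by move=> /le_lt_trans; apply; rewrite oppr_lt0 mulr_gt0 // normsq_gt0.
have [a a0 aP] := qf_lower_bound posX.
have [b b0 bP] := qf_upper_bound X.
have [kappa k0 zle] := output_bound C D.
(* [a] and [b] compare the quadratic form of [X] with the squared norm. *)
exists (Num.sqrt (b / a)); first by rewrite sqrtr_gt0 divr_gt0.
move=> Delta DeltaP x z w [acx z2 _ [dx zE wE]].
have [m [A' [B' [C' [hA' markov freq]]]]] := hurwitz_realization DeltaP.
(* Half of the margin [c] pays for a perturbation of the supply rate of this
   size. *)
have e0 : 0 < c / (2 * kappa) by rewrite divr_gt0 // mulr_gt0.
have [|Y [c' [sY psdY c'0 storage]]] := storage_exists sPi e0 hA' corner (B := B') (C0 := C') (D := lti_D Delta).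
  move=> xi u xu0 h; have [u0 [v vP ->]] := freq xi u xu0 h; split => //.
  by rewrite -{1}[u]scale1r; exact: P_mult_psd.
have [eta eta0 decr] := energy_decrease c0 c'0 k0 diss storage zle.
(* The uncertainty starts at rest, so that its storage function does not
   contribute to [f 0]. *)
pose xi := response A' B' z.
pose f t := expR (eta * t) * (qf X (x t) + qf Y (xi t)).
have acf : abs_continuous f.
  apply: ac_mul; first exact: ac_expRM.
  apply: ac_add; apply: ac_qf => i; last exact: response_ac.
  exact: loc_abs_continuous_entry.
have f_le T : 0 <= T -> f T <= f 0.
  apply: (ac_nonincreasing acf).
  have dxi := response_derive A' B' z2.
  have aeF := ae_filter_ringOfSetsType (@lebesgue_measure R).
  apply: (@filterS2 _ _ aeF _ _ _ _ (@filterI _ _ aeF _ _ dx zE) (@filterI _ _ aeF _ _ wE dxi)).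
  move=> t [{}dx {}zE] [{}wE {}dxi] t0.
  have dX := qf_derive sX (fun i => is_derive_entry i (dx t0)).
  have dY := qf_derive sY (dxi t0).
  exists (eta * expR (eta * t) * (qf X (x t) + qf Y (xi t)) +
     expR (eta * t) * (2 * ((x t)^T *m X *m (A *m x t + B *m w t)) 0 0 +
       2 * ((xi t)^T *m Y *m (A' *m xi t + B' *m z t)) 0 0)).
    exact: (is_derive_prod (is_derive_expRM eta t) (is_deriveD dX dY)).
  rewrite [eta * _]mulrC -mulrA -mulrDr pmulr_rle0 ?expR_gt0 //.
  apply: decr; first exact/zE/ltW.
  by rewrite [LHS](wE (ltW t0)) (io_map_response _ z2 markov).
have bound t : 0 <= t -> expR (eta * t) * normsq (x t) <= b / a * normsq (x 0).
  move=> t0; have := f_le t t0.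
  rewrite /f mulr0 expR0 mul1r /xi response0 [qf Y 0](_ : _ = 0) ?addr0; last first.
    by rewrite /qf mulmx0 mxE.
  move=> h; rewrite -(ler_pM2l a0) [X in _ <= X]mulrA [a * (_ / _)]mulrC divfK ?gt_eqF //.
  apply: le_trans (bP (x 0)); apply: le_trans (ler_norm _); apply: le_trans h.
  rewrite mulrCA ler_pM2l ?expR_gt0 //; apply: (le_trans (aP _)).
  by rewrite lerDl.
split; first exact: exp_decay_cvg0 bound.
move=> t t0; rewrite -(@ler_pXn2r _ 2) ?nnegrE ?mulr_ge0 ?sqrtr_ge0 //.
rewrite exprMn !norm2_sqr sqr_sqrtr; last by rewrite divr_ge0 ?ltW.
apply: le_trans (bound t t0); rewrite ler_peMl ?normsq_ge0 //.
by rewrite -expR0 ler_expR mulr_ge0 // ltW.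
Qed.
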